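(* Let $\tau=c_1+ic_2$ with $c_1,c_2\in\mathbb{R}$, $c_2\neq 0$, let $\Lambda=\mathbb{Z}\,2\pi+\mathbb{Z}\,\tau\subset\mathbb{C}$, let $z=re^{i\theta}\in\mathbb{C}\setminus\mathbb{R}$ ($r>0$, $\theta\in\mathbb{R}$) be a constant, and put $a+ib=c_1+\frac{z-z^{-1}}{2}c_2$. Let $V=(v_{ij}):\mathbb{C}\to\mathcal{M}^0_{n\times k}(\mathbb{C})$ be a meromorphic map each of whose entries $v_{ij}$ is an elliptic function with periods $2\pi$ and $a+ib$. Let $\pi(x,y,t)$ be the Hermitian projection of $\mathbb{C}^n$ onto the subspace spanned by the columns of $V(w)$, $w=x+\frac{z-z^{-1}}{2}y+\frac{z+z^{-1}}{2}t$. Then the extended $1$-soliton solution $h_{z,\pi}$ is doubly periodic in the space variables with periods $2\pi$ and $\tau$ (where $(x,y)\in\mathbb{R}^2$ is identified with $x+iy\in\mathbb{C}$), and the associated $1$-soliton $$J_{z,V}=e^{2ik\theta/n}\,h_{z,\pi}(0)^{-1}=e^{2ik\theta/n}\left(\pi^\perp+e^{-2i\theta}\pi\right)$$ is a Ward map from $(\mathbb{C}/\Lambda)\times\mathbb{R}$ to $SU(n)$. Moreover: (1) if $r\neq 1$ and there exist integers $m_1,m_2$ with $m_2\ne 0$ such that $$\frac{2\cos\theta}{r-r^{-1}}=\frac{2\pi m_1+m_2c_1}{m_2c_2},$$ then $J_{z,V}$ is periodic in time with period $T=\frac{m_2c_2(r+r^{-1})}{r-r^{-1}}$; (2) if $r=1$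 and $\cos\theta\neq 0$, then $J_{z,V}$ is periodic in time with period $T=\frac{2\pi}{\cos\theta}$.
   Context: A Ward map is a smooth map $J$ from $\mathbb{R}^{2,1}$ (coordinates $x,y,t$) to $SU(n)$ satisfying the Ward equation $$(J^{-1}J_t)_t-(J^{-1}J_x)_x-(J^{-1}J_y)_y-[J^{-1}J_t,J^{-1}J_y]=0 .$$ A Ward map from $(\mathbb{C}/\Lambda)\times\mathbb{R}$ is one that is invariant under translation of $(x,y)$ by elements of $\Lambda$. Set $u=\frac{t+y}{2}$, $v=\frac{t-y}{2}$. Thus $x+\frac{z-z^{-1}}{2}y+\frac{z+z^{-1}}{2}t=x+zu+z^{-1}v$. An extended Ward map (extended solution) is a map $\psi(x,y,t,\lambda)\in GL(n,\mathbb{C})$ such that $(\lambda\psi_x-\psi_u)\psi^{-1}$ and $(\lambda\psi_v-\psi_x)\psi^{-1}$ are independent of $\lambda$ and $\psi(x,y,t,\bar\lambda)^*\psi(x,y,t,\lambda)=I$. $\mathcal{M}^0_{n\times k}(\mathbb{C})$ is the space of complex $n\times k$ matrices of rank $k$. A meromorphic map $V:\mathbb{C}\to\mathcal{M}^0_{n\times k}(\mathbb{C})$ is one with meromorphic entries and rank $k$ (away from poles); the column span, a holomorphic map into the Grassmannian $\mathrm{Gr}(k,\mathbb{C}^n)$, is extended holomorphically across the (isolated) exceptional points, so that the projection $\pi$ is smooth. For a Hermitian projection $\pi$ of $\mathbb{C}^n$, $\pi^\perp=I-\pi$ and $h_{z,\pi}(\lambda)=\pi^\perp+\frac{\lambda-z}{\lambda-\bar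 z}\pi$. With $\pi=\pi(x,y,t)$ as in the claim, $h_{z,\pi(x,y,t)}(\lambda)$ is called an extended $1$-soliton solution. ''Period'' in time means $J(x,y,t+T)=J(x,y,t)$ for all $x,y,t$ (no minimality or positivity of $T$ is claimed). *)

(* Defs.v *)
From HB Require Import structures.
From mathcomp Require Import all_boot all_order all_algebra.
From mathcomp Require Import spectral complex.
From mathcomp Require Import all_classical all_reals all_analysis.

Set Implicit Arguments.
Unset Strict Implicit.
Unset Printing Implicit Defensive.
Import Order.TTheory GRing.Theory Num.Theory.
Import numFieldNormedType.Exports.

Local Open Scope classical_set_scope.
Local Open Scope ring_scope.
Local Open Scope complex_scope.
Local Open Scope sesquilinear_scope.

Section complex_analysis.
Variable R : realType.
Local Notation C := R[i].
Implicit Types (f g : C -> C) (w : C).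

(* The norm, topology and (complex) derivative on [R[i]] are those of the      *)
(* one-dimensional normed module [R[i]^o] over the field [R[i]].               *)
Definition holomorphic_at f w0 : Prop :=
  \forall w \near (w0 : C^o), derivable (f : C^o -> C^o) w 1.

(* Functions are total: the value of [f] at an isolated singularity is junk.   *)
Definition meromorphic_at f w0 : Prop :=
  exists N : nat, exists2 g, holomorphic_at g w0 &
    \forall w \near (w0 : C^o)^', f w = g w / (w - w0) ^+ N.

Definition meromorphic f : Prop := forall w, meromorphic_at f w.

(* Equality of meromorphic functions, hence tested away from the poles.        *)
Definition meromorphic_period f (om : C) : Prop :=
  forall w, holomorphic_at f w -> holomorphic_at f (w + om) ->
    f (w + om) = f w.

Definition elliptic f (om1 om2 : C) : Prop :=
  [/\ meromorphic f, complex.Im (om2 / om1) != 0,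
      meromorphic_period f om1 & meromorphic_period f om2].

Definition holomorphic_mx_at m p (W : C -> 'M[C]_(m, p)) w0 : Prop :=
  forall i j, holomorphic_at (fun w => W w i j) w0.

Definition meromorphic_full_rank n k (V : C -> 'M[C]_(n, k)) : Prop :=
  (forall i j, meromorphic (fun w => V w i j)) /\
  (forall w, holomorphic_mx_at V w -> \rank (V w) = k).

Definition colspan m p (A : 'M[C]_(m, p)) : {vspace 'cV[C]_m} :=
  <<[seq col j A | j : 'I_p]>>%VS.

(* A map into Gr(k, C^n) is holomorphic when it locally is the column span of  *)
(* a holomorphic matrix of rank k.                                             *)
Definition holomorphic_Gr n k (L : C -> {vspace 'cV[C]_n}) : Prop :=
  forall w0, exists2 W : C -> 'M[C]_(n, k), holomorphic_mx_at W w0 &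
    \forall w \near (w0 : C^o), \rank (W w) = k /\ L w = colspan (W w).

(* [L] is the column span of [V], extended holomorphically across the poles.   *)
Definition extended_colspan n k (V : C -> 'M[C]_(n, k))
    (L : C -> {vspace 'cV[C]_n}) : Prop :=
  holomorphic_Gr k L /\
  (forall w, holomorphic_mx_at V w -> L w = colspan (V w)).

Definition hermitian_projection_onto n (P : 'M[C]_n)
    (U : {vspace 'cV[C]_n}) : Prop :=
  [/\ P ^t* = P, P *m P = P & colspan P = U].

Definition expi (a : R) : C := cos a +i* sin a.

Definition lattice (om1 om2 : C) : set C :=
  [set w | exists m1 m2 : int, w = om1 *~ m1 + om2 *~ m2].

End complex_analysis.

Section spacetime.
Variable R : realType.
Local Notation C := R[i].

(* C^m in (x, y, t): all iterated partial derivatives of order at most m exist *)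
(* and are jointly continuous.                                                 *)
Fixpoint Ck (m : nat) (g : R -> R -> R -> R) : Prop :=
  continuous (fun p : R * R * R => g p.1.1 p.1.2 p.2) /\
  if m isn't m'.+1 then True else
  [/\ forall x y t, [/\ derivable (fun s => g s y t) x 1,
                        derivable (fun s => g x s t) y 1 &
                        derivable (fun s => g x y s) t 1],
      Ck m' (fun x y t => derive1 (fun s => g s y t) x),
      Ck m' (fun x y t => derive1 (fun s => g x s t) y) &
      Ck m' (fun x y t => derive1 (fun s => g x y s) t)].

Definition smooth n (F : R -> R -> R -> 'M[C]_n) : Prop :=
  forall m i j, Ck m (fun x y t => complex.Re (F x y t i j)) /\
                Ck m (fun x y t => complex.Im (F x y t i j)).

Definition mx_derive n (F : R -> 'M[C]_n) (s0 : R) : 'M[C]_n :=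
  \matrix_(i, j) (derive1 (fun s => complex.Re (F s i j)) s0 +i*
                  derive1 (fun s => complex.Im (F s i j)) s0).

Section partial.
Variables (n : nat) (F : R -> R -> R -> 'M[C]_n).

Definition Dx x y t := mx_derive (fun s => F s y t) x.
Definition Dy x y t := mx_derive (fun s => F x s t) y.
Definition Dt x y t := mx_derive (fun s => F x y s) t.

(* Partial derivatives in the coordinates (x, u, v), where u = (t + y) / 2 and *)
(* v = (t - y) / 2, i.e. y = u - v and t = u + v.                              *)
Definition Du x y t :=
  let v := (t - y) / 2 in mx_derive (fun u => F x (u - v) (u + v)) ((t + y) / 2).
Definition Dv x y t :=
  let u := (t + y) / 2 in mx_derive (fun v => F x (u - v) (u + v)) ((t - y) / 2).

(* (x, y) is identified with x + iy. *)
Definition space_period (om : C) : Prop :=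
  forall x y t, F (x + complex.Re om) (y + complex.Im om) t = F x y t.

Definition time_period (T : R) : Prop :=
  forall x y t, F x y (t + T) = F x y t.

End partial.

Definition SU n : set 'M[C]_n := [set A | A \is unitarymx /\ \det A = 1].

Definition ward_equation n (J : R -> R -> R -> 'M[C]_n) : Prop :=
  let A x y t := invmx (J x y t) *m Dt J x y t in
  let B x y t := invmx (J x y t) *m Dx J x y t in
  let E x y t := invmx (J x y t) *m Dy J x y t in
  forall x y t,
    Dt A x y t - Dx B x y t - Dy E x y t
      - (A x y t *m E x y t - E x y t *m A x y t) = 0.

Definition ward_map n (J : R -> R -> R -> 'M[C]_n) : Prop :=
  [/\ smooth J, forall x y t, SU (J x y t) & ward_equation J].

Definition ward_map_mod (Lam : set C) n (J : R -> R -> R -> 'M[C]_n) : Prop :=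
  ward_map J /\ (forall om, Lam om -> space_period J om).

(* The spectral parameter ranges over [D]; extended solutions are in general   *)
(* undefined or singular at some values of it.                                 *)
Definition extended_ward_map (D : set C) n
    (psi : R -> R -> R -> C -> 'M[C]_n) : Prop :=
  let psi_ lam x y t := psi x y t lam in
  [/\ forall lam, D lam -> smooth (psi_ lam),
      forall x y t lam, D lam -> psi x y t lam \in unitmx,
      forall x y t lam1 lam2, D lam1 -> D lam2 ->
        let A lam := (lam *: Dx (psi_ lam) x y t - Du (psi_ lam) x y t)
                       *m invmx (psi x y t lam) in
        A lam1 = A lam2,
      forall x y t lam1 lam2, D lam1 -> D lam2 ->
        let B lam := (lam *: Dv (psi_ lam) x y t - Dx (psi_ lam) x y t)
                       *m invmx (psi x y t lam) in
        B lam1 = B lam2 &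
      forall x y t lam, D lam -> D (lam^*)%R ->
        (psi x y t (lam^*)%R) ^t* *m psi x y t lam = 1%:M].

Definition soliton_var (z : C) (x y t : R) : C :=
  x%:C + (z - z^-1) / 2 * y%:C + (z + z^-1) / 2 * t%:C.

Definition simple_element (z : C) n (P : 'M[C]_n) (lam : C) : 'M[C]_n :=
  (1%:M - P) + ((lam - z) / (lam - (z^*)%R)) *: P.

Definition extended_1_soliton (z : C) n (P : R -> R -> R -> 'M[C]_n)
    (x y t : R) (lam : C) : 'M[C]_n := simple_element z (P x y t) lam.

Definition one_soliton (z : C) (theta : R) (k n : nat)
    (P : R -> R -> R -> 'M[C]_n) (x y t : R) : 'M[C]_n :=
  expi (2 * k%:R * theta / n%:R) *: invmx (extended_1_soliton z P x y t 0).

End spacetime.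

(* Main.v *)
Require Import Defs.
From HB Require Import structures.
From mathcomp Require Import all_boot all_order all_algebra.
From mathcomp Require Import spectral complex.
From mathcomp Require Import all_classical all_reals all_analysis.
From mathcomp Require Import ring lra.
Set Implicit Arguments.
Unset Strict Implicit.
Unset Printing Implicit Defensive.
Import Order.TTheory GRing.Theory Num.Theory.
Import numFieldNormedType.Exports.
Local Open Scope classical_set_scope.
Local Open Scope ring_scope.
Local Open Scope complex_scope.

(* The span of the columns of V is locally the span of a holomorphic frame W(w),
   so the projection is P = W (W^* W)^-1 W^*, and P is smooth because holomorphic
   functions are.  Mere complex differentiability is upgraded in two steps:
   Goursat's bisection on rectangles yields a primitive F of f, and for such F
   with continuous derivative f the identity
     2 pi r f(w) = \int_0^(2 pi) F(w + r e^(it)) e^(-it) dt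
   can be differentiated in w under the integral sign, so that f is again
   continuously differentiable.
   With X = P_x P and Y = P P_x, differentiating P W = W gives
   P_d = nu X + nu^* Y in every direction d, where nu is the derivative of w
   along d.  The extended solution and the Ward equation then reduce to identities
   between scalars.  Periodicity of the column span holds away from the poles of V
   by assumption and everywhere by continuity, and the time periods are the T for
   which the shift of w lies in the period lattice. *)

(** * Complex-valued functions of a real variable *)

Section complex_line.
Variable R : realType.
Local Notation C := R[i].
Local Notation Re := (@complex.Re R).
Local Notation Im := (@complex.Im R).

(** [holomorphic_at] gives complex derivatives pointwise and nothing about their continuity, while
    smoothness asks for partial derivatives of every order; closing this gap is the purpose of the
    analytic half. The circle integral expresses f through its primitive F, so the function
    differentiated under the integral sign is F, whose derivative f is already known to be
    continuous, and the argument can be iterated. The algebraic half works because w is a null plane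
    wave: its derivatives satisfy nu_t^2 = nu_x^2 + nu_y^2, so the genuine second derivatives of P
    cancel in the Ward equation, whatever V is. X and Y are the two off-diagonal blocks of P_x with
    respect to the image and the kernel of P, so multiplication by 1 - P + f P only rescales them,
    and everything left is a scalar identity in z and its conjugate. Since P depends on (x, y, t)
    only through w, a time shift and a space shift that move w by the same amount have the same
    effect. This is how space periods turn into time periods. *)

Definition iC : C := 0 +i* 1.

Definition cplx (a b : R) : C := a +i* b.

(** The library norm of [R[i]] takes its values in [R[i]]. This one is real, submultiplicative, and
    free of square roots, so that estimates can be made componentwise in the ordered field [R]. *)
Definition norm1 (h : C) : R := `|Re h| + `|Im h|.

Lemma complex_eqP (a b : C) : Re a = Re b -> Im a = Im b -> a = b.
Proof. by case: a b => [? ?] [? ?] /= -> ->. Qed.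

Lemma ReD (a b : C) : Re (a + b) = Re a + Re b.
Proof. by case: a b => [? ?] [? ?]. Qed.
Lemma ImD (a b : C) : Im (a + b) = Im a + Im b.
Proof. by case: a b => [? ?] [? ?]. Qed.
Lemma ReN (a : C) : Re (- a) = - Re a. Proof. by case: a. Qed.
Lemma ImN (a : C) : Im (- a) = - Im a. Proof. by case: a. Qed.
Lemma ReM (a b : C) : Re (a * b) = Re a * Re b - Im a * Im b.
Proof. by case: a b => [? ?] [? ?]. Qed.
Lemma ImM (a b : C) : Im (a * b) = Re a * Im b + Im a * Re b.
Proof. by case: a b => [? ?] [? ?]. Qed.
Lemma ReC (a : R) : Re a%:C = a. Proof. by []. Qed.
Lemma ImC (a : R) : Im a%:C = 0. Proof. by []. Qed.
Lemma ReMk (a b : R) : Re (cplx a b) = a. Proof. by []. Qed.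
Lemma ImMk (a b : R) : Im (cplx a b) = b. Proof. by []. Qed.
Lemma Re0 : Re 0 = 0. Proof. by []. Qed.
Lemma Im0 : Im 0 = 0. Proof. by []. Qed.
Lemma Re1 : Re 1 = 1. Proof. by []. Qed.
Lemma Im1 : Im 1 = 0. Proof. by []. Qed.
Lemma Rei : Re iC = 0. Proof. by []. Qed.
Lemma Imi : Im iC = 1. Proof. by []. Qed.
Lemma ReJ (a : C) : Re (conjc a) = Re a. Proof. by case: a. Qed.
Lemma ImJ (a : C) : Im (conjc a) = - Im a. Proof. by case: a. Qed.
Definition ReImE := (ReD, ImD, ReN, ImN, ReM, ImM, ReC, ImC, Re0, Im0, Re1, Im1,
  Rei, Imi, ReJ, ImJ, ReMk, ImMk).

Lemma norm1_ge0 h : 0 <= norm1 h. Proof. by rewrite addr_ge0. Qed.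
Lemma norm10 : norm1 0 = 0. Proof. by rewrite /norm1 !normr0 addr0. Qed.
Lemma norm1_eq0 h : norm1 h = 0 -> h = 0.
Proof.
move=> /eqP; rewrite paddr_eq0// => /andP[/eqP/normr0_eq0 a /eqP/normr0_eq0 b].
exact: complex_eqP.
Qed.
Lemma norm1N h : norm1 (- h) = norm1 h.
Proof. by rewrite /norm1 !ReImE !normrN. Qed.
Lemma norm1D a b : norm1 (a + b) <= norm1 a + norm1 b.
Proof.
by rewrite /norm1 !ReImE addrACA lerD// ler_normD.
Qed.
Lemma norm1B a b : norm1 (a - b) <= norm1 a + norm1 b.
Proof. by rewrite (le_trans (norm1D _ _))// norm1N. Qed.
Lemma norm1M a b : norm1 (a * b) <= norm1 a * norm1 b.
Proof.
rewrite /norm1 !ReImE.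
have -> : (`|Re a| + `|Im a|) * (`|Re b| + `|Im b|) =
  (`|Re a * Re b| + `|Im a * Im b|) + (`|Re a * Im b| + `|Im a * Re b|).
  by rewrite !normrM; ring.
by rewrite lerD// ?ler_normD// ler_normB.
Qed.
Lemma norm1C (x : R) : norm1 x%:C = `|x|.
Proof. by rewrite /norm1 /= normr0 addr0. Qed.
Lemma norm1Cl (x : R) a : norm1 (x%:C * a) = `|x| * norm1 a.
Proof. by rewrite /norm1 !ReImE !mul0r subr0 addr0 !normrM mulrDr. Qed.
Lemma norm1i a : norm1 (iC * a) = norm1 a.
Proof.
by rewrite /norm1 !ReImE !mul0r !mul1r sub0r add0r normrN addrC.
Qed.
Lemma norm1_dist a b : norm1 (a - b) = norm1 (b - a).
Proof. by rewrite -norm1N opprB. Qed.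
Lemma Re_le_norm1 a : `|Re a| <= norm1 a. Proof. by rewrite lerDl. Qed.
Lemma Im_le_norm1 a : `|Im a| <= norm1 a. Proof. by rewrite lerDr. Qed.

(** Stands in for a passage to the limit. The sign of [K] is free, hence the division by [|K| + 1]
    in the proof. *)
Lemma norm1_le_eps a (K : R) : (forall e : R, 0 < e -> norm1 a <= K * e) -> a = 0.
Proof.
move=> H; apply: norm1_eq0; apply/eqP; rewrite eq_le norm1_ge0 andbT.
apply/ler_addgt0Pr => e e0; rewrite add0r.
have K1 : 0 < `|K| + 1 by rewrite ltr_wpDl.
have /H : 0 < e / (`|K| + 1) by rewrite divr_gt0.
move=> /le_trans; apply.
rewrite mulrA ler_pdivrMr// mulrC ler_wpM2l ?ltW//.
by rewrite (le_lt_trans (ler_norm _))// ltrDl.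
Qed.

(** The remainder form has no quotient, so h = 0 is no exception and the same shape serves for
    complex values and complex increments. *)
Lemma is_derive_epsP (f : R -> R) x d :
  is_derive x (1 : R) f d <->
  forall e : R, 0 < e -> exists2 del : R, 0 < del &
    forall h, `|h| < del -> `|f (x + h) - f x - d * h| <= e * `|h|.
Proof.
split=> [[df dv] e e0|H].
  have : (fun h => h^-1 *: ((f \o shift x) (h *: 1) - f x)) @ 0^' --> d.
    by rewrite -dv; exact: df.
  move=> /cvgrPdist_le /(_ e e0); rewrite near_withinE => /nbhs_ballP[del /= del0 B].
  exists del => // h hd.
  have [->|h0] := eqVneq h 0; first by rewrite addr0 subrr mulr0 subrr normr0 mulr0.
  have := B h; rewrite /ball /= sub0r normrN => /(_ hd h0).
  rewrite /= /GRing.scale /= mulr1 (addrC h x) => K.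
  have -> : f (x + h) - f x - d * h = - (d - h^-1 * (f (x + h) - f x)) * h.
    by rewrite mulNr mulrBl mulrAC mulVf// mul1r opprB.
  by rewrite normrM normrN ler_wpM2r.
have K : (fun h => h^-1 *: ((f \o shift x) (h *: 1) - f x)) @ 0^' --> d.
  apply/cvgrPdist_le => e e0; rewrite near_withinE.
  have [del del0 B] := H e e0; apply/nbhs_ballP; exists del => // h.
  rewrite /ball /= sub0r normrN => /B {}B h0.
  rewrite /= /GRing.scale /= mulr1 (addrC h x).
  have h0' : 0 < `|h| by rewrite normr_gt0.
  rewrite -(ler_pM2r h0') -normrM; apply: le_trans B; rewrite -normrN.
  by rewrite le_eqVlt; apply/orP; left; apply/eqP; congr `|_|; field.
by split; [apply: cvgP K|apply: cvg_lim].
Qed.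

(** Componentwise, in agreement with [mx_derive], which differentiates real and imaginary parts
    separately. *)
Definition cder (phi : R -> C) (s : R) (d : C) : Prop :=
  is_derive s (1 : R) (fun s => Re (phi s)) (Re d) /\
  is_derive s (1 : R) (fun s => Im (phi s)) (Im d).

Lemma cderP phi s d : cder phi s d <->
  forall e : R, 0 < e -> exists2 del : R, 0 < del &
    forall h, `|h| < del -> norm1 (phi (s + h) - phi s - d * h%:C) <= e * `|h|.
Proof.
split=> [[/is_derive_epsP r /is_derive_epsP i] e e0|H].
  have e2 : 0 < e / 2 by rewrite divr_gt0.
  have [d1 d10 r1] := r _ e2; have [d2 d20 i1] := i _ e2.
  exists (Num.min d1 d2); first by rewrite lt_min d10.
  move=> h; rewrite lt_min => /andP[/r1 {}r1 /i1 {}i1].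
  rewrite /norm1 !ReImE !mulr0 subr0 add0r.
  rewrite (splitr e) mulrDl lerD//.
split; apply/is_derive_epsP => e e0; have [del d0 B] := H e e0; exists del => // h /B;
  apply: le_trans; rewrite /norm1 !ReImE !mulr0 subr0 add0r ?lerDl ?lerDr//.
Qed.

Lemma cder_unique phi s d d' : cder phi s d -> cder phi s d' -> d = d'.
Proof.
move=> [[_ a] [_ b]] [[_ a'] [_ b']]; apply: complex_eqP.
  by rewrite -a -a'.
by rewrite -b -b'.
Qed.

Lemma cder_eq phi s d d' : cder phi s d -> d = d' -> cder phi s d'.
Proof. by move=> H <-. Qed.

Lemma cder_near phi psi s d :
  (exists2 del : R, 0 < del & forall h, `|h| < del -> psi (s + h) = phi (s + h)) ->
  cder phi s d -> cder psi s d.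
Proof.
move=> [del d0 E] /cderP H; apply/cderP => e /H [d1 d10 B].
exists (Num.min del d1); first by rewrite lt_min d0.
move=> h; rewrite lt_min => /andP[/E -> /B].
by have := E 0; rewrite normr0 !addr0 => ->.
Qed.

Lemma cder_cst c s : cder (fun=> c) s 0.
Proof. by split; apply: is_derive_cst. Qed.

Lemma cder_id s : cder (fun s => s%:C) s 1.
Proof. by split; [apply: is_derive_id|apply: is_derive_cst]. Qed.

Lemma cderD p q s d e : cder p s d -> cder q s e ->
  cder (fun s => p s + q s) s (d + e).
Proof.
move=> [a b] [a' b']; split.
  under eq_fun do rewrite ReD; rewrite ReD; exact: is_deriveD.
under eq_fun do rewrite ImD; rewrite ImD; exact: is_deriveD.
Qed.

Lemma cderN p s d : cder p s d -> cder (fun s => - p s) s (- d).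
Proof.
move=> [a b]; split.
  under eq_fun do rewrite ReN; rewrite ReN; exact: is_deriveN.
under eq_fun do rewrite ImN; rewrite ImN; exact: is_deriveN.
Qed.

Lemma cderJ p s d : cder p s d -> cder (fun s => conjc (p s)) s (conjc d).
Proof.
move=> [a b]; split.
  by under eq_fun do rewrite ReJ; rewrite ReJ.
under eq_fun do rewrite ImJ; rewrite ImJ; exact: is_deriveN.
Qed.

Lemma cderB p q s d e : cder p s d -> cder q s e ->
  cder (fun s => p s - q s) s (d - e).
Proof. by move=> a b; apply: cderD => //; apply: cderN. Qed.

Lemma cderM p q s d e : cder p s d -> cder q s e ->
  cder (fun s => p s * q s) s (d * q s + p s * e).
Proof.
move=> [a b] [a' b']; split.
  under eq_fun do rewrite ReM.
  apply: is_derive_eq; rewrite !ReImE /= /GRing.scale /=; ring.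
under eq_fun do rewrite ImM.
apply: is_derive_eq; rewrite !ReImE /= /GRing.scale /=; ring.
Qed.

Lemma ReV (a : C) : Re a^-1 = Re a / (Re a ^+ 2 + Im a ^+ 2).
Proof. by case: a. Qed.
Lemma ImV (a : C) : Im a^-1 = - Im a / (Re a ^+ 2 + Im a ^+ 2).
Proof. by case: a => a b; rewrite /= mulNr. Qed.
Lemma sqr_neq0 (a : C) : a != 0 -> Re a ^+ 2 + Im a ^+ 2 != 0.
Proof.
apply: contra; rewrite paddr_eq0 ?sqr_ge0// !sqrf_eq0 => /andP[/eqP ? /eqP ?].
by apply/eqP/complex_eqP.
Qed.

Lemma cderV p s d : p s != 0 -> cder p s d ->
  cder (fun s => (p s)^-1) s (- d / (p s) ^+ 2).
Proof.
move=> p0 [a b]; have n0 := sqr_neq0 p0.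
have E : is_derive s (1 : R) (fun s => (Re (p s) ^+ 2 + Im (p s) ^+ 2)^-1)
   (- (Re (p s) ^+ 2 + Im (p s) ^+ 2) ^- 2 *
     (2 * Re (p s) * Re d + 2 * Im (p s) * Im d)).
  have : is_derive s (1 : R) (fun s => Re (p s) ^+ 2 + Im (p s) ^+ 2)
    (2 * Re (p s) * Re d + 2 * Im (p s) * Im d).
    apply: is_derive_eq; rewrite /= /GRing.scale /=; ring.
  by move=> K; apply: is_derive_eq.
split.
  under eq_fun do rewrite ReV.
  apply: is_derive_eq; rewrite !expr2 !ReImE ReV ImV !ReImE /GRing.scale /=.
  field; rewrite n0 andbT.
  have := sqr_neq0 (mulf_neq0 p0 p0); rewrite !ReImE => H.
  by move: H; congr (_ != 0); ring.
under eq_fun do rewrite ImV.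
apply: is_derive_eq; rewrite !expr2 !ReImE ReV ImV !ReImE /GRing.scale /=.
field; rewrite n0 andbT.
have := sqr_neq0 (mulf_neq0 p0 p0); rewrite !ReImE => H.
by move: H; congr (_ != 0); ring.
Qed.

Lemma cder_expi s : cder (@expi R) s (iC * expi s).
Proof.
split.
  rewrite !ReImE /= mul0r mul1r sub0r; exact: is_derive_cos.
rewrite !ReImE /= mul0r mul1r add0r; exact: is_derive_sin.
Qed.

Lemma cder_affine (p : R -> C) (a b s : R) d : cder p (a + b * s) d ->
  cder (fun s => p (a + b * s)) s (b%:C * d).
Proof.
move=> /cderP H; apply/cderP => e e0.
have b1 : 0 < `|b| + 1 by rewrite ltr_wpDl.
have [del d0 B] := H (e / (`|b| + 1)) (divr_gt0 e0 b1).
exists (del / (`|b| + 1)); first exact: divr_gt0.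
move=> h hd; have hb : `|b * h| < del.
  rewrite normrM; apply: le_lt_trans (_ : (`|b| + 1) * `|h| < _).
    by rewrite ler_wpM2r// lerDl.
  by rewrite mulrC -ltr_pdivlMr.
have := B _ hb; rewrite mulrDr addrA => K.
have -> : b%:C * d * h%:C = d * (b * h)%:C.
  by apply: complex_eqP; rewrite !ReImE; ring.
apply: le_trans K _; rewrite normrM mulrA ler_wpM2r//.
rewrite mulrAC ler_pdivrMr// ler_wpM2l ?ltW//.
by rewrite ltrDl.
Qed.

Lemma is_derive_cont (f : R -> R) x d : is_derive x (1 : R) f d -> {for x, continuous f}.
Proof.
by move=> [df _]; apply/differentiable_continuous/derivable1_diffP.
Qed.

Lemma MVT_ineq (f df : R -> R) (a b M : R) : a <= b ->
  (forall x, a <= x <= b -> is_derive x (1 : R) f (df x)) ->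
  (forall x, a <= x <= b -> `|df x| <= M) -> `|f b - f a| <= M * (b - a).
Proof.
move=> ab Hd Hb.
have cf : {within `[a, b], continuous f}.
  apply: continuous_in_subspaceT => x; rewrite inE /= in_itv /= => /Hd.
  exact: is_derive_cont.
have Hd' x : x \in `]a, b[%R -> is_derive x 1 f (df x).
  by rewrite in_itv /= => /andP[? ?]; apply: Hd; rewrite !ltW.
have [c cab ->] := MVT_segment ab Hd' cf.
by rewrite normrM (ger0_norm (_ : 0 <= b - a)) ?subr_ge0// ler_wpM2r ?subr_ge0// Hb.
Qed.

(** The mean value theorem has no equality form for complex values; using it on each component costs
    the factor 2, which reappears in all later constants. *)
Lemma cder_ineq (f df : R -> C) (a b M : R) : a <= b ->
  (forall x, a <= x <= b -> cder f x (df x)) ->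
  (forall x, a <= x <= b -> norm1 (df x) <= M) ->
  norm1 (f b - f a) <= 2 * M * (b - a).
Proof.
move=> ab Hd Hb; rewrite /norm1 !ReImE mulr2n mulrDl mul1r mulrDl lerD//.
  apply: (@MVT_ineq (fun x => Re (f x)) (fun x => Re (df x))) => // x xab.
    by have [] := Hd x xab.
  exact: le_trans (Re_le_norm1 _) (Hb x xab).
apply: (@MVT_ineq (fun x => Im (f x)) (fun x => Im (df x))) => // x xab.
  by have [] := Hd x xab.
exact: le_trans (Im_le_norm1 _) (Hb x xab).
Qed.

Lemma cder_ineq_sym (f df : R -> C) (a b M : R) :
  (forall x, Num.min a b <= x <= Num.max a b -> cder f x (df x)) ->
  (forall x, Num.min a b <= x <= Num.max a b -> norm1 (df x) <= M) ->
  norm1 (f b - f a) <= 2 * M * `|b - a|.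
Proof.
have [ab|ba] := leP a b => Hd Hb.
  by rewrite ger0_norm ?subr_ge0//; apply: cder_ineq Hb.
have ab := ltW ba.
rewrite distrC ger0_norm ?subr_ge0// (norm1_dist (f b)).
exact: cder_ineq Hd Hb.
Qed.

Lemma cder0_const (f : R -> C) a b : a <= b ->
  (forall x, a <= x <= b -> cder f x 0) -> f b = f a.
Proof.
move=> ab H; apply/eqP; rewrite -subr_eq0; apply/eqP.
apply: (@norm1_le_eps _ 0) => e _.
have := @cder_ineq f (fun=> 0) a b 0 ab H; rewrite mulr0 !mul0r; apply.
by move=> x _; rewrite norm10.
Qed.

(** Complex differentiability with derivative [e]; [derivable_cdiffP] identifies it with the library
    notion. *)
Definition cdiff (F : C -> C) (w e : C) : Prop :=
  forall eps : R, 0 < eps -> exists2 del : R, 0 < del &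
    forall h, norm1 h < del -> norm1 (F (w + h) - F w - e * h) <= eps * norm1 h.

Definition ccont (F : C -> C) (w : C) : Prop :=
  forall eps : R, 0 < eps -> exists2 del : R, 0 < del &
    forall h, norm1 h < del -> norm1 (F (w + h) - F w) <= eps.

Lemma cdiff_ccont F w e : cdiff F w e -> ccont F w.
Proof.
move=> H eps e0; have [del d0 B] := H 1 ltr01.
have n1 : 0 < 1 + norm1 e by rewrite ltr_pwDl// norm1_ge0.
exists (Num.min del (eps / (1 + norm1 e))); first by rewrite lt_min d0 divr_gt0.
move=> h; rewrite lt_min => /andP[/B hd]; rewrite ltr_pdivlMr// => he.
rewrite -(subrK (e * h) (F (w + h) - F w)).
apply: le_trans (norm1D _ _) _; apply: le_trans (lerD hd (norm1M _ _)) _.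
by rewrite -mulrDl mulrC ltW.
Qed.

Lemma cder_comp F phi s d e : cder phi s d -> cdiff F (phi s) e ->
  cder (fun s => F (phi s)) s (e * d).
Proof.
move=> /cderP H D; apply/cderP => eps e0.
pose K := 1 + norm1 d.
have K0 : 0 < K by rewrite /K ltr_pwDl// norm1_ge0.
have L0 : 0 < 2 * (1 + norm1 e).
  by rewrite mulr_gt0// ltr_pwDl// norm1_ge0.
have [d1 d10 B1] := D (eps / (2 * K)) (divr_gt0 e0 (mulr_gt0 (ltr0n _ 2) K0)).
have [d2 d20 B2] := H 1 ltr01.
have [d3 d30 B3] := H (eps / (2 * (1 + norm1 e))) (divr_gt0 e0 L0).
exists (Num.min (Num.min d2 d3) (d1 / K)).
  by rewrite !lt_min d20 d30 divr_gt0.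
move=> h; rewrite !lt_min => /andP[/andP[/B2 h2 /B3 h3]]; rewrite ltr_pdivlMr// => h1.
set k := phi (s + h) - phi s.
have kE : norm1 k <= K * `|h|.
  rewrite -(subrK (d * h%:C) k); apply: le_trans (norm1D _ _) _.
  apply: le_trans (lerD h2 (norm1M _ _)) _; rewrite norm1C /K.
  by rewrite -mulrDl.
have := B1 k; rewrite /k [phi s + _]addrC subrK -/k => /(_ _) B.
have {}B : norm1 (F (phi (s + h)) - F (phi s) - e * k) <= eps / 2 * `|h|.
  apply: le_trans (B _) _; first by apply: le_lt_trans kE _; rewrite mulrC.
  apply: le_trans (ler_wpM2l _ kE) _; first by rewrite divr_ge0 ?ltW// mulr_gt0.
  by rewrite invfM !mulrA [_ / K * K]mulfVK// gt_eqF.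
have -> : F (phi (s + h)) - F (phi s) - e * d * h%:C =
  (F (phi (s + h)) - F (phi s) - e * k) + e * (k - d * h%:C) by ring.
apply: le_trans (norm1D _ _) _; rewrite (splitr eps) mulrDl lerD//.
apply: le_trans (norm1M _ _) _.
apply: le_trans (ler_wpM2l (norm1_ge0 _) h3) _.
rewrite mulrA ler_wpM2r// mulrA ler_pdivrMr//.
rewrite mulrA mulfVK// mulrC ler_wpM2l ?ltW// ltrDr//.
Qed.

End complex_line.
Arguments iC {R}.

(** * Goursat's theorem and primitives *)

Section goursat.
Variable R : realType.
Local Notation C := R[i].
Local Notation Re := (@complex.Re R).
Local Notation Im := (@complex.Im R).

Definition rcont (g : R -> C) (s : R) : Prop :=
  forall eps : R, 0 < eps -> exists2 del : R, 0 < del &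
    forall h : R, `|h| < del -> norm1 (g (s + h) - g s) <= eps.

Lemma rcont_Re g s : rcont g s -> {for s, continuous (fun x => Re (g x))}.
Proof.
move=> H; apply/cvgrPdist_le => e e0; have [del d0 B] := H e e0.
apply/nbhs_ballP; exists del => // x; rewrite /ball /= distrC => /B.
rewrite subrKC => K; rewrite distrC; apply: le_trans K.
by rewrite -ReN -ReD Re_le_norm1.
Qed.

Lemma rcont_Im g s : rcont g s -> {for s, continuous (fun x => Im (g x))}.
Proof.
move=> H; apply/cvgrPdist_le => e e0; have [del d0 B] := H e e0.
apply/nbhs_ballP; exists del => // x; rewrite /ball /= distrC => /B.
rewrite subrKC => K; rewrite distrC; apply: le_trans K.
by rewrite -ImN -ImD Im_le_norm1.
Qed.

Lemma rcont_comp (F : C -> C) g s : rcont g s -> ccont F (g s) ->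
  rcont (fun s => F (g s)) s.
Proof.
move=> H D e e0; have [d1 d10 B1] := D e e0.
have d12 : 0 < d1 / 2 by rewrite divr_gt0.
have [d2 d20 B2] := H _ d12; exists d2 => // h /B2 k.
have := B1 (g (s + h) - g s); rewrite [g s + _]addrC subrK; apply.
by apply: le_lt_trans k _; rewrite ltr_pdivrMr// ltr_pMr// ltrDl.
Qed.

Lemma cder_rcont g s d : cder g s d -> rcont g s.
Proof.
move=> /cderP H eps e0; have [del d0 B] := H 1 ltr01.
have n1 : 0 < 1 + norm1 d by rewrite ltr_pwDl// norm1_ge0.
exists (Num.min del (eps / (1 + norm1 d))); first by rewrite lt_min d0 divr_gt0.
move=> h; rewrite lt_min => /andP[/B hd]; rewrite ltr_pdivlMr// => he.
rewrite -(subrK (d * h%:C) (g (s + h) - g s)).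
apply: le_trans (norm1D _ _) _; apply: le_trans (lerD hd (norm1M _ _)) _.
by rewrite norm1C -mulrDl mulrC ltW.
Qed.

Lemma rcontM g h s : rcont g s -> rcont h s -> rcont (fun s => g s * h s) s.
Proof.
move=> H K e e0.
pose M := 1 + norm1 (g s) + norm1 (h s).
have M0 : 0 < M by rewrite /M -addrA ltr_pwDl// addr_ge0// norm1_ge0.
pose e1 := Num.min 1 (e / (2 * M)).
have M2 : 0 < 2 * M by rewrite mulr_gt0.
have e10 : 0 < e1 by rewrite lt_min ltr01 divr_gt0.
have [d1 d10 B1] := H e1 e10; have [d2 d20 B2] := K e1 e10.
exists (Num.min d1 d2); first by rewrite lt_min d10.
move=> x; rewrite lt_min => /andP[/B1 a /B2 b].
set p := g (s + x) - g s in a *; set q := h (s + x) - h s in b *.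
have -> : g (s + x) * h (s + x) - g s * h s = p * q + (p * h s + g s * q).
  by rewrite /p /q; ring.
have e11 : e1 <= 1 by rewrite ge_min lexx.
have e12 : e1 * M <= e / 2.
  apply: le_trans (ler_wpM2r (ltW M0) (_ : e1 <= e / (2 * M))) _.
    by rewrite ge_min lexx orbT.
  by rewrite invfM !mulrA mulfVK// gt_eqF.
have p0 := norm1_ge0 p; have q0 := norm1_ge0 q; have h0 := norm1_ge0 (h s).
have g0 := norm1_ge0 (g s).
apply: le_trans (norm1D _ _) _; apply: le_trans (lerD (norm1M _ _) (norm1D _ _)) _.
apply: le_trans (lerD (lexx _) (lerD (norm1M _ _) (norm1M _ _))) _.
move: e12; rewrite /M; nra.
Qed.

(** The fundamental theorem is available strictly to the right of the base point only, so callers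
    choose a base point to the left of the interval that matters. *)
Lemma continuous_primitive (g : R -> R) (a : R) : continuous g ->
  exists G : R -> R, forall x : R, a < x -> is_derive x (1 : R) G (g x).
Proof.
move=> cg; pose mu := @lebesgue_measure R.
exists (fun x => \int[mu]_(t in [set` `[a, x]]) (g t))%R => x ax.
have [||d e] := @continuous_FTC1_closed R g a x (x + 1) _ _ ax (cg x).
- by rewrite ltrDl.
- apply: continuous_compact_integrable; first exact: segment_compact.
  exact: continuous_subspaceT.
by split; [exact: d|rewrite -derive1E].
Qed.

Lemma cprimitive (g : R -> C) (a : R) : (forall s, rcont g s) ->
  exists G : R -> C, forall x : R, a < x -> cder G x (g x).
Proof.
move=> cg.
have [G1 H1] := @continuous_primitive (fun x => Re (g x)) a
  (fun x => rcont_Re (cg x)).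
have [G2 H2] := @continuous_primitive (fun x => Im (g x)) a
  (fun x => rcont_Im (cg x)).
by exists (fun x => G1 x +i* G2 x) => x ax; split; [exact: H1|exact: H2].
Qed.

(** * Goursat's bisection of a rectangle *)

Section rectangle.
Variables (f A B : R -> R -> C).

(** The contour integral of f dz counterclockwise around the rectangle [a, b] x [c, d]: [A] and [B]
    are primitives of f along horizontal and vertical lines, and dz = i dy on the vertical sides. *)
Definition rect_bd (a b c d : R) : C :=
  (A b c - A a c) + iC * (B b d - B b c) - (A b d - A a d) -
  iC * (B a d - B a c).

Lemma rect_bd_split a h c k :
  rect_bd a (a + h + h) c (c + k + k) =
  rect_bd a (a + h) c (c + k) + rect_bd (a + h) (a + h + h) c (c + k) +
  rect_bd a (a + h) (c + k) (c + k + k) +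
  rect_bd (a + h) (a + h + h) (c + k) (c + k + k).
Proof. rewrite /rect_bd; ring. Qed.

Lemma rect_bd_quarter a h c k : exists a' c', [/\ a' = a \/ a' = a + h,
  c' = c \/ c' = c + k &
  norm1 (rect_bd a (a + h + h) c (c + k + k)) <=
    4 * norm1 (rect_bd a' (a' + h) c' (c' + k))].
Proof.
rewrite rect_bd_split; set q1 := rect_bd a _ c _; set q2 := rect_bd _ _ c _.
set q3 := rect_bd a _ _ _; set q4 := rect_bd _ _ (c + k) _.
have T : norm1 (q1 + q2 + q3 + q4) <= norm1 q1 + norm1 q2 + norm1 q3 + norm1 q4.
  apply: le_trans (norm1D _ _) _; rewrite lerD2r.
  by apply: le_trans (norm1D _ _) _; rewrite lerD2r norm1D.
set S := norm1 (_ + q4) in T *.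
have [h1|h1] := leP S (4 * norm1 q1); first by exists a, c; split; auto.
have [h2|h2] := leP S (4 * norm1 q2); first by exists (a + h), c; split; auto.
have [h3|h3] := leP S (4 * norm1 q3); first by exists a, (c + k); split; auto.
exists (a + h), (c + k); split; [by right|by right|].
by rewrite -/q4; lra.
Qed.

Variables (x1 x2 y1 y2 : R).
Definition in_rect x y := (x1 <= x <= x2) && (y1 <= y <= y2).
Hypothesis hA : forall x y, in_rect x y -> cder (A ^~ y) x (f x y).
Hypothesis hB : forall x y, in_rect x y -> cder (B x) y (f x y).

(** Only the deviation of f from its affine approximation contributes, since the integral of an
    affine function around a rectangle is zero. With half-perimeter S the deviation is at most e S;
    each side of length l gives 2 e S l, and the four sides add up to 4 e S^2. *)
Lemma rect_bd_local (x y e del a b c d : R) (D : C) : 0 <= e ->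
  (forall x' y', in_rect x' y' -> `|x' - x| <= del -> `|y' - y| <= del ->
    norm1 (f x' y' - f x y - D * (cplx (x' - x) (y' - y))) <=
      e * (`|x' - x| + `|y' - y|)) ->
  x1 <= a -> b <= x2 -> y1 <= c -> d <= y2 ->
  a <= x <= b -> c <= y <= d -> b - a <= del -> d - c <= del ->
  norm1 (rect_bd a b c d) <= 4 * e * ((b - a) + (d - c)) ^+ 2.
Proof.
move=> e0 H ax bx cy dy xab ycd ba dc.
set S := (b - a) + (d - c).
(* The affine approximation is al + D zeta; [Aff] and [Bff] are its explicit primitives in the
   horizontal and in the vertical variable. *)
pose al := f x y - D * (cplx x y).
pose Aff x' y' := al * x'%:C + D * ((x' ^+ 2 / 2)%:C + iC * x'%:C * y'%:C).
pose Bff x' y' := al * y'%:C + D * (x'%:C * y'%:C + iC * (y' ^+ 2 / 2)%:C).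
have sq (s : R) : cder (fun s => (s ^+ 2 / 2)%:C) s s%:C.
  split; last exact: is_derive_cst.
  have -> : Re s%:C = 2^-1 * (s + s) by rewrite ReC; field.
  under eq_fun do rewrite ReC mulrC.
  by apply: is_derive_eq; rewrite /GRing.scale /= ; ring.
have dA x' y' : in_rect x' y' -> cder (fun s => A s y' - Aff s y') x'
   (f x' y' - f x y - D * (cplx (x' - x) (y' - y))).
  move=> I; apply: cder_eq.
    apply: cderB; first exact: hA.
    apply: cderD; first by apply: cderM; [exact: cder_cst|exact: cder_id].
    apply: cderM; first exact: cder_cst.
    apply: cderD; first exact: sq.
    apply: cderM; last exact: cder_cst.
    by apply: cderM; [exact: cder_cst|exact: cder_id].
  by apply: complex_eqP; cbv beta; rewrite /al !ReImE; ring.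
have dB x' y' : in_rect x' y' -> cder (fun s => B x' s - Bff x' s) y'
   (f x' y' - f x y - D * (cplx (x' - x) (y' - y))).
  move=> I; apply: cder_eq.
    apply: cderB; first exact: hB.
    apply: cderD; first by apply: cderM; [exact: cder_cst|exact: cder_id].
    apply: cderM; first exact: cder_cst.
    apply: cderD; first by apply: cderM; [exact: cder_cst|exact: cder_id].
    by apply: cderM; [exact: cder_cst|exact: sq].
  by apply: complex_eqP; cbv beta; rewrite /al !ReImE; ring.
have bound x' y' : a <= x' <= b -> c <= y' <= d ->
   norm1 (f x' y' - f x y - D * (cplx (x' - x) (y' - y))) <= e * S.
  move=> x'ab y'cd; have /andP[? ?] := xab; have /andP[? ?] := ycd.
  have /andP[? ?] := x'ab; have /andP[? ?] := y'cd.
  have hx : `|x' - x| <= b - a by rewrite ler_norml; lra.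
  have hy : `|y' - y| <= d - c by rewrite ler_norml; lra.
  apply: le_trans (H _ _ _ _ _) _.
  - by rewrite /in_rect; lra.
  - exact: le_trans ba.
  - exact: le_trans dc.
  - by rewrite ler_wpM2l// lerD.
have /andP[? ?] := xab; have /andP[? ?] := ycd.
have ab : a <= b by lra.
have cd : c <= d by lra.
have EA y' : c <= y' <= d ->
    norm1 ((A b y' - Aff b y') - (A a y' - Aff a y')) <= 2 * (e * S) * (b - a).
  move=> /andP[? ?].
  apply: (@cder_ineq _ (fun s => A s y' - Aff s y')) => // s /andP[? ?].
    by apply: dA; rewrite /in_rect; lra.
  by apply: bound; lra.
have EB x' : a <= x' <= b ->
    norm1 ((B x' d - Bff x' d) - (B x' c - Bff x' c)) <= 2 * (e * S) * (d - c).
  move=> /andP[? ?].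
  apply: (@cder_ineq _ (fun s => B x' s - Bff x' s)) => // s /andP[? ?].
    by apply: dB; rewrite /in_rect; lra.
  by apply: bound; lra.
(* The boundary sum of [Aff] and [Bff] vanishes identically, so it may be subtracted side by
   side. *)
have -> : rect_bd a b c d =
   ((A b c - Aff b c) - (A a c - Aff a c)) +
   iC * ((B b d - Bff b d) - (B b c - Bff b c)) -
   ((A b d - Aff b d) - (A a d - Aff a d)) -
   iC * ((B a d - Bff a d) - (B a c - Bff a c)).
  by rewrite /rect_bd /Aff /Bff; ring.
apply: le_trans (norm1B _ _) _; rewrite norm1i.
have -> : 4 * e * S ^+ 2 = 2 * (e * S) * (b - a) + 2 * (e * S) * (d - c) +
   2 * (e * S) * (b - a) + 2 * (e * S) * (d - c) by rewrite /S; ring.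
apply: lerD; last by apply: EB; lra.
apply: le_trans (norm1B _ _) _; apply: lerD; last by apply: EA; lra.
apply: le_trans (norm1D _ _) _; rewrite norm1i; apply: lerD.
  by apply: EA; lra.
by apply: EB; lra.
Qed.

Lemma pow2_large (x : R) : exists n : nat, x < 2 ^+ n.
Proof.
exists (Num.truncn `|x|).+1; apply: le_lt_trans (ler_norm _) _.
apply: lt_trans (real_truncnS_gt (normr_real x)) _.
by rewrite -natrX ltr_nat ltn_expl.
Qed.

(** The intervals from u n to u n + h / 2^n are nested, because a step to the right is at most the
    half by which the length shrinks. The supremum of the left ends lies in all of them. *)
Lemma nested_limit (u : nat -> R) (h : R) :
  0 <= h -> (forall n, u n <= u n.+1 <= u n + h / 2 ^+ n.+1) ->
  exists x, forall n, u n <= x <= u n + h / 2 ^+ n.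
Proof.
move=> h0 H.
have p2 n : 0 < 2 ^+ n :> R by rewrite exprn_gt0.
have hp n : 0 <= h / 2 ^+ n by rewrite divr_ge0 // ltW.
have half n : h / 2 ^+ n = h / 2 ^+ n.+1 + h / 2 ^+ n.+1.
  by rewrite exprS; field; rewrite gt_eqF.
have mono n m : u n <= u (n + m)%N /\ u (n + m)%N + h / 2 ^+ (n + m) <= u n + h / 2 ^+ n.
  elim: m => [|m [IH1 IH2]]; first by rewrite addn0 !lexx.
  rewrite addnS; have /andP[a b] := H (n + m)%N; have c := half (n + m)%N.
  split; first exact: le_trans a.
  by apply: le_trans IH2; rewrite c; lra.
have cross n m : u m <= u n + h / 2 ^+ n.
  have [nm|/ltnW mn] := leqP n m.
    by have [_] := mono n (m - n)%N; rewrite subnKC// => /(le_trans _); apply; rewrite lerDl.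
  have [+ _] := mono m (n - m)%N; rewrite subnKC// => /le_trans; apply.
  by rewrite lerDl.
exists (sup (range u)) => n; apply/andP; split.
  apply: ub_le_sup; last by exists n.
  by exists (u 0%N + h / 2 ^+ 0) => _ [m _ <-]; exact: cross.
by apply: ge_sup; [exists (u 0%N), 0%N|move=> _ [m _ <-]; exact: cross].
Qed.

Hypothesis hD : forall x y, in_rect x y -> exists D : C,
  forall e : R, 0 < e -> exists2 del : R, 0 < del &
  forall x' y', in_rect x' y' -> `|x' - x| <= del -> `|y' - y| <= del ->
    norm1 (f x' y' - f x y - D * (cplx (x' - x) (y' - y))) <=
      e * (`|x' - x| + `|y' - y|).

(** Among the four quarters one carries at least a quarter of the integral. After n bisections the
    integral is at most 4^n times one over a rectangle with sides H / 2^n and K / 2^n, where the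
    local bound 4 e (H + K)^2 / 4^n holds; the powers cancel and e is arbitrary. *)
Lemma goursat_rect : x1 <= x2 -> y1 <= y2 -> rect_bd x1 x2 y1 y2 = 0.
Proof.
move=> x12 y12; pose H := x2 - x1; pose K := y2 - y1.
have H0 : 0 <= H by rewrite subr_ge0.
have K0 : 0 <= K by rewrite subr_ge0.
have p2 n : 0 < 2 ^+ n :> R by rewrite exprn_gt0.
pose h n := H / 2 ^+ n; pose k n := K / 2 ^+ n.
have h0 n : 0 <= h n by rewrite divr_ge0 // ltW.
have k0 n : 0 <= k n by rewrite divr_ge0 // ltW.
have hh n : h n = h n.+1 + h n.+1.
  by rewrite /h exprS; field; rewrite gt_eqF.
have kk n : k n = k n.+1 + k n.+1.
  by rewrite /k exprS; field; rewrite gt_eqF.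
pose Q n (p : R * R) := norm1 (rect_bd p.1 (p.1 + h n) p.2 (p.2 + k n)).
have step (np : nat * (R * R)) : exists p' : R * R,
   [/\ np.2.1 <= p'.1 <= np.2.1 + h np.1.+1,
       np.2.2 <= p'.2 <= np.2.2 + k np.1.+1 &
       Q np.1 np.2 <= 4 * Q np.1.+1 p'].
  case: np => n [a c] /=.
  have [a' [c' [Ha Hc HQ]]] := rect_bd_quarter a (h n.+1) c (k n.+1).
  have := h0 n.+1; have := k0 n.+1 => ? ?.
  exists (a', c'); split => /=; first by case: Ha => ->; lra.
    by case: Hc => ->; lra.
  by rewrite /Q /= hh kk !addrA.
have [s Hs] := choice step.
pose fix u n : R * R := if n is m.+1 then s (m, u m) else (x1, y1).
have [xs Hxs] : exists x, forall n, (u n).1 <= x <= (u n).1 + H / 2 ^+ n.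
  by apply: nested_limit => // n; have [] := Hs (n, u n).
have [ys Hys] : exists x, forall n, (u n).2 <= x <= (u n).2 + K / 2 ^+ n.
  by apply: nested_limit => // n; have [] := Hs (n, u n).
have inx n : x1 <= (u n).1 /\ (u n).1 + h n <= x2.
  elim: n => [|n [IH1 IH2]]; first by rewrite /h /H /= expr0 divr1; split; lra.
  have [/andP[a b] _ _] := Hs (n, u n); rewrite /= in a b *.
  by have := hh n; have := h0 n.+1; split; lra.
have iny n : y1 <= (u n).2 /\ (u n).2 + k n <= y2.
  elim: n => [|n [IH1 IH2]]; first by rewrite /k /K /= expr0 divr1; split; lra.
  have [_ /andP[a b] _] := Hs (n, u n); rewrite /= in a b *.
  by have := kk n; have := k0 n.+1; split; lra.
have Qn n : norm1 (rect_bd x1 x2 y1 y2) <= 4 ^+ n * Q n (u n).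
  elim: n => [|n IH].
    rewrite expr0 mul1r /Q /= /h /k /H /K expr0 !divr1.
    by rewrite !(addrC _ (_ - _)) !subrK.
  apply: le_trans IH _; rewrite exprSr -mulrA ler_wpM2l ?exprn_ge0//.
  by have [] := Hs (n, u n).
have inr : in_rect xs ys.
  have := inx 0%N; have := iny 0%N; have := Hxs 0%N; have := Hys 0%N.
  by rewrite /in_rect /h /k; lra.
have [D HD] := hD inr.
apply: (@norm1_le_eps _ _ (4 * (H + K) ^+ 2)) => e e0.
have [del del0 Hdel] := HD e e0.
(* Deep enough for the n-th rectangle to fit into the neighbourhood where differentiability at the
   limit point gives the error [e]. *)
have [n nl] := pow2_large ((H + K) / del).
have hkd : H / 2 ^+ n + K / 2 ^+ n <= del.
  rewrite -mulrDl ler_pdivrMr// mulrC -ler_pdivrMr//; exact: ltW.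
have hd := h0 n; have kd := k0 n; rewrite /h /k in hd kd.
apply: le_trans (Qn n) _.
have [? ?] := inx n; have [? ?] := iny n.
have : Q n (u n) <= 4 * e * (h n + k n) ^+ 2.
  have -> : h n + k n = ((u n).1 + h n - (u n).1) + ((u n).2 + k n - (u n).2) by ring.
  apply: (@rect_bd_local xs ys e del _ _ _ _ D) => //.
  - exact: ltW.
  - by rewrite /h; lra.
  - by rewrite /k; lra.
move=> /(ler_wpM2l (exprn_ge0 n (ler0n R 4))) /le_trans; apply.
rewrite le_eqVlt; apply/orP; left; apply/eqP.
have -> : (4 : R) ^+ n = 2 ^+ n * 2 ^+ n by rewrite -exprMn; congr (_ ^+ n); ring.
by rewrite /h /k; field; rewrite gt_eqF.
Qed.

End rectangle.

(** Freezing the coordinates outside the square extends f continuously to the plane, as primitives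
    are constructed for functions continuous on the whole line. *)
Definition clamp (c rho x : R) : R := Num.max (c - rho) (Num.min (c + rho) x).

Lemma clamp_id c rho x : c - rho <= x <= c + rho -> clamp c rho x = x.
Proof. by move=> /andP[a b]; rewrite /clamp (min_r b) (max_r a). Qed.

Lemma clamp_in c rho x : 0 <= rho -> c - rho <= clamp c rho x <= c + rho.
Proof.
move=> r0; rewrite /clamp le_max lexx /= ge_max; apply/andP; split; first lra.
by rewrite ge_min lexx.
Qed.

Lemma clamp_lip c rho x y : `|clamp c rho x - clamp c rho y| <= `|x - y|.
Proof.
have := ler_norm (x - y); have := ler_norm (y - x); rewrite (distrC y) => ? ?.
rewrite /clamp; have [? | ?] := leP (c + rho) x; have [? | ?] := leP (c + rho) y;
  rewrite !maxEle; do ?(case: ifPn; rewrite -?ltNge => ?); rewrite ?subrr ?normr0// ler_norml; lra.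
Qed.

Definition in_square (w0 : C) (rho : R) (w : C) :=
  `|Re (w - w0)| < rho /\ `|Im (w - w0)| < rho.

(* Cauchy--Goursat on rectangles makes the two path integrals from the corner
   of a square (first along x or first along y) agree, so either of them is a
   primitive. *)
Lemma holomorphic_primitive (f : C -> C) (w0 : C) (rho : R) : 0 < rho ->
  (forall w, `|Re (w - w0)| <= rho -> `|Im (w - w0)| <= rho ->
     exists d, cdiff f w d) ->
  exists F : C -> C, forall w, in_square w0 rho w -> cdiff F w (f w).
Proof.
move=> r0 Hf; case: w0 Hf => x0 y0 Hf; rewrite /= in Hf.
pose fc x y := f (cplx (clamp x0 rho x) (clamp y0 rho y)).
have dsq x y : x0 - rho <= x <= x0 + rho -> y0 - rho <= y <= y0 + rho ->
   exists d, cdiff f (cplx x y) d.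
  by move=> /andP[? ?] /andP[? ?]; apply: Hf; rewrite /= ler_norml; lra.
have fcc x y : ccont f (cplx (clamp x0 rho x) (clamp y0 rho y)).
  have [||d /cdiff_ccont//] := dsq (clamp x0 rho x) (clamp y0 rho y);
  by rewrite clamp_in// ltW.
have cx y s : rcont (fc ^~ y) s.
  apply: (@rcont_comp f (fun x => cplx (clamp x0 rho x) (clamp y0 rho y))) => // e e0.
  exists e => // h hh; rewrite /norm1 /= subrr normr0 addr0.
  by apply: le_trans (clamp_lip _ _ _ _) _; rewrite addrC addKr ltW.
have cy x s : rcont (fc x) s.
  apply: (@rcont_comp f (fun y => cplx (clamp x0 rho x) (clamp y0 rho y))) => // e e0.
  exists e => // h hh; rewrite /norm1 /= subrr normr0 add0r.
  by apply: le_trans (clamp_lip _ _ _ _) _; rewrite addrC addKr ltW.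
have [A' HA] := choice (fun y => cprimitive (x0 - 2 * rho) (cx y)).
have [B HB] := choice (fun x => cprimitive (y0 - 2 * rho) (cy x)).
pose A x y := A' y x.
have [a aE] : exists a, a = x0 - rho by exists (x0 - rho).
have [c cE] : exists c, c = y0 - rho by exists (y0 - rho).
(* [F1] runs along the bottom and then up, [F2] up the left side and then across. The y-derivative
   is read off [F1], the x-derivative off [F2]. *)
pose F1 x y := (A x c - A a c) + iC * (B x y - B x c).
pose F2 x y := (A x y - A a y) + iC * (B a y - B a c).
have F12 x y : a <= x <= x0 + rho -> c <= y <= y0 + rho -> F1 x y = F2 x y.
  move=> /andP[ax xr] /andP[cy' yr].
  have : rect_bd A B a x c y = 0.
    apply: (@goursat_rect fc) => //.
    - move=> x' y' /andP[/andP[? ?] /andP[? ?]]; apply: HA; lra.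
    - move=> x' y' /andP[/andP[? ?] /andP[? ?]]; apply: HB; lra.
    - move=> x' y' /andP[/andP[? ?] /andP[? ?]].
      have [||D HD] := dsq x' y'.
        by lra.
        by lra.
      exists D => e e0; have [del d0 Hdel] := HD e e0.
      (* Two coordinates of size at most del / 4 keep [norm1] strictly below del. *)
      exists (del / 4); first by rewrite divr_gt0.
      move=> x'' y'' /andP[/andP[? ?] /andP[? ?]] hx hy.
      have cl u v : a <= u <= x -> c <= v <= y -> fc u v = f (cplx u v).
        by move=> ? ?; rewrite /fc !clamp_id//; lra.
      rewrite !cl; [|lra|lra|lra|lra].
      have hn : norm1 (cplx (x'' - x') (y'' - y')) < del.
        by apply: le_lt_trans (lerD hx hy) _; lra.
      have := Hdel _ hn; congr (norm1 (f _ - _ - _) <= _).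
      by apply: complex_eqP; rewrite !ReImE; ring.
  move=> E; apply/eqP; rewrite -subr_eq0; apply/eqP; rewrite -[RHS]E.
  by rewrite /F1 /F2 /rect_bd; ring.
exists (fun w => F1 (Re w) (Im w)).
case=> x y [/=]; rewrite !ltr_norml => /andP[x_1 x_2] /andP[y_1 y_2] e e0.
have fcE u v : a <= u <= x0 + rho -> c <= v <= y0 + rho -> fc u v = f (cplx u v).
  by move=> ? ?; rewrite /fc !clamp_id//; lra.
have dF2 u v : a < u < x0 + rho -> c < v < y0 + rho ->
    cder (F1 ^~ v) u (f (cplx u v)).
  move=> /andP[u1 u2] /andP[v1 v2]; apply: (@cder_near _ (F2 ^~ v)).
    exists (Num.min (u - a) (x0 + rho - u)); first by rewrite lt_min; lra.
    move=> h; rewrite lt_min !ltr_norml => /andP[/andP[? ?] /andP[? ?]].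
    by apply: F12; lra.
  rewrite -fcE; [|lra|lra].
  apply: cder_eq.
    apply: cderD; last exact: cder_cst.
    apply: cderB; last exact: cder_cst.
    by apply: HA; lra.
  by rewrite subr0 addr0.
have dF1 u v : a < u < x0 + rho -> c < v < y0 + rho ->
    cder (F1 u) v (iC * f (cplx u v)).
  move=> /andP[u1 u2] /andP[v1 v2].
  rewrite -fcE; [|lra|lra].
  apply: cder_eq.
    apply: cderD; first exact: cder_cst.
    apply: cderM; first exact: cder_cst.
    apply: cderB; last exact: cder_cst.
    by apply: HB; lra.
  by rewrite subr0 add0r mul0r add0r.
have [||d /cdiff_ccont cf] := dsq x y; [lra|lra|].
(* The half absorbs the factor 2 of the mean value inequality. The increment of [F1], corrected by
   the linear map [P], is then estimated along a vertical and a horizontal leg. *)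
have e2 : 0 < e / 2 by rewrite divr_gt0.
have [d1 d10 Hd] := cf _ e2.
pose m := Num.min (Num.min d1 (Num.min (x - a) (x0 + rho - x)))
   (Num.min (y - c) (y0 + rho - y)).
exists m; first by rewrite /m !lt_min; lra.
case=> h k; rewrite {1}/norm1 /m !lt_min /=.
move=> /andP[/andP[hk /andP[h1 h2]] /andP[k1 k2]].
have nh := normr_ge0 h; have nk := normr_ge0 k.
have hh : - `|h| <= h <= `|h| by rewrite -ler_norml.
have hk' : - `|k| <= k <= `|k| by rewrite -ler_norml.
set P := f (cplx x y).
have close u v : `|u - x| <= `|h| -> `|v - y| <= `|k| -> norm1 (f (cplx u v) - P) <= e / 2.
  move=> hu hv; have := Hd (cplx (u - x) (v - y)).
  have -> : cplx x y + cplx (u - x) (v - y) = cplx u v by apply: complex_eqP; rewrite !ReImE; ring.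
  by apply; apply: le_lt_trans (lerD hu hv) hk.
have inx u : Num.min x (x + h) <= u <= Num.max x (x + h) -> `|u - x| <= `|h| /\ a < u < x0 + rho.
  move=> H; have : `|u - x| <= `|h|.
    by move: H; rewrite ler_norml; case: (leP x (x + h)) => ? /andP[? ?]; lra.
  by rewrite ler_norml => /[dup] ? /andP[? ?]; split => //; lra.
have iny v : Num.min y (y + k) <= v <= Num.max y (y + k) -> `|v - y| <= `|k| /\ c < v < y0 + rho.
  move=> H; have : `|v - y| <= `|k|.
    by move: H; rewrite ler_norml; case: (leP y (y + k)) => ? /andP[? ?]; lra.
  by rewrite ler_norml => /[dup] ? /andP[? ?]; split => //; lra.
have yk : `|y + k - y| <= `|k| by rewrite addrC addKr.
have E1 : norm1 ((F1 (x + h) (y + k) - P * (x + h)%:C) - (F1 x (y + k) - P * x%:C)) <=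
   2 * (e / 2) * `|x + h - x|.
  apply: (@cder_ineq_sym _ (fun u => F1 u (y + k) - P * u%:C)
     (fun u => f (cplx u (y + k)) - P)) => u /inx[u1 u2].
    apply: cder_eq.
      apply: cderB; first by apply: dF2 => //; lra.
      by apply: cderM; [exact: cder_cst|exact: cder_id].
    by rewrite mul0r add0r mulr1.
  exact: close.
have E2 : norm1 ((F1 x (y + k) - P * (iC * (y + k)%:C)) - (F1 x y - P * (iC * y%:C))) <=
   2 * (e / 2) * `|y + k - y|.
  apply: (@cder_ineq_sym _ (fun v => F1 x v - P * (iC * v%:C))
     (fun v => iC * (f (cplx x v) - P))) => v /iny[v1 v2].
    apply: cder_eq.
      apply: cderB; first by apply: dF1 => //; lra.
      apply: cderM; first exact: cder_cst.
      by apply: cderM; [exact: cder_cst|exact: cder_id].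
    by rewrite !mul0r !add0r mulr1; ring.
  by rewrite norm1i; apply: close => //; rewrite subrr normr0.
rewrite /=.
have -> : F1 (x + h) (y + k) - F1 x y - P * (cplx h k) =
 ((F1 (x + h) (y + k) - P * (x + h)%:C) - (F1 x (y + k) - P * x%:C)) +
 ((F1 x (y + k) - P * (iC * (y + k)%:C)) - (F1 x y - P * (iC * y%:C))).
  have -> : cplx h k = (x + h)%:C - x%:C + (iC * (y + k)%:C - iC * y%:C).
    by apply: complex_eqP; rewrite !ReImE; ring.
  by ring.
apply: le_trans (norm1D _ _) _; apply: le_trans (lerD E1 E2) _.
rewrite !(addrC _ (- _)) !addKr /norm1 /= mulrDr; lra.
Qed.

End goursat.

(** * Circle averages *)

Section circle_averages.
Variable R : realType.
Local Notation C := R[i].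
Local Notation Re := (@complex.Re R).
Local Notation Im := (@complex.Im R).

(** With the integral defined as an increment of a primitive, linearity and bounds follow from the
    rules for derivatives. *)
Definition is_cint (g : R -> C) (a b : R) (I : C) : Prop :=
  exists2 G : R -> C, (forall x, a <= x <= b -> cder G x (g x)) & I = G b - G a.

(** The default 0 is never met for continuous integrands, by [cintP]. *)
Definition cint (g : R -> C) (a b : R) : C := xget 0 [set I | is_cint g a b I].

Lemma cintP g a b : (forall s, rcont g s) -> is_cint g a b (cint g a b).
Proof.
move=> cg; have [G HG] := cprimitive (a - 1) cg.
apply: (@xgetPex _ 0 [set I | is_cint g a b I]); exists (G b - G a), G => // x /andP[ax _].
by apply: HG; rewrite (lt_le_trans _ ax)// ltrBlDr ltrDl.
Qed.

Lemma is_cint_bound g a b I M : a <= b -> is_cint g a b I ->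
  (forall x, a <= x <= b -> norm1 (g x) <= M) -> norm1 I <= 2 * M * (b - a).
Proof. by move=> ab [G HG ->] HM; apply: (@cder_ineq _ G g). Qed.

Lemma is_cintD g h a b I J : is_cint g a b I -> is_cint h a b J ->
  is_cint (fun x => g x + h x) a b (I + J).
Proof.
move=> [G HG ->] [H HH ->]; exists (fun x => G x + H x); last by ring.
by move=> x xab; apply: cderD; [exact: HG|exact: HH].
Qed.

Lemma is_cintZ g a b I c : is_cint g a b I -> is_cint (fun x => c * g x) a b (c * I).
Proof.
move=> [G HG ->]; exists (fun x => c * G x); last by ring.
move=> x xab; apply: cder_eq.
  by apply: cderM; [exact: cder_cst|exact: HG].
by rewrite mul0r add0r.
Qed.

Lemma is_cintN g a b I : is_cint g a b I -> is_cint (fun x => - g x) a b (- I).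
Proof.
move=> /(is_cintZ (-1)); rewrite mulN1r.
by under eq_fun do rewrite mulN1r.
Qed.

Lemma is_cint_cst c a b : is_cint (fun=> c) a b (c * (b - a)%:C).
Proof.
exists (fun x => c * x%:C) => [x _|]; last first.
  by apply: complex_eqP; rewrite !ReImE; ring.
apply: cder_eq; first by apply: cderM; [exact: cder_cst|exact: cder_id].
by rewrite mul0r add0r mulr1.
Qed.

Lemma is_cint_ext g h a b I : (forall x, a <= x <= b -> h x = g x) ->
  is_cint g a b I -> is_cint h a b I.
Proof. by move=> E [G HG ->]; exists G => // x xab; rewrite E//; exact: HG. Qed.

Lemma is_cint_unique g a b I J : a <= b ->
  is_cint g a b I -> is_cint g a b J -> I = J.
Proof.
move=> ab HI HJ; apply/eqP; rewrite -subr_eq0; apply/eqP.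
apply: (@norm1_le_eps _ _ 0) => e _; rewrite mul0r.
have := is_cint_bound ab (is_cintD HI (is_cintN HJ)) (M := 0).
rewrite mulr0 mul0r; apply => x _; by rewrite subrr norm10.
Qed.

(** Compactness of the segment turns radii that depend on the point into a common one. This is what
    makes estimates under the integral sign uniform in the angle. *)
Lemma uniform_on_segment (T : Type) (sz : T -> R) (Q : T -> R -> Prop) (a b : R) :
  (forall x : R, a <= x <= b -> exists2 del : R, 0 < del &
     forall (x' : R) (h : T), `|x' - x| < del -> sz h < del -> Q h x') ->
  exists2 del : R, 0 < del & forall (x : R) (h : T), a <= x <= b -> sz h < del -> Q h x.
Proof.
move=> H.
have /compact_near_coveringP cov := @segment_compact R a b.
have := cov R (0 : R)^'+ (fun r x => forall h, sz h < r -> Q h x) _.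
case.
  move=> x; rewrite /= in_itv /= => /H[del d0 B].
  exists ([set x' | `|x' - x| < del], [set r | 0 < r < del]) => /=.
    split; first by apply/nbhs_ballP; exists del => // y; rewrite /ball /= distrC.
    exists del => // y; rewrite /ball_ /= sub0r normrN => yd y0.
    by rewrite y0 (le_lt_trans (ler_norm y) yd).
  move=> [x' r] /= [hx /andP[_ r1]] h hr; apply: B => //; exact: lt_trans r1.
move=> del /= d0 B; exists (del / 2); first by rewrite divr_gt0.
move=> x h xab hh; apply: (B (del / 2)) => //=.
- rewrite sub0r normrN gtr0_norm ?divr_gt0// ltr_pdivrMr// ltr_pMr// ltrDl//.
- by rewrite divr_gt0.
Qed.

Definition copen (U : C -> Prop) : Prop :=
  forall w, U w -> exists2 del : R, 0 < del & forall h, norm1 h < del -> U (w + h).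

Definition hol1 (U : C -> Prop) (F f : C -> C) : Prop :=
  forall w, U w -> cdiff F w (f w) /\ ccont f w.

Lemma ccont_strict f w : ccont f w ->
  forall eps : R, 0 < eps -> exists2 del : R, 0 < del & forall k h,
    norm1 k < del -> norm1 h < del ->
    norm1 (f (w + k + h) - f (w + k)) <= eps.
Proof.
move=> cf eps e0; have e2 : 0 < eps / 2 by rewrite divr_gt0.
have [d d0 B] := cf _ e2.
exists (d / 2); first by rewrite divr_gt0.
move=> k h kd hd; have := lerD (B (k + h) _) (B k _); rewrite -splitr.
have -> : f (w + k + h) - f (w + k) = (f (w + (k + h)) - f w) - (f (w + k) - f w).
  by rewrite addrA; ring.
move=> K; apply: le_trans (norm1B _ _) (K _ _).
  by apply: le_lt_trans (norm1D _ _) _; rewrite (splitr d) ltrD.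
by apply: lt_trans kd _; rewrite ltr_pdivrMr// ltr_pMr// ltrDl.
Qed.

(** A continuous derivative makes F strictly differentiable: the base point w + k may move too.
    Along the segment s -> w + k + s h the mean value inequality costs two thirds of eps, and
    replacing f(w) by f(w + k) the last third. *)
Lemma hol1_strict U F f w : copen U -> hol1 U F f -> U w ->
  forall eps : R, 0 < eps -> exists2 del : R, 0 < del & forall k h,
    norm1 k < del -> norm1 h < del ->
    norm1 (F (w + k + h) - F (w + k) - f (w + k) * h) <= eps * norm1 h.
Proof.
move=> oU HF Uw eps e0; have e3 : 0 < eps / 3 by rewrite divr_gt0.
have [d1 d10 B1] := oU w Uw; have [_ cf] := HF w Uw.
have [d2 d20 B2] := cf _ e3.
pose d := Num.min d1 d2.
have d0 : 0 < d by rewrite lt_min d10.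
exists (d / 2); first by rewrite divr_gt0.
move=> k h kd hd.
have small s : 0 <= s <= 1 -> norm1 (k + s%:C * h) < d.
  move=> /andP[s0 s1]; apply: le_lt_trans (norm1D _ _) _.
  rewrite (splitr d) ltr_leD// norm1Cl ger0_norm//.
  by apply: le_trans (ltW hd); rewrite ler_piMl ?norm1_ge0.
have K : norm1 ((F (w + k + 1%:C * h) - f w * (1%:C * h)) -
           (F (w + k + 0%:C * h) - f w * (0%:C * h))) <=
     2 * (eps / 3 * norm1 h) * (1 - 0).
  apply: (@cder_ineq _ (fun s => F (w + k + s%:C * h) - f w * (s%:C * h))
     (fun s => (f (w + (k + s%:C * h)) - f w) * h)) => //.
    move=> s /small; rewrite lt_min => /andP[/B1 Us _].
    have [dF _] := HF _ Us; rewrite addrA in dF.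
    have ds : cder (fun s => s%:C * h) s h.
      apply: cder_eq; first by apply: cderM; [exact: cder_id|exact: cder_cst].
      by rewrite mul1r mulr0 addr0.
    apply: cder_eq.
      apply: cderB; last by apply: cderM; [exact: cder_cst|exact: ds].
      apply: (@cder_comp _ F (fun s => w + k + s%:C * h)); last exact: dF.
      by apply: cderD; [exact: cder_cst|exact: ds].
    by rewrite addrA; ring.
  move=> s /small; rewrite lt_min => /andP[_ /B2 L].
  by apply: le_trans (norm1M _ _) _; rewrite ler_wpM2r ?norm1_ge0.
have L : norm1 ((f (w + k) - f w) * h) <= eps / 3 * norm1 h.
  apply: le_trans (norm1M _ _) _; rewrite ler_wpM2r ?norm1_ge0//.
  have := small 0; rewrite lexx ler01 => /(_ isT).
  by rewrite mul0r addr0 lt_min => /andP[_ /B2].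
have -> : F (w + k + h) - F (w + k) - f (w + k) * h =
  ((F (w + k + 1%:C * h) - f w * (1%:C * h)) -
           (F (w + k + 0%:C * h) - f w * (0%:C * h))) - (f (w + k) - f w) * h.
  by rewrite !mul1r !mul0r addr0; ring.
apply: le_trans (norm1B _ _) _; apply: le_trans (lerD K L) _; lra.
Qed.

Lemma expi_norm1 (s : R) : norm1 (expi s) <= 2.
Proof. by rewrite /norm1 /= (_ : 2 = 1 + 1)// lerD// ler_norml ?cos_geN1 ?cos_le1 ?sin_geN1 ?sin_le1. Qed.

Lemma expiMN (s : R) : expi s * expi (- s) = 1.
Proof.
apply: complex_eqP; rewrite !ReImE /= cosN sinN; last by ring.
by have := cos2Dsin2 s; rewrite !expr2 => <-; ring.
Qed.

Lemma expi2pi : (expi (2 * pi) = 1 :> C) * (expi (- (2 * pi)) = 1 :> C) * (expi 0 = 1 :> C).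
Proof.
by rewrite /expi cosN sinN !mulr_natl cos2pi sin2pi cos0 sin0 oppr0.
Qed.

Lemma cder_expiN s : cder (fun s : R => expi (- s)) s (- iC * expi (- s)).
Proof.
have -> : (fun s : R => expi (- s)) = (fun s => expi (0 + -1 * s)).
  by apply/funext => x; rewrite add0r mulN1r.
apply: cder_eq; first by apply: cder_affine; exact: cder_expi.
rewrite add0r mulN1r; apply: complex_eqP; rewrite !ReImE; ring.
Qed.

(** Up to the factor r / i, Cauchy's integral of F(zeta) / (zeta - w)^2 over the circle of radius r
    about w. *)
Definition circ_int (F : C -> C) (r : R) (w : C) : C :=
  cint (fun t => F (w + r%:C * expi t) * expi (- t)) 0 (2 * pi).

Let pi2_ge0 : 0 <= 2 * pi :> R. Proof. by rewrite mulr_ge0// pi_ge0. Qed.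

Lemma circ_in U (w : C) (r rho : R) : 0 <= r -> 2 * r < rho ->
  (forall h, norm1 h < rho -> U (w + h)) -> forall t, U (w + r%:C * expi t).
Proof.
move=> r0 rr HU t; apply: HU; rewrite norm1Cl ger0_norm// (le_lt_trans _ rr)//.
by rewrite mulrC ler_wpM2r// expi_norm1.
Qed.

Lemma rcont_circ f (w : C) (r : R) : (forall t, ccont f (w + r%:C * expi t)) ->
  forall t, rcont (fun t => f (w + r%:C * expi t)) t.
Proof.
move=> H t; apply: (@rcont_comp _ f (fun t => w + r%:C * expi t)) => //.
apply: (@cder_rcont _ _ _ _ ).
apply: cderD; first exact: cder_cst.
by apply: cderM; [exact: cder_cst|exact: cder_expi].
Qed.

Lemma rcont_circM f (w : C) (r : R) : (forall t, ccont f (w + r%:C * expi t)) ->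
  forall t, rcont (fun t => f (w + r%:C * expi t) * expi (- t)) t.
Proof.
move=> H t; apply: rcontM; first exact: rcont_circ.
exact: cder_rcont (cder_expiN t).
Qed.

Lemma circ_near (r : R) t (d : R) : 0 < d -> exists2 del : R, 0 < del &
  forall t', `|t' - t| < del -> norm1 (r%:C * expi t' - r%:C * expi t) < d.
Proof.
move=> d0.
have : rcont (fun t => r%:C * expi t) t.
  apply: (@cder_rcont _ _ _ _ ).
  by apply: cderM; [exact: cder_cst|exact: cder_expi].
have d2 : 0 < d / 2 by rewrite divr_gt0.
move=> /(_ _ d2)[del del0 B]; exists del => // t' /B.
by rewrite subrKC => /le_lt_trans; apply; rewrite ltr_pdivrMr// ltr_pMr// ltrDl.
Qed.

Lemma ball_shift (U : C -> Prop) (w : C) (rho : R) h :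
  (forall h, norm1 h < rho -> U (w + h)) -> norm1 h < rho / 2 ->
  forall h', norm1 h' < rho / 2 -> U (w + h + h').
Proof.
move=> H hr h' hr'; rewrite -addrA; apply: H.
by apply: le_lt_trans (norm1D _ _) _; rewrite (splitr rho) ltrD.
Qed.

(** * Differentiating circle integrals in the centre and in the radius *)

Section with_domain.
Variables (U : C -> Prop) (F f : C -> C) (w : C) (r rho : R).
Hypotheses (oU : copen U) (HF : hol1 U F f) (r0 : 0 <= r) (rr : 4 * r < rho)
  (HU : forall h, norm1 h < rho -> U (w + h)).

Let rho0 : 0 < rho. Proof. by apply: le_lt_trans rr; rewrite mulr_ge0. Qed.
Let rr2 : 2 * r < rho / 2. Proof. by have := rr; lra. Qed.

(** In [norm1] a circle of radius r reaches out to at most 2 r, so 4 r < rho leaves room to move its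
    centre by rho / 2. *)
Let Uc h : norm1 h < rho / 2 -> forall t, U (w + h + r%:C * expi t).
Proof. by move=> hr; apply: (circ_in r0 rr2); apply: ball_shift. Qed.

Let Uc0 t : U (w + r%:C * expi t).
Proof.
have := Uc (h := 0); rewrite addr0; apply.
by rewrite norm10 divr_gt0.
Qed.

Let cF h : norm1 h < rho / 2 -> forall t, ccont F (w + h + r%:C * expi t).
Proof. by move=> hr t; have [/cdiff_ccont] := HF (Uc hr t). Qed.

Let cf h : norm1 h < rho / 2 -> forall t, ccont f (w + h + r%:C * expi t).
Proof. by move=> hr t; have [] := HF (Uc hr t). Qed.

Let h00 : norm1 (0 : C) < rho / 2. Proof. by rewrite norm10 divr_gt0. Qed.

(** The constant is 2 from the componentwise mean value inequality, times 2 for [norm1] of the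
    phase, times the length 2 pi. *)
Lemma circ_int_bound (g : R -> C) I (M : R) : is_cint (fun t => g t * expi (- t)) 0 (2 * pi) I ->
  (forall t, 0 <= t <= 2 * pi -> norm1 (g t) <= M) -> norm1 I <= 8 * pi * M.
Proof.
move=> HI HM.
have -> : 8 * pi * M = 2 * (2 * M) * (2 * pi - 0) by ring.
apply: is_cint_bound HI _ => // t tp.
apply: le_trans (norm1M _ _) _; rewrite mulrC.
apply: le_trans (ler_wpM2r (norm1_ge0 _) (expi_norm1 _)) _.
by rewrite ler_wpM2l// HM.
Qed.

Lemma circ_int_diff : cdiff (circ_int F r) w (circ_int f r w).
Proof.
move=> eps e0; pose e' := eps / (8 * pi).
have p8 : 0 < 8 * pi :> R by rewrite mulr_gt0// pi_gt0.
have e'0 : 0 < e' by rewrite divr_gt0.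
have [t _|del del0 B] := @uniform_on_segment C (@norm1 R)
  (fun h t => norm1 (F (w + r%:C * expi t + h) - F (w + r%:C * expi t) -
                     f (w + r%:C * expi t) * h) <= e' * norm1 h) 0 (2 * pi).
  (* Strict differentiability at angle t covers all nearby angles t', with the displacement along
     the circle as [k]; hence a radius uniform in t. *)
  have [d1 d10 B1] := hol1_strict oU HF (Uc0 t) e'0.
  have [d2 d20 B2] := circ_near r t d10.
  exists (Num.min d1 d2); first by rewrite lt_min d10.
  move=> t' h; rewrite !lt_min => /andP[_ /B2 k1] /andP[h1 _].
  have := B1 _ _ k1 h1.
  by have -> : w + r%:C * expi t + (r%:C * expi t' - r%:C * expi t) = w + r%:C * expi t' by ring.
exists (Num.min del (rho / 2)); first by rewrite lt_min del0 divr_gt0.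
move=> h; rewrite lt_min => /andP[h1 h2].
have I1 := cintP 0 (2 * pi) (rcont_circM (cF h2)).
have I2 := cintP 0 (2 * pi) (rcont_circM (cF h00)).
have I3 := cintP 0 (2 * pi) (rcont_circM (cf h00)).
rewrite !addr0 in I2 I3.
have I := is_cintD (is_cintD I1 (is_cintN I2)) (is_cintN (is_cintZ h I3)).
have -> : eps * norm1 h = 8 * pi * (e' * norm1 h).
  by rewrite /e' mulrA mulrC [8 * pi * _]mulrC mulfVK ?gt_eqF// mulrC.
rewrite /circ_int [_ * h]mulrC.
apply: (@circ_int_bound (fun t => F (w + r%:C * expi t + h) - F (w + r%:C * expi t) -
                     f (w + r%:C * expi t) * h)).
  by apply: is_cint_ext I => t _; rewrite [w + h + _]addrAC; ring.
by move=> t tp; exact: B.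
Qed.

Lemma circ_int_cont : ccont (circ_int f r) w.
Proof.
move=> eps e0; pose e' := eps / (8 * pi).
have p8 : 0 < 8 * pi :> R by rewrite mulr_gt0// pi_gt0.
have e'0 : 0 < e' by rewrite divr_gt0.
have [t _|del del0 B] := @uniform_on_segment C (@norm1 R)
  (fun h t => norm1 (f (w + r%:C * expi t + h) - f (w + r%:C * expi t)) <= e') 0 (2 * pi).
  have [d1 d10 B1] := ccont_strict (HF (Uc0 t)).2 e'0.
  have [d2 d20 B2] := circ_near r t d10.
  exists (Num.min d1 d2); first by rewrite lt_min d10.
  move=> t' h; rewrite !lt_min => /andP[_ /B2 k1] /andP[h1 _].
  have := B1 _ _ k1 h1.
  by have -> : w + r%:C * expi t + (r%:C * expi t' - r%:C * expi t) = w + r%:C * expi t' by ring.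
exists (Num.min del (rho / 2)); first by rewrite lt_min del0 divr_gt0.
move=> h; rewrite lt_min => /andP[h1 h2].
have I1 := cintP 0 (2 * pi) (rcont_circM (cf h2)).
have I2 := cintP 0 (2 * pi) (rcont_circM (cf h00)).
rewrite !addr0 in I2.
have I := is_cintD I1 (is_cintN I2).
have -> : eps = 8 * pi * e' by rewrite /e' mulrC mulfVK ?gt_eqF.
rewrite /circ_int.
apply: (@circ_int_bound (fun t => f (w + r%:C * expi t + h) - f (w + r%:C * expi t))).
  by apply: is_cint_ext I => t _; rewrite [w + h + _]addrAC; ring.
by move=> t tp; exact: B.
Qed.

(* The t-derivative of F(w + r e^(it)) e^(-it) has mean zero over a period. *)
Lemma circ_int_mean :
  circ_int F r w = r%:C * cint (fun t => f (w + r%:C * expi t)) 0 (2 * pi).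
Proof.
have cf0 : forall t, ccont f (w + r%:C * expi t) by have := cf h00; rewrite addr0.
have cF0 : forall t, ccont F (w + r%:C * expi t) by have := cF h00; rewrite addr0.
have I1 := cintP 0 (2 * pi) (rcont_circ cf0).
have I2 := cintP 0 (2 * pi) (rcont_circM cF0).
have I := is_cintZ iC (is_cintD (is_cintZ r%:C I1) (is_cintN I2)).
have J : is_cint (fun t => iC * (r%:C * f (w + r%:C * expi t) - F (w + r%:C * expi t) * expi (- t)))
    0 (2 * pi) 0.
  exists (fun t => F (w + r%:C * expi t) * expi (- t)).
    move=> t _; have [dF _] := HF (Uc0 t).
    apply: cder_eq.
      apply: cderM; last exact: cder_expiN.
      apply: (@cder_comp _ F (fun t => w + r%:C * expi t)); last exact: dF.
      apply: cderD; first exact: cder_cst.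
      by apply: cderM; [exact: cder_cst|exact: cder_expi].
    rewrite mul0r !add0r -[in RHS](mulr1 (f _)) -(expiMN t); ring.
  by rewrite oppr0 !expi2pi subrr.
have := is_cint_unique pi2_ge0 I J.
rewrite -/(circ_int F r w) => /eqP; rewrite mulf_eq0 => /orP[/eqP[]/eqP|].
  by rewrite oner_eq0.
by rewrite subr_eq0 => /eqP.
Qed.

(** Differentiating F(w + r e^(it)) in r produces a factor e^(it), which cancels the weight
    e^(-it). *)
Lemma circ_int_der :
  cder (fun s => circ_int F s w) r (cint (fun t => f (w + r%:C * expi t)) 0 (2 * pi)).
Proof.
apply/cderP => eps e0; pose e' := eps / (8 * pi * 2).
have p8 : 0 < 8 * pi * 2 :> R by rewrite !mulr_gt0// pi_gt0.
have e'0 : 0 < e' by rewrite divr_gt0.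
have [t _|del del0 B] := @uniform_on_segment C (@norm1 R)
  (fun h t => norm1 (F (w + r%:C * expi t + h) - F (w + r%:C * expi t) -
                     f (w + r%:C * expi t) * h) <= e' * norm1 h) 0 (2 * pi).
  have [d1 d10 B1] := hol1_strict oU HF (Uc0 t) e'0.
  have [d2 d20 B2] := circ_near r t d10.
  exists (Num.min d1 d2); first by rewrite lt_min d10.
  move=> t' h; rewrite !lt_min => /andP[_ /B2 k1] /andP[h1 _].
  have := B1 _ _ k1 h1.
  by have -> : w + r%:C * expi t + (r%:C * expi t' - r%:C * expi t) = w + r%:C * expi t' by ring.
exists (Num.min (del / 2) (rho / 4)); first by rewrite lt_min !divr_gt0.
move=> h; rewrite lt_min => /andP[h1 h2].
have ke t : norm1 (h%:C * expi t) <= 2 * `|h|.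
  by rewrite norm1Cl mulrC ler_wpM2r// expi_norm1.
have kh t : norm1 (h%:C * expi t) < del.
  by apply: le_lt_trans (ke t) _; rewrite mulrC -ltr_pdivlMr.
have Uh t : U (w + (r + h)%:C * expi t).
  apply: HU; rewrite norm1Cl mulrC.
  apply: le_lt_trans (ler_wpM2r (normr_ge0 _) (expi_norm1 _)) _.
  have := ler_normD r h; rewrite (ger0_norm r0); have := rr; lra.
have I1 := cintP 0 (2 * pi) (rcont_circM (fun t => cdiff_ccont (HF (Uh t)).1)).
have I2 := cintP 0 (2 * pi) (rcont_circM (cF h00)).
have I3 := cintP 0 (2 * pi) (rcont_circ (cf h00)).
rewrite !addr0 in I2 I3.
have I := is_cintD (is_cintD I1 (is_cintN I2)) (is_cintN (is_cintZ h%:C I3)).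
have -> : eps * `|h| = 8 * pi * (e' * (2 * `|h|)).
  by transitivity (e' * (8 * pi * 2) * `|h|); [rewrite /e' mulfVK ?gt_eqF|ring].
rewrite /circ_int [_ * h%:C]mulrC.
apply: (@circ_int_bound (fun t => F (w + r%:C * expi t + h%:C * expi t) - F (w + r%:C * expi t) -
                     f (w + r%:C * expi t) * (h%:C * expi t))).
  apply: is_cint_ext I => t _.
  have -> : w + (r + h)%:C * expi t = w + r%:C * expi t + h%:C * expi t.
    by rewrite rmorphD; ring.
  rewrite -{2}(mulr1 (f _)) -(expiMN t); ring.
move=> t tp; apply: le_trans (B t _ tp (kh t)) _.
by apply: ler_wpM2l; [exact: ltW|exact: ke].
Qed.

End with_domain.

(* circ_int F s w / s does not depend on s, and tends to 2 pi f(w) as s -> 0. *)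
Lemma circ_int_formula U F f w (r rho : R) : copen U -> hol1 U F f -> 0 < r ->
  4 * r < rho -> (forall h, norm1 h < rho -> U (w + h)) ->
  circ_int F r w = (2 * pi * r)%:C * f w.
Proof.
move=> oU HF r0 rr HU.
have Uw : U w by rewrite -(addr0 w); apply: HU; rewrite norm10; lra.
have r0' : r%:C != 0 by apply/eqP => -[/eqP]; rewrite gt_eqF.
pose m s := cint (fun t => f (w + s%:C * expi t)) 0 (2 * pi).
have const s : 0 < s <= r -> circ_int F r w / r%:C = m s.
  move=> /andP[s0 sr].
  have s0' : s%:C != 0 by apply/eqP => -[/eqP]; rewrite gt_eqF.
  transitivity (circ_int F s w / s%:C); last first.
    rewrite (circ_int_mean HF (ltW s0) _ HU); last by lra.
    by rewrite mulrC mulKf.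
  (* With m the integral of f over the circle, the derivative is m / x - (x m) / x^2 = 0, by
     [circ_int_der] and [circ_int_mean]. *)
  apply: (@cder0_const _ (fun s => circ_int F s w / s%:C)) => // x /andP[sx xr].
  have x0' : x%:C != 0 by apply/eqP => -[/eqP]; rewrite gt_eqF//; lra.
  have x0 : 0 <= x by lra.
  have rx : 4 * x < rho by lra.
  apply: cder_eq.
    apply: cderM; first exact: (circ_int_der oU HF x0 rx HU).
    by apply: cderV => //; exact: cder_id.
  cbv beta; rewrite (circ_int_mean HF x0 rx HU); field.
  by rewrite x0'.
have pi0 : (2 * pi)%:C != 0 :> C.
  by apply/eqP => -[/eqP]; rewrite gt_eqF// mulr_gt0// pi_gt0.
suff -> : f w = circ_int F r w / r%:C / (2 * pi)%:C.
  have aux (p q x : C) : p != 0 -> q != 0 -> x = p * q * (x / q / p).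
    by move=> p0 q0; field; rewrite p0.
  by rewrite rmorphM; exact: aux.
apply/eqP; rewrite -subr_eq0; apply/eqP.
apply: (@norm1_le_eps _ _ 2) => e e0.
have [_ cfw] := HF w Uw; have [d d0 B] := cfw e e0.
(* The circle of radius s stays within 2 s < d of w, where f differs from f(w) by at most e. *)
pose s := Num.min r (d / 3).
have s0 : 0 < s by rewrite lt_min r0 divr_gt0.
have sr : s <= r by rewrite ge_min lexx.
have sd : s <= d / 3 by rewrite ge_min lexx orbT.
rewrite (const s) ?s0//.
have I1 : is_cint (fun t => f (w + s%:C * expi t)) 0 (2 * pi) (m s).
  apply: cintP; apply: rcont_circ => t.
  have [] := HF (w + s%:C * expi t) _ => //.
  by apply: (circ_in (ltW s0) _ HU); lra.
have := is_cintD (is_cintN I1) (is_cint_cst (f w) 0 (2 * pi)).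
rewrite subr0 => I.
have := is_cint_bound pi2_ge0 I (M := e) => /(_ _) K.
have -> : f w - m s / (2 * pi)%:C = (2 * pi)^-1%:C * (- m s + f w * (2 * pi)%:C).
  have aux (p x y : C) : p != 0 -> x - y / p = p^-1 * (- y + x * p).
    by move=> p0; field.
  by rewrite fmorphV; exact: aux.
rewrite norm1Cl ger0_norm ?invr_ge0// mulrC ler_pdivrMr ?mulr_gt0 ?pi_gt0//.
have := K _; rewrite subr0; apply => t _.
rewrite addrC norm1_dist.
apply: B; rewrite norm1Cl ger0_norm ?ltW// mulrC.
apply: le_lt_trans (ler_wpM2r (ltW s0) (expi_norm1 _)) _; lra.
Qed.

Lemma cdiff_near (F G : C -> C) w d : (exists2 del : R, 0 < del & forall h, norm1 h < del -> G (w + h) = F (w + h)) ->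
  cdiff F w d -> cdiff G w d.
Proof.
move=> [del d0 E] H e /H [d1 d10 B].
exists (Num.min del d1); first by rewrite lt_min d0.
move=> h; rewrite lt_min => /andP[/E -> /B].
by have := E 0; rewrite norm10 !addr0 => ->.
Qed.

Lemma cdiffZ (F : C -> C) w d c : cdiff F w d -> cdiff (fun w => c * F w) w (c * d).
Proof.
move=> H e e0; have c1 : 0 < norm1 c + 1 by rewrite ltr_wpDl// norm1_ge0.
have [del d0 B] := H _ (divr_gt0 e0 c1); exists del => // h /B K.
have -> : c * F (w + h) - c * F w - c * d * h = c * (F (w + h) - F w - d * h) by ring.
apply: le_trans (norm1M _ _) _.
apply: le_trans (ler_wpM2l (norm1_ge0 _) K) _.
rewrite mulrA ler_wpM2r ?norm1_ge0// mulrA ler_pdivrMr// mulrC ler_wpM2l ?ltW//.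
by rewrite ltrDl.
Qed.

Lemma ccontZ (F : C -> C) w c : ccont F w -> ccont (fun w => c * F w) w.
Proof.
move=> H e e0; have c1 : 0 < norm1 c + 1 by rewrite ltr_wpDl// norm1_ge0.
have [del d0 B] := H _ (divr_gt0 e0 c1); exists del => // h /B K.
rewrite -mulrBr; apply: le_trans (norm1M _ _) _.
apply: le_trans (ler_wpM2l (norm1_ge0 _) K) _.
rewrite mulrA ler_pdivrMr// mulrC ler_wpM2l ?ltW//.
by rewrite ltrDl.
Qed.

Lemma cdiff_unique (F : C -> C) w d d' : cdiff F w d -> cdiff F w d' -> d = d'.
Proof.
move=> H H'; apply/eqP; rewrite -subr_eq0; apply/eqP.
apply: (@norm1_le_eps _ _ 2) => e e0.
have [d1 d10 B1] := H e e0; have [d2 d20 B2] := H' e e0.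
pose t := Num.min d1 d2 / 2.
have t0 : 0 < t by rewrite divr_gt0// lt_min d10.
have tm : t < Num.min d1 d2 by rewrite ltr_pdivrMr// ltr_pMr ?lt_min ?d10// ltrDl.
have nt : norm1 t%:C = t by rewrite norm1C gtr0_norm.
move: tm; rewrite lt_min => /andP[t1 t2].
have := B1 t%:C; rewrite nt => /(_ t1) K1; have := B2 t%:C; rewrite nt => /(_ t2) K2.
rewrite -(ler_pM2r t0) -[t in norm1 _ * t](gtr0_norm t0) mulrC -norm1Cl.
have -> : t%:C * (d - d') = (F (w + t%:C) - F w - d' * t%:C) - (F (w + t%:C) - F w - d * t%:C) by ring.
apply: le_trans (norm1B _ _) _; lra.
Qed.

(** Near w, with a fixed radius, f equals [circ_int F r] up to a constant factor; its derivative is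
    [circ_int f r] up to the same factor, which is continuous because f is. *)
Theorem hol1_deriv U F f : copen U -> hol1 U F f -> exists f', hol1 U f f'.
Proof.
move=> oU HF.
have loc w : U w -> exists2 r : R, 0 < r & exists2 del : R, 0 < del & forall h, norm1 h < del ->
    cdiff f (w + h) ((2 * pi * r)^-1%:C * circ_int f r (w + h)) /\
    ccont (circ_int f r) (w + h).
  move=> Uw; have [rho rho0 HU] := oU w Uw.
  (* The ball about w is halved twice, for the shift h and for the further increment h', so 4 r <
     rho / 4 is required. *)
  pose r := rho / 20.
  have r0 : 0 < r by rewrite divr_gt0.
  have rr : 4 * r < rho / 2 by rewrite /r; lra.
  have rr' : 4 * r < rho / 2 / 2 by rewrite /r; lra.
  exists r => //; exists (rho / 2 / 2); first by rewrite !divr_gt0.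
  move=> h hd.
  have hd2 : norm1 h < rho / 2 by lra.
  have HUh := ball_shift HU hd2.
  split; last exact: (circ_int_cont HF (ltW r0) rr HUh).
  apply: (@cdiff_near (fun w => (2 * pi * r)^-1%:C * circ_int F r w)); last first.
    apply: cdiffZ; exact: (circ_int_diff oU HF (ltW r0) rr HUh).
  exists (rho / 2 / 2); first by rewrite !divr_gt0.
  move=> h' hd'.
  rewrite (circ_int_formula oU HF r0 rr' (ball_shift HUh hd')).
  rewrite mulrA -rmorphM mulVf ?mul1r//; by rewrite gt_eqF// !mulr_gt0// pi_gt0.
have ex w : exists d, U w -> cdiff f w d.
  have [Uw|nU] := pselect (U w); last by exists 0.
  have [r r0 [del d0 B]] := loc w Uw.
  have := B 0; rewrite norm10 addr0 => /(_ d0)[D _].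
  by exists ((2 * pi * r)^-1%:C * circ_int f r w).
have [f' Hf'] := choice ex.
exists f' => w Uw; split; first exact: Hf'.
have [r r0 [del d0 B]] := loc w Uw.
have [d1 d10 B1] := oU w Uw.
move=> e e0.
have cc : ccont (fun w => (2 * pi * r)^-1%:C * circ_int f r w) w.
  by apply: ccontZ; have := B 0; rewrite norm10 addr0 => /(_ d0)[].
have [d2 d20 B2] := cc e e0.
exists (Num.min (Num.min del d1) d2); first by rewrite !lt_min d0 d10.
have E h : norm1 h < del -> norm1 h < d1 -> f' (w + h) = (2 * pi * r)^-1%:C * circ_int f r (w + h).
  move=> /B[D _] /B1 Uh; exact: cdiff_unique (Hf' _ Uh) D.
move=> h; rewrite !lt_min => /andP[/andP[h1 h2] h3].
have := E 0; rewrite norm10 !addr0 => /(_ d0 d10) ->; rewrite E//; exact: B2.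
Qed.

Lemma copen_square (w0 : C) (rho : R) : copen (in_square w0 rho).
Proof.
move=> w [a b]; exists (Num.min (rho - `|Re (w - w0)|) (rho - `|Im (w - w0)|)).
  by rewrite lt_min !subr_gt0 a.
move=> h; rewrite lt_min => /andP[h1 h2].
have := Re_le_norm1 h; have := Im_le_norm1 h => hi hr.
split; rewrite addrAC ?ReD ?ImD; apply: le_lt_trans (ler_normD _ _) _; rewrite -?ReD -?ImD; lra.
Qed.

(** f is the derivative of its primitive F, and is continuous because it is differentiable;
    [hol1_deriv] applied to F makes its own derivative continuous. *)
Theorem holomorphic_hol1 (f : C -> C) (w0 : C) (rho : R) : 0 < rho ->
  (forall w, `|Re (w - w0)| <= rho -> `|Im (w - w0)| <= rho ->
     exists d, cdiff f w d) ->
  exists f', hol1 (in_square w0 rho) f f'.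
Proof.
move=> r0 Hf; have [F HF] := holomorphic_primitive r0 Hf.
apply: (@hol1_deriv _ F); first exact: copen_square.
move=> w Uw; split; first exact: HF.
have [||d /cdiff_ccont//] := Hf w; by case: Uw => ? ?; exact: ltW.
Qed.

End circle_averages.

(** * Comparison with the library topology *)

Section complex_topology.
Variable R : realType.
Local Notation C := R[i].
Local Notation Re := (@complex.Re R).
Local Notation Im := (@complex.Im R).

Lemma norm_le_norm1 (h : C) : `|h| <= (norm1 h)%:C.
Proof.
rewrite normc_def lecR /norm1 -(@ger0_norm _ (`|Re h| + `|Im h|)) ?addr_ge0//.
rewrite -sqrtr_sqr ler_wsqrtr// sqrrD !real_normK ?num_real// lerD2r lerDl.
by rewrite mulrn_wge0// mulr_ge0.
Qed.

Lemma norm1_le_norm (h : C) (e : R) : `|h| <= e%:C -> norm1 h <= 2 * e.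
Proof.
rewrite normc_def lecR => he; rewrite /norm1 mulr2n mulrDl mul1r.
by apply: lerD; apply: le_trans he; rewrite -sqrtr_sqr ler_wsqrtr// ?lerDl ?lerDr sqr_ge0.
Qed.

Lemma nbhs_norm1P (w : C) (P : C -> Prop) :
  (\forall w' \near (w : C^o), P w') <->
  exists2 del : R, 0 < del & forall h, norm1 h < del -> P (w + h).
Proof.
split=> [/nbhs_ballP[e /= e0 B]|[del d0 B]].
  have eR : e = (Re e)%:C by rewrite RRe_real// gtr0_real.
  exists (Re e); first by move: e0; rewrite eR ltcR.
  move=> h hd; apply: B; rewrite /ball /= opprD addNKr normrN eR.
  by apply: le_lt_trans (norm_le_norm1 h) _; rewrite ltcR.
apply/nbhs_ballP; exists (del / 3)%:C; first by rewrite /= ltcR divr_gt0.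
move=> w'; rewrite /ball /= distrC => /ltW/norm1_le_norm hd.
have -> : w' = w + (w' - w) by rewrite subrKC.
by apply: B; apply: le_lt_trans hd _; lra.
Qed.

Lemma derivable_cdiffP (f : C -> C) (w : C) :
  derivable (f : C^o -> C^o) w 1 <-> exists d, cdiff f w d.
Proof.
split=> [/cvg_ex[/= l]|[d D]].
  move=> Hl; exists l => e e0.
  have e2 : 0 < (e / 2)%:C :> C by rewrite ltcR divr_gt0.
  move: Hl => /cvgrPdist_le /(_ _ e2); rewrite near_withinE => /nbhs_norm1P[del d0 B].
  exists del => // h /B; rewrite add0r => K.
  have [->|h0] := eqVneq h 0.
    by rewrite addr0 mulr0 !subrr norm10 mulr0.
  have {}K := K h0; rewrite /= /GRing.scale /= mulr1 (addrC h w) in K.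
  have -> : f (w + h) - f w - l * h = - ((l - h^-1 * (f (w + h) - f w)) * h).
    by field.
  rewrite norm1N; apply: le_trans (norm1M _ _) _; rewrite ler_wpM2r ?norm1_ge0//.
  by apply: le_trans (norm1_le_norm K) _; lra.
apply/cvg_ex; exists d; apply/cvgrPdist_le => /= e e0.
have eR : e = (Re e)%:C by rewrite RRe_real// gtr0_real.
have e1 : 0 < Re e by move: e0; rewrite eR ltcR.
have [del d0 B] := D (Re e / 2) (divr_gt0 e1 (ltr0n _ 2)).
rewrite near_withinE; apply/nbhs_norm1P; exists del => // h hd h0.
rewrite add0r in h0 *; rewrite /GRing.scale /= mulr1 (addrC h w).
have nh : 0 < `|h| by rewrite normr_gt0.
rewrite -(ler_pM2r nh) -normrM eR.
have -> : (d - h^-1 * (f (w + h) - f w)) * h = - (f (w + h) - f w - d * h) by field.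
rewrite normrN; apply: le_trans (norm_le_norm1 _) _.
have : norm1 h <= 2 * complex.Re `|h|.
  by apply: norm1_le_norm; rewrite RRe_real// normr_real.
have := B h hd => K1 K2.
rewrite -[`|h|]RRe_real ?normr_real// -rmorphM lecR.
by apply: le_trans K1 _; nra.
Qed.

Lemma holomorphic_atP (f : C -> C) (w : C) : holomorphic_at f w <->
  exists2 del : R, 0 < del & forall h, norm1 h < del -> exists d, cdiff f (w + h) d.
Proof.
split=> [/nbhs_norm1P[del d0 B]|[del d0 B]].
  by exists del => // h /B /derivable_cdiffP.
by apply/nbhs_norm1P; exists del => // h /B /derivable_cdiffP.
Qed.

Lemma holomorphic_at_hol1 (f : C -> C) (w : C) : holomorphic_at f w ->
  exists2 rho : R, 0 < rho & exists f', hol1 (in_square w rho) f f'.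
Proof.
move=> /holomorphic_atP[del d0 B]; exists (del / 3); first by rewrite divr_gt0.
apply: holomorphic_hol1; first by rewrite divr_gt0.
move=> w' h1 h2; have -> : w' = w + (w' - w) by rewrite subrKC.
by apply: B; rewrite /norm1; lra.
Qed.

Lemma meromorphic_at_punctured (f : C -> C) (w0 : C) : meromorphic_at f w0 ->
  \forall w \near (w0 : C^o)^', holomorphic_at f w.
Proof.
move=> [N [g hg fE]]; move: hg fE => /nbhs_norm1P[d1 d10 B1].
rewrite near_withinE => /nbhs_norm1P[d2 d20 B2].
rewrite near_withinE; apply/nbhs_norm1P.
exists (Num.min d1 d2); first by rewrite lt_min d10.
move=> h; rewrite lt_min => /andP[h1 h2] hn.
have h0 : h != 0 by move: hn; apply: contra => /eqP->; rewrite addr0.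
(* The first term keeps the neighbourhood away from the singularity, the others inside the regions
   where g is holomorphic and f is the quotient. *)
pose m := Num.min (norm1 h) (Num.min (d1 - norm1 h) (d2 - norm1 h)).
have nh0 : 0 < norm1 h.
  by rewrite lt0r norm1_ge0 andbT; apply: contra h0 => /eqP/norm1_eq0/eqP.
have m0 : 0 < m by rewrite !lt_min nh0 !subr_gt0 h1.
have hne k : norm1 k < m -> w0 + h + k != w0.
  rewrite lt_min => /andP[km _]; apply/eqP => /eqP.
  rewrite -addrA addrC -subr_eq0 addrK => /eqP E.
  by move: km; rewrite (_ : k = - h) ?norm1N ?ltxx//; apply/eqP; rewrite -addr_eq0 addrC E.
apply/nbhs_norm1P; exists m => // k km.
have hk : norm1 (h + k) < d1 /\ norm1 (h + k) < d2.
  have := norm1D h k; move: km; rewrite !lt_min => /andP[_ /andP[? ?]] ?; split; lra.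
have dg : derivable (g : C^o -> C^o) (w0 + h + k) 1.
  by rewrite -addrA; apply: B1; case: hk.
apply/derivable_cdiffP.
suff [d D] : exists d, cdiff (fun w => g w / (w - w0) ^+ N) (w0 + h + k) d.
  exists d; apply: cdiff_near D.
  pose m' := Num.min (m - norm1 k) (d2 - norm1 (h + k)).
  have [_ hk2] := hk.
  exists m'; first by rewrite lt_min !subr_gt0 km.
  move=> l; rewrite lt_min => /andP[l1 l2].
  have E : w0 + h + k + l = w0 + (h + k + l) by rewrite !addrA.
  rewrite E; apply: B2; first by apply: le_lt_trans (norm1D _ _) _; lra.
  have := @hne (k + l); rewrite -E -addrA [k + l]addrC.
  rewrite !addrA [_ + l + k]addrAC; apply.
  by rewrite addrC; apply: le_lt_trans (norm1D _ _) _; lra.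
apply/derivable_cdiffP.
have nz : (w0 + h + k - w0) ^+ N != 0 by rewrite expf_neq0// subr_eq0 hne.
pose u : C^o -> C^o := fun w => w - w0.
have du x : derivable u x 1.
  by apply: derivableB; [exact: derivable_id|exact: derivable_cst].
have dX : derivable (fun w : C^o => u w ^+ N : C^o) (w0 + h + k) 1.
  have -> : (fun w : C^o => u w ^+ N : C^o) = u ^+ N.
    by apply/funext => y; rewrite exprfctE.
  exact: (derivableX (n := N) (du _)).
exact: (derivableM dg (derivableV nz dX)).
Qed.

End complex_topology.

(** * Functions generated by holomorphic functions of w *)

Section smooth_algebra.
Variable R : realType.
Local Notation C := R[i].
Local Notation Re := (@complex.Re R).
Local Notation Im := (@complex.Im R).
Variable z : C.
Local Notation wv := (soliton_var z).

Definition ddir (G : R -> R -> R -> C) (a b c x y t : R) (D : C) : Prop :=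
  cder (fun s => G (x + a * s) (y + b * s) (t + c * s)) 0 D.

Lemma soliton_varD (x y t a b c : R) :
  wv (x + a) (y + b) (t + c) = wv x y t + wv a b c.
Proof. by rewrite /soliton_var !rmorphD; ring. Qed.

Lemma soliton_varZ (a b c s : R) :
  wv (a * s) (b * s) (c * s) = wv a b c * s%:C.
Proof. by rewrite /soliton_var !rmorphM; ring. Qed.

Lemma ddir_soliton_var (a b c x y t : R) : ddir wv a b c x y t (wv a b c).
Proof.
rewrite /ddir; under eq_fun do rewrite soliton_varD soliton_varZ.
apply: cder_eq.
  apply: cderD; first exact: cder_cst.
  by apply: cderM; [exact: cder_cst|exact: cder_id].
by rewrite add0r mul0r add0r mulr1.
Qed.

Lemma ddir_unique G a b c x y t D D' :
  ddir G a b c x y t D -> ddir G a b c x y t D' -> D = D'.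
Proof. exact: cder_unique. Qed.

Section one_domain.
Variable U : C -> Prop.

(* Closed under directional derivatives, so that membership alone gives
   smoothness to all orders. *)
Inductive alg : (R -> R -> R -> C) -> Prop :=
| alg_cst c : alg (fun _ _ _ => c)
| alg_hol f f' : hol1 U f f' -> alg (fun x y t => f (wv x y t))
| alg_conj G : alg G -> alg (fun x y t => conjc (G x y t))
| alg_add G H : alg G -> alg H -> alg (fun x y t => G x y t + H x y t)
| alg_mul G H : alg G -> alg H -> alg (fun x y t => G x y t * H x y t)
| alg_inv G : (forall x y t, U (wv x y t) -> G x y t != 0) -> alg G ->
    alg (fun x y t => (G x y t)^-1).

Lemma alg_sum (I : Type) (r : seq I) (P : pred I) (G : I -> R -> R -> R -> C) :
  (forall i, alg (G i)) -> alg (fun x y t => \sum_(i <- r | P i) G i x y t).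
Proof.
move=> H; elim: r => [|i r IH].
  by under eq_fun do under eq_fun do under eq_fun do rewrite big_nil; exact: alg_cst.
under eq_fun do under eq_fun do under eq_fun do rewrite big_cons.
by case: (P i) => //; apply: alg_add.
Qed.

Lemma alg_prod (I : Type) (r : seq I) (P : pred I) (G : I -> R -> R -> R -> C) :
  (forall i, alg (G i)) -> alg (fun x y t => \prod_(i <- r | P i) G i x y t).
Proof.
move=> H; elim: r => [|i r IH].
  by under eq_fun do under eq_fun do under eq_fun do rewrite big_nil; exact: alg_cst.
under eq_fun do under eq_fun do under eq_fun do rewrite big_cons.
by case: (P i) => //; apply: alg_mul.
Qed.

Hypothesis oU : copen U.

Lemma alg_ddir2 G : alg G -> forall a b c a' b' c' : R,
  exists G1 G2 G12, [/\ alg G1, alg G2, alg G12 & forall x y t, U (wv x y t) ->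
    [/\ ddir G a b c x y t (G1 x y t), ddir G a' b' c' x y t (G2 x y t),
        ddir G1 a' b' c' x y t (G12 x y t) & ddir G2 a b c x y t (G12 x y t)]].
Proof.
move=> AG a b c a' b' c'; elim: AG => {G}.
- move=> k; exists (fun _ _ _ => 0), (fun _ _ _ => 0), (fun _ _ _ => 0).
  by split; try exact: alg_cst; move=> x y t _; split; exact: cder_cst.
- move=> f f' Hf; have [f'' Hf'] := hol1_deriv oU Hf.
  (* The third derivative certifies that f'' again yields a member of [alg]. *)
  have [f3 Hf''] := hol1_deriv oU Hf'.
  exists (fun x y t => f' (wv x y t) * wv a b c), (fun x y t => f' (wv x y t) * wv a' b' c'),
    (fun x y t => f'' (wv x y t) * (wv a b c * wv a' b' c')).
  split.
  - by apply: alg_mul; [exact: alg_hol Hf'|exact: alg_cst].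
  - by apply: alg_mul; [exact: alg_hol Hf'|exact: alg_cst].
  - by apply: alg_mul; [exact: alg_hol Hf''|exact: alg_cst].
  move=> x y t Uw.
  have H g g' d e h : hol1 U g g' ->
      ddir (fun x y t => g (wv x y t)) d e h x y t (g' (wv x y t) * wv d e h).
    move=> Hg; apply: cder_comp; first exact: ddir_soliton_var.
    by rewrite !mulr0 !addr0; have [] := Hg _ Uw.
  split; [exact: H Hf|exact: H Hf| |].
    apply: cder_eq; first by apply: cderM; [exact: H Hf'|exact: cder_cst].
    by cbv beta; ring.
  apply: cder_eq; first by apply: cderM; [exact: H Hf'|exact: cder_cst].
  by cbv beta; ring.
- move=> G _ [G1 [G2 [G12 [A1 A2 A12 H]]]].
  exists (fun x y t => conjc (G1 x y t)), (fun x y t => conjc (G2 x y t)),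
    (fun x y t => conjc (G12 x y t)); split; try exact: alg_conj.
  by move=> x y t /H[? ? ? ?]; split; apply: cderJ.
- move=> G K _ [G1 [G2 [G12 [A1 A2 A12 H]]]] _ [K1 [K2 [K12 [B1 B2 B12 L]]]].
  exists (fun x y t => G1 x y t + K1 x y t), (fun x y t => G2 x y t + K2 x y t),
    (fun x y t => G12 x y t + K12 x y t); split; try exact: alg_add.
  by move=> x y t /[dup] /H[? ? ? ?] /L[? ? ? ?]; split; apply: cderD.
- move=> G K AG [G1 [G2 [G12 [A1 A2 A12 H]]]] AK [K1 [K2 [K12 [B1 B2 B12 L]]]].
  exists (fun x y t => G1 x y t * K x y t + G x y t * K1 x y t),
    (fun x y t => G2 x y t * K x y t + G x y t * K2 x y t),
    (fun x y t => (G12 x y t * K x y t + G1 x y t * K2 x y t) +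
                  (G2 x y t * K1 x y t + G x y t * K12 x y t)).
  split; try by do ?[apply: alg_add|apply: alg_mul].
  move=> x y t /[dup] /H[? ? ? ?] /L[? ? ? ?]; split.
  - apply: cder_eq; first by apply: cderM; eassumption.
    by cbv beta; rewrite !mulr0 !addr0.
  - apply: cder_eq; first by apply: cderM; eassumption.
    by cbv beta; rewrite !mulr0 !addr0.
  - apply: cder_eq; first by apply: cderD; apply: cderM; eassumption.
    by cbv beta; rewrite !mulr0 !addr0.
  - apply: cder_eq; first by apply: cderD; apply: cderM; eassumption.
    by cbv beta; rewrite !mulr0 !addr0; ring.
- move=> G nz AG [G1 [G2 [G12 [A1 A2 A12 H]]]].
  have AV := alg_inv nz AG.
  pose V x y t := (G x y t)^-1.
  exists (fun x y t => -1 * (G1 x y t * (V x y t * V x y t))),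
    (fun x y t => -1 * (G2 x y t * (V x y t * V x y t))),
    (fun x y t => -1 * (G12 x y t * (V x y t * V x y t)) +
      2 * (G1 x y t * (G2 x y t * (V x y t * (V x y t * V x y t))))).
  split; try by do ?[apply: alg_add|apply: alg_mul|apply: alg_cst].
  move=> x y t Uw; have [h1 h2 h3 h4] := H x y t Uw; have nz0 := nz x y t Uw.
  have W d e f L : ddir G d e f x y t L -> ddir V d e f x y t (- L / (G x y t) ^+ 2).
    move=> h; apply: cder_eq; first by apply: cderV h; cbv beta; rewrite !mulr0 !addr0.
    by cbv beta; rewrite !mulr0 !addr0.
  split.
  - apply: cder_eq; first exact: W h1.
    by rewrite /V; field.
  - apply: cder_eq; first exact: W h2.
    by rewrite /V; field.
  - apply: cder_eq.
      apply: cderM; first exact: cder_cst.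
      apply: cderM; first exact: h3.
      by apply: cderM; exact: W h2.
    by cbv beta; rewrite !mulr0 !addr0 /V; field.
  - apply: cder_eq.
      apply: cderM; first exact: cder_cst.
      apply: cderM; first exact: h4.
      by apply: cderM; exact: W h1.
    by cbv beta; rewrite !mulr0 !addr0 /V; field.
Qed.

Lemma alg_ddir G : alg G -> forall a b c : R,
  exists2 G1, alg G1 & forall x y t, U (wv x y t) -> ddir G a b c x y t (G1 x y t).
Proof.
move=> AG a b c; have [G1 [G2 [G12 [A1 _ _ H]]]] := alg_ddir2 AG a b c a b c.
by exists G1 => // x y t /H[].
Qed.

(** * Joint continuity and smoothness in space-time *)

Definition cont3 (g : R -> R -> R -> R) (x y t : R) : Prop :=
  continuous_at (x, y, t) (fun p : R * R * R => g p.1.1 p.1.2 p.2).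

Lemma near_domain (x y t : R) (P : C -> Prop) :
  (exists2 del : R, 0 < del & forall h, norm1 h < del -> P (wv x y t + h)) ->
  \forall p \near ((x, y, t) : R * R * R), P (wv p.1.1 p.1.2 p.2).
Proof.
move=> [del d0 B].
pose M := 1 + norm1 ((z - z^-1) / 2) + norm1 ((z + z^-1) / 2).
have n1 := norm1_ge0 ((z - z^-1) / 2); have n2 := norm1_ge0 ((z + z^-1) / 2).
have M0 : 0 < M by rewrite /M; lra.
have e0 : 0 < del / M by rewrite divr_gt0.
apply/nbhs_ballP; exists (del / M) => // -[[x' y'] t'] /= [[/= b1 b2] b3].
rewrite /ball /= in b1 b2 b3.
have -> : wv x' y' t' = wv x y t + wv (x' - x) (y' - y) (t' - t).
  by rewrite -soliton_varD !subrKC.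
apply: B; rewrite /soliton_var.
rewrite distrC in b1; rewrite distrC in b2; rewrite distrC in b3.
apply: le_lt_trans (norm1D _ _) _.
apply: le_lt_trans (lerD (norm1D _ _) (norm1M _ _)) _.
apply: le_lt_trans (lerD (lerD (lexx _) (norm1M _ _)) (lexx _)) _.
rewrite !norm1C.
have -> : del = del / M + norm1 ((z - z^-1) / 2) * (del / M) + norm1 ((z + z^-1) / 2) * (del / M).
  by rewrite -[X in X + _ + _]mul1r -!mulrDl mulrC mulfVK// gt_eqF.
rewrite ltr_leD// ?ltr_leD//; apply: ler_wpM2l => //; exact: ltW.
Qed.

Lemma alg_cont G : alg G -> forall x y t, U (wv x y t) ->
  cont3 (fun x y t => Re (G x y t)) x y t /\ cont3 (fun x y t => Im (G x y t)) x y t.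
Proof.
rewrite /cont3; elim=> {G}.
- by move=> c x y t _; split; exact: cvg_cst.
- move=> f f' Hf x y t Uw; have [_ /(_ _)] := Hf _ Uw => _.
  have [/cdiff_ccont cf _] := Hf _ Uw.
  by split; apply/cvgrPdist_le => e e0; have [del d0 B] := cf e e0;
    apply: (@near_domain x y t (fun w => `|_ (f (wv x y t)) - _ (f w)| <= e));
    exists del => // h /B; apply: le_trans; rewrite distrC -?ReN -?ReD -?ImN -?ImD
    ?Re_le_norm1 ?Im_le_norm1.
- move=> G _ IH x y t /IH[a b]; split.
    by under eq_fun do rewrite ReJ.
  by under eq_fun do rewrite ImJ; exact: continuousN.
- move=> G H _ IH1 _ IH2 x y t /[dup] /IH1[a b] /IH2[a' b']; split.
    by under eq_fun do rewrite ReD; exact: continuousD.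
  by under eq_fun do rewrite ImD; exact: continuousD.
- move=> G H _ IH1 _ IH2 x y t /[dup] /IH1[a b] /IH2[a' b']; split.
    under eq_fun do rewrite ReM.
    exact: (continuousB (continuousM a a') (continuousM b b')).
  under eq_fun do rewrite ImM.
  exact: (continuousD (continuousM a b') (continuousM b a')).
- move=> G nz _ IH x y t Uw; have [a b] := IH x y t Uw.
  have n0 := sqr_neq0 (nz x y t Uw).
  have V : continuous_at (x, y, t) (fun p : R * R * R =>
     (Re (G p.1.1 p.1.2 p.2) * Re (G p.1.1 p.1.2 p.2) +
      Im (G p.1.1 p.1.2 p.2) * Im (G p.1.1 p.1.2 p.2))^-1).
    rewrite !expr2 in n0.
    pose q (p : R * R * R) : R := Re (G p.1.1 p.1.2 p.2) * Re (G p.1.1 p.1.2 p.2) +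
      Im (G p.1.1 p.1.2 p.2) * Im (G p.1.1 p.1.2 p.2).
    have cq : q @ (x, y, t) --> q (x, y, t).
      exact: (continuousD (continuousM a a) (continuousM b b)).
    exact: (cvgV (n0 : q (x, y, t) != 0) cq).
  split.
    under eq_fun do rewrite ReV !expr2.
    exact: (continuousM a V).
  under eq_fun do rewrite ImV !expr2.
  exact: (continuousM (continuousN b) V).
Qed.

End one_domain.

(** Holomorphic frames exist only locally in w, so membership in the algebra can only be asked
    locally. *)
Definition loc_alg (F : R -> R -> R -> C) : Prop := forall x y t, exists U G,
  [/\ copen U, U (wv x y t), alg U G &
      forall x' y' t', U (wv x' y' t') -> F x' y' t' = G x' y' t'].

Lemma ddir_ext U F G a b c x y t D : copen U -> U (wv x y t) ->
  (forall x' y' t', U (wv x' y' t') -> F x' y' t' = G x' y' t') ->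
  ddir G a b c x y t D -> ddir F a b c x y t D.
Proof.
move=> oU Uw E; apply: cder_near; have [del d0 B] := oU _ Uw.
have M0 : 0 < 1 + norm1 (wv a b c) by rewrite ltr_pwDl// norm1_ge0.
exists (del / (1 + norm1 (wv a b c))); first by rewrite divr_gt0.
move=> h; rewrite ltr_pdivlMr// => hd; apply: E.
rewrite add0r soliton_varD soliton_varZ; apply: B.
apply: le_lt_trans (norm1M _ _) _; rewrite norm1C.
by apply: le_lt_trans hd; rewrite mulrC ler_wpM2l// lerDr.
Qed.

(** The derivative is selected point by point; uniqueness makes it agree with each local formula, so
    it stays locally in the algebra. *)
Lemma loc_alg_ddir F (a b c : R) : loc_alg F ->
  exists2 F', loc_alg F' & forall x y t, ddir F a b c x y t (F' x y t).
Proof.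
move=> HF.
have ex (p : R * R * R) : exists D, ddir F a b c p.1.1 p.1.2 p.2 D.
  case: p => -[x y] t /=; have [U [G [oU Uw AG E]]] := HF x y t.
  have [G1 _ H] := alg_ddir oU AG a b c.
  by exists (G1 x y t); apply: (ddir_ext oU Uw E); exact: H.
have [F' HF'] := choice ex.
exists (fun x y t => F' (x, y, t)); last by move=> x y t; exact: HF' (x, y, t).
move=> x y t; have [U [G [oU Uw AG E]]] := HF x y t.
have [G1 AG1 H] := alg_ddir oU AG a b c.
exists U, G1; split => // x' y' t' Uw'.
apply: ddir_unique (HF' (x', y', t')) _.
by apply: (ddir_ext oU Uw' E); exact: H.
Qed.

Lemma ddir_x F x y t D : ddir F 1 0 0 x y t D -> cder (fun s => F s y t) x D.
Proof.
move=> H; have -> : (fun s => F s y t) =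
    (fun s => (fun s => F (x + 1 * s) (y + 0 * s) (t + 0 * s)) (- x + 1 * s)).
  by apply/funext => s /=; rewrite !mul0r !addr0 !mul1r addrA subrr add0r.
rewrite -[D]mul1r; 
  apply: (@cder_affine _ (fun s => F (x + 1 * s) (y + 0 * s) (t + 0 * s))); by rewrite mul1r addNr.
Qed.

Lemma ddir_y F x y t D : ddir F 0 1 0 x y t D -> cder (fun s => F x s t) y D.
Proof.
move=> H; have -> : (fun s => F x s t) =
    (fun s => (fun s => F (x + 0 * s) (y + 1 * s) (t + 0 * s)) (- y + 1 * s)).
  by apply/funext => s /=; rewrite !mul0r !addr0 !mul1r addrA subrr add0r.
rewrite -[D]mul1r; 
  apply: (@cder_affine _ (fun s => F (x + 0 * s) (y + 1 * s) (t + 0 * s))); by rewrite mul1r addNr.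
Qed.

Lemma ddir_t F x y t D : ddir F 0 0 1 x y t D -> cder (fun s => F x y s) t D.
Proof.
move=> H; have -> : (fun s => F x y s) =
    (fun s => (fun s => F (x + 0 * s) (y + 0 * s) (t + 1 * s)) (- t + 1 * s)).
  by apply/funext => s /=; rewrite !mul0r !addr0 !mul1r addrA subrr add0r.
rewrite -[D]mul1r; 
  apply: (@cder_affine _ (fun s => F (x + 0 * s) (y + 0 * s) (t + 1 * s))); by rewrite mul1r addNr.
Qed.

Lemma ddir_u F x y t D : ddir F 0 1 1 x y t D ->
  cder (fun u => F x (u - (t - y) / 2) (u + (t - y) / 2)) ((t + y) / 2) D.
Proof.
move=> H; have -> : (fun u => F x (u - (t - y) / 2) (u + (t - y) / 2)) =
    (fun s => (fun s => F (x + 0 * s) (y + 1 * s) (t + 1 * s)) (- ((t + y) / 2) + 1 * s)).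
  apply/funext => s /=; rewrite !mul0r !addr0 !mul1r.
  by congr (F _ _ _); field.
rewrite -[D]mul1r; 
  apply: (@cder_affine _ (fun s => F (x + 0 * s) (y + 1 * s) (t + 1 * s))); by rewrite mul1r addNr.
Qed.

Lemma ddir_v F x y t D : ddir F 0 (-1) 1 x y t D ->
  cder (fun v => F x ((t + y) / 2 - v) ((t + y) / 2 + v)) ((t - y) / 2) D.
Proof.
move=> H; have -> : (fun v => F x ((t + y) / 2 - v) ((t + y) / 2 + v)) =
    (fun s => (fun s => F (x + 0 * s) (y + -1 * s) (t + 1 * s)) (- ((t - y) / 2) + 1 * s)).
  apply/funext => s /=; rewrite !mul0r !addr0 !mul1r !mulN1r.
  by congr (F _ _ _); field.
rewrite -[D]mul1r; 
  apply: (@cder_affine _ (fun s => F (x + 0 * s) (y + -1 * s) (t + 1 * s))); by rewrite mul1r addNr.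
Qed.

Lemma loc_alg_Ck F m : loc_alg F ->
  Ck m (fun x y t => Re (F x y t)) /\ Ck m (fun x y t => Im (F x y t)).
Proof.
have cont F' : loc_alg F' ->
    continuous (fun p : R * R * R => Re (F' p.1.1 p.1.2 p.2)) /\
    continuous (fun p : R * R * R => Im (F' p.1.1 p.1.2 p.2)).
  move=> HF; split=> -[[x y] t]; have [U [G [oU Uw AG E]]] := HF x y t;
    have [cR cI] := alg_cont AG Uw; have nU := near_domain (oU _ Uw).
    rewrite /continuous_at /= E//; apply: cvg_trans cR.
    by apply: near_eq_cvg; near do rewrite E//.
  rewrite /continuous_at /= E//; apply: cvg_trans cI.
  by apply: near_eq_cvg; near do rewrite E//.
elim: m F => [|m IH] F HF; have [cR cI] := cont F HF; first by [].
have [Fx Lx Hx] := loc_alg_ddir 1 0 0 HF.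
have [Fy Ly Hy] := loc_alg_ddir 0 1 0 HF.
have [Ft Lt Ht] := loc_alg_ddir 0 0 1 HF.
have d1 (f : R -> R) x d : is_derive x (1 : R) f d -> derive1 f x = d.
  by move=> [_ <-]; rewrite derive1E.
have [Rx Ix] := IH _ Lx; have [Ry Iy] := IH _ Ly; have [Rt It] := IH _ Lt.
split; split => //; split.
- move=> x y t; split.
  + have [[D _] _] := ddir_x (Hx x y t); exact: D.
  + have [[D _] _] := ddir_y (Hy x y t); exact: D.
  + have [[D _] _] := ddir_t (Ht x y t); exact: D.
- move: Rx; congr (Ck m _); apply/funext => x; apply/funext => y; apply/funext => t.
  apply/esym/d1; have [D _] := ddir_x (Hx x y t); exact: D.
- move: Ry; congr (Ck m _); apply/funext => x; apply/funext => y; apply/funext => t.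
  apply/esym/d1; have [D _] := ddir_y (Hy x y t); exact: D.
- move: Rt; congr (Ck m _); apply/funext => x; apply/funext => y; apply/funext => t.
  apply/esym/d1; have [D _] := ddir_t (Ht x y t); exact: D.
- move=> x y t; split.
  + have [_ [D _]] := ddir_x (Hx x y t); exact: D.
  + have [_ [D _]] := ddir_y (Hy x y t); exact: D.
  + have [_ [D _]] := ddir_t (Ht x y t); exact: D.
- move: Ix; congr (Ck m _); apply/funext => x; apply/funext => y; apply/funext => t.
  apply/esym/d1; have [_ D] := ddir_x (Hx x y t); exact: D.
- move: Iy; congr (Ck m _); apply/funext => x; apply/funext => y; apply/funext => t.
  apply/esym/d1; have [_ D] := ddir_y (Hy x y t); exact: D.
- move: It; congr (Ck m _); apply/funext => x; apply/funext => y; apply/funext => t.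
  apply/esym/d1; have [_ D] := ddir_t (Ht x y t); exact: D.
Unshelve. all: by end_near.
Qed.

End smooth_algebra.

(** * Hermitian projections *)

Section projections.
Local Open Scope sesquilinear_scope.
Variable R : realType.
Local Notation C := R[i].

Lemma adjM m n p (A : 'M[C]_(m, n)) (B : 'M[C]_(n, p)) :
  (A *m B)^t* = B^t* *m A^t*.
Proof. by rewrite trmx_mul map_mxM. Qed.

(** If v W^* W = 0 then y = v W^* has y y^* = 0, a sum of squared moduli, so y = 0; full rank gives
    v = 0. *)
Lemma gram_unit n k (W : 'M[C]_(n, k)) : \rank W = k -> W^t* *m W \in unitmx.
Proof.
move=> rW; rewrite -row_free_unit -kermx_eq0; apply/rowV0P => v /sub_kermxP vG.
have y0 : v *m W^t* = 0.
  set y := v *m W^t*.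
  have : (y *m y^t*) 0 0 = 0.
    by rewrite /y adjM trmxCK !mulmxA -(mulmxA v) vG mul0mx mxE.
  rewrite mxE => /eqP; rewrite psumr_eq0 => [/allP H|j _]; last first.
    by rewrite !mxE -normCK exprn_ge0.
  apply/rowP => j; rewrite [RHS]mxE; have := H j (mem_index_enum _).
  by rewrite !mxE -normCK sqrf_eq0 normr_eq0 => /eqP.
have rf : row_free (W^t*) by rewrite /row_free mxrank_map mxrank_tr rW.
by apply/eqP; rewrite -(mulmx_free_eq0 _ rf) y0.
Qed.

Lemma col_colspan m p (A : 'M[C]_(m, p)) j : col j A \in colspan A.
Proof. by apply: memv_span; apply: map_f; rewrite mem_enum. Qed.

Lemma colspanP m p (A : 'M[C]_(m, p)) (v : 'cV[C]_m) :
  v \in colspan A -> exists u : 'cV[C]_p, v = A *m u.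
Proof.
pose f : 'Hom('cV[C]_p, 'cV[C]_m) := linfun (mulmx A).
have sub : (colspan A <= limg f)%VS.
  apply/span_subvP => w /mapP[j _ ->]; apply/memv_imgP.
  by exists (delta_mx j 0); [exact: memvf|rewrite lfunE /= -colE].
by move=> /(subvP sub)/memv_imgP[u _ ->]; exists u; rewrite lfunE.
Qed.

Lemma mem_colspan m p (A : 'M[C]_(m, p)) (u : 'cV[C]_p) : A *m u \in colspan A.
Proof.
have -> : A *m u = \sum_j u j 0 *: col j A.
  apply/colP => i; rewrite mxE summxE; apply: eq_bigr => j _.
  by rewrite !mxE mulrC.
by apply: memv_suml => j _; apply: memvZ; exact: col_colspan.
Qed.

Lemma col_mulmx m n p (A : 'M[C]_(m, n)) (B : 'M[C]_(n, p)) j :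
  col j (A *m B) = A *m col j B.
Proof. by rewrite !colE mulmxA. Qed.

Lemma colspan_mul m n p (A : 'M[C]_(m, n)) (B : 'M[C]_(n, p)) :
  (colspan (A *m B) <= colspan A)%VS.
Proof.
apply/span_subvP => w /mapP[j _ ->]; rewrite col_mulmx; exact: mem_colspan.
Qed.

Lemma hermitian_projection_id n p (P : 'M[C]_n) U (A : 'M[C]_(n, p)) :
  hermitian_projection_onto P U -> (colspan A <= U)%VS -> P *m A = A.
Proof.
move=> [_ PP <-] sub; apply/matrixP => i j.
suff : P *m col j A = col j A.
  by rewrite -col_mulmx => /matrixP/(_ i 0); rewrite !mxE.
have /colspanP[u ->] : col j A \in colspan P.
  by apply: (subvP sub); exact: col_colspan.
by rewrite mulmxA PP.
Qed.

(** Equal ranges give P Q = Q and Q P = P; hence P = P^* = (Q P)^* = P Q = Q. *)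
Lemma hermitian_projection_unique n (P Q : 'M[C]_n) U :
  hermitian_projection_onto P U -> hermitian_projection_onto Q U -> P = Q.
Proof.
move=> HP HQ; have [hP _ sP] := HP; have [hQ _ sQ] := HQ.
have PQ : P *m Q = Q by apply: (hermitian_projection_id HP); rewrite sQ subvv.
have QP : Q *m P = P by apply: (hermitian_projection_id HQ); rewrite sP subvv.
by rewrite -hP -QP adjM hP hQ PQ.
Qed.

Definition colproj n k (W : 'M[C]_(n, k)) : 'M[C]_n :=
  W *m invmx (W^t* *m W) *m W^t*.

Lemma colprojW n k (W : 'M[C]_(n, k)) : \rank W = k -> colproj W *m W = W.
Proof.
by move=> /gram_unit G; rewrite /colproj -!mulmxA mulVmx// mulmx1.
Qed.

Lemma colprojP n k (W : 'M[C]_(n, k)) : \rank W = k ->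
  hermitian_projection_onto (colproj W) (colspan W).
Proof.
move=> rW; have G := gram_unit rW; split.
- rewrite /colproj !adjM trmxCK mulmxA; congr (_ *m _ *m _).
  rewrite trmx_inv map_invmx; congr invmx.
  by rewrite adjM trmxCK.
- by rewrite {2}/colproj !mulmxA colprojW.
- apply/eqP; rewrite eqEsubv; apply/andP; split.
    by rewrite /colproj -mulmxA colspan_mul.
  by rewrite -{1}(colprojW rW) colspan_mul.
Qed.

Lemma hermitian_projection_colproj n k (P : 'M[C]_n) (W : 'M[C]_(n, k)) :
  \rank W = k -> hermitian_projection_onto P (colspan W) -> P = colproj W.
Proof.
by move=> rW HP; apply: hermitian_projection_unique HP _; exact: colprojP.
Qed.

(** Sylvester's identity: the block matrix [M] is multiplied on the right and on the left by the
    same unipotent matrix. *)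
Lemma det_add1_mulC n k (A : 'M[C]_(n, k)) (B : 'M[C]_(k, n)) :
  \det (1%:M + A *m B) = \det (1%:M + B *m A).
Proof.
pose M := block_mx 1%:M (- A) B 1%:M.
have E1 : M *m block_mx 1%:M A 0 1%:M = block_mx 1%:M 0 B (1%:M + B *m A).
  rewrite mulmx_block !mul1mx !mulmx1 !mulmx0 !addr0 subrr.
  by rewrite addrC.
have E2 : block_mx 1%:M A 0 1%:M *m M = block_mx (1%:M + A *m B) 0 B 1%:M.
  by rewrite mulmx_block !mul1mx !mul0mx !mulmx1 !add0r addNr.
have := congr1 determinant E1; rewrite det_mulmx det_ublock det_lblock !det1 !mul1r !mulr1 => <-.
by have := congr1 determinant E2; rewrite det_mulmx det_ublock det_lblock !det1 !mul1r !mulr1 => <-.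
Qed.

(** Sylvester's identity moves the computation to size k, where the Gram matrix cancels and the
    scalar matrix c remains. *)
Lemma det_colproj n k (W : 'M[C]_(n, k)) c : \rank W = k ->
  \det ((1%:M - colproj W) + c *: colproj W) = c ^+ k.
Proof.
move=> rW.
have -> : (1%:M - colproj W) + c *: colproj W =
    1%:M + W *m ((c - 1) *: (invmx (W^t* *m W) *m W^t*)).
  rewrite -scalemxAr mulmxA -/(colproj W) scalerBl scale1r.
  by rewrite -addrA; congr (_ + _); rewrite addrC.
rewrite det_add1_mulC -scalemxAl -mulmxA mulVmx ?gram_unit//.
rewrite scalemx1 (_ : 1%:M + _ = c%:M) ?det_scalar//.
by apply/matrixP => i j; rewrite !mxE -mulrnDl addrC subrK.
Qed.

Section idempotent.
Variables (n : nat) (P : 'M[C]_n).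
Hypothesis PP : P *m P = P.

Lemma simple_mul (c d : C) :
  ((1%:M - P) + c *: P) *m ((1%:M - P) + d *: P) = (1%:M - P) + (c * d) *: P.
Proof.
have QP : (1%:M - P) *m P = 0 by rewrite mulmxBl mul1mx PP subrr.
have PQ : P *m (1%:M - P) = 0 by rewrite mulmxBr mulmx1 PP subrr.
have QQ : (1%:M - P) *m (1%:M - P) = 1%:M - P by rewrite mulmxBr mulmx1 QP subr0.
move: (1%:M - P) QP PQ QQ => Q QP PQ QQ.
rewrite mulmxDl !mulmxDr -!scalemxAl -!scalemxAr QP PQ QQ PP.
by rewrite !scaler0 addr0 add0r scalerA.
Qed.

Lemma simple_mulV (c : C) : c != 0 ->
  ((1%:M - P) + c *: P) *m ((1%:M - P) + c^-1 *: P) = 1%:M.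
Proof. by move=> c0; rewrite simple_mul divff// scale1r subrK. Qed.

Lemma simple_unit (c : C) : c != 0 -> (1%:M - P) + c *: P \in unitmx.
Proof. by move=> c0; have [u _] := mulmx1_unit (simple_mulV c0); exact: u. Qed.

Lemma simple_inv (c : C) : c != 0 ->
  invmx ((1%:M - P) + c *: P) = (1%:M - P) + c^-1 *: P.
Proof.
move=> c0; have u := simple_unit c0.
by rewrite -[RHS](mulKmx u) simple_mulV// mulmx1.
Qed.

End idempotent.

End projections.

(** * Matrix calculus and local frames *)

Section matrix_calculus.
Local Open Scope sesquilinear_scope.
Variable R : realType.
Local Notation C := R[i].
Local Notation Re := (@complex.Re R).
Local Notation Im := (@complex.Im R).
Variable z : C.
Local Notation wv := (soliton_var z).

Definition ddirmx m p (F : R -> R -> R -> 'M[C]_(m, p)) (a b c x y t : R)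
    (D : 'M[C]_(m, p)) : Prop :=
  forall i j, ddir (fun x y t => F x y t i j) a b c x y t (D i j).

Lemma cder_sum (I : Type) (r : seq I) (F : I -> R -> C) (D : I -> C) s :
  (forall i, cder (F i) s (D i)) ->
  cder (fun s => \sum_(i <- r) F i s) s (\sum_(i <- r) D i).
Proof.
move=> H; elim: r => [|i r IH].
  by under eq_fun do rewrite big_nil; rewrite big_nil; exact: cder_cst.
by under eq_fun do rewrite big_cons; rewrite big_cons; exact: cderD.
Qed.

Lemma ddirmx_unique m p (F : R -> R -> R -> 'M[C]_(m, p)) a b c x y t D D' :
  ddirmx F a b c x y t D -> ddirmx F a b c x y t D' -> D = D'.
Proof.
by move=> H H'; apply/matrixP => i j; exact: ddir_unique (H i j) (H' i j).
Qed.

Lemma ddirmx_eq m p (F : R -> R -> R -> 'M[C]_(m, p)) a b c x y t D D' :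
  ddirmx F a b c x y t D -> D = D' -> ddirmx F a b c x y t D'.
Proof. by move=> H <-. Qed.

Lemma ddirmx_cst m p (A : 'M[C]_(m, p)) a b c x y t :
  ddirmx (fun _ _ _ => A) a b c x y t 0.
Proof. by move=> i j; rewrite mxE; exact: cder_cst. Qed.

Lemma ddirmxD m p (F G : R -> R -> R -> 'M[C]_(m, p)) a b c x y t D E :
  ddirmx F a b c x y t D -> ddirmx G a b c x y t E ->
  ddirmx (fun x y t => F x y t + G x y t) a b c x y t (D + E).
Proof.
move=> H K i j; rewrite /ddir mxE; under eq_fun do rewrite mxE.
exact: (cderD (H i j) (K i j)).
Qed.

Lemma ddirmxZ m p (F : R -> R -> R -> 'M[C]_(m, p)) a b c x y t D (k : C) :
  ddirmx F a b c x y t D ->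
  ddirmx (fun x y t => k *: F x y t) a b c x y t (k *: D).
Proof.
move=> H i j; rewrite /ddir mxE; under eq_fun do rewrite mxE.
apply: cder_eq; first by apply: cderM; [exact: cder_cst|exact: H].
by rewrite mul0r add0r.
Qed.

Lemma ddirmxN m p (F : R -> R -> R -> 'M[C]_(m, p)) a b c x y t D :
  ddirmx F a b c x y t D ->
  ddirmx (fun x y t => - F x y t) a b c x y t (- D).
Proof.
move=> H i j; rewrite /ddir mxE; under eq_fun do rewrite mxE.
exact: (cderN (H i j)).
Qed.

Lemma ddirmxM m p q (F : R -> R -> R -> 'M[C]_(m, p)) (G : R -> R -> R -> 'M[C]_(p, q))
    a b c x y t D E :
  ddirmx F a b c x y t D -> ddirmx G a b c x y t E ->
  ddirmx (fun x y t => F x y t *m G x y t) a b c x y t (D *m G x y t + F x y t *m E).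
Proof.
move=> H K i j; rewrite /ddir !mxE -big_split /=; under eq_fun do rewrite mxE.
apply: cder_sum => l; apply: cder_eq; first exact: (cderM (H i l) (K l j)).
by cbv beta; rewrite !mulr0 !addr0.
Qed.

Lemma ddirmx_adj m p (F : R -> R -> R -> 'M[C]_(m, p)) a b c x y t D :
  ddirmx F a b c x y t D ->
  ddirmx (fun x y t => (F x y t)^t*) a b c x y t (D^t*).
Proof.
move=> H i j; rewrite /ddir !mxE; under eq_fun do rewrite !mxE.
exact: (cderJ (H j i)).
Qed.

Lemma mx_deriveE n (F : R -> 'M[C]_n) s (D : 'M[C]_n) :
  (forall i j, cder (fun s => F s i j) s (D i j)) -> mx_derive F s = D.
Proof.
move=> H; apply/matrixP => i j; rewrite mxE; have [[_ a] [_ b]] := H i j.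
by apply: complex_eqP; rewrite /= derive1E.
Qed.

Lemma DxE n (F : R -> R -> R -> 'M[C]_n) x y t D :
  ddirmx F 1 0 0 x y t D -> Dx F x y t = D.
Proof.
by move=> H; apply: mx_deriveE => i j; exact: (@ddir_x _ (fun x y t => F x y t i j)).
Qed.

Lemma DyE n (F : R -> R -> R -> 'M[C]_n) x y t D :
  ddirmx F 0 1 0 x y t D -> Dy F x y t = D.
Proof.
by move=> H; apply: mx_deriveE => i j; exact: (@ddir_y _ (fun x y t => F x y t i j)).
Qed.

Lemma DtE n (F : R -> R -> R -> 'M[C]_n) x y t D :
  ddirmx F 0 0 1 x y t D -> Dt F x y t = D.
Proof.
by move=> H; apply: mx_deriveE => i j; exact: (@ddir_t _ (fun x y t => F x y t i j)).
Qed.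

Lemma DuE n (F : R -> R -> R -> 'M[C]_n) x y t D :
  ddirmx F 0 1 1 x y t D -> Du F x y t = D.
Proof.
by move=> H; apply: mx_deriveE => i j; exact: (@ddir_u _ (fun x y t => F x y t i j)).
Qed.

Lemma DvE n (F : R -> R -> R -> 'M[C]_n) x y t D :
  ddirmx F 0 (-1) 1 x y t D -> Dv F x y t = D.
Proof.
by move=> H; apply: mx_deriveE => i j; exact: (@ddir_v _ (fun x y t => F x y t i j)).
Qed.

Definition algmx U m p (F : R -> R -> R -> 'M[C]_(m, p)) : Prop :=
  forall i j, alg z U (fun x y t => F x y t i j).

Lemma alg_ext U G H : (forall x y t, G x y t = H x y t) -> alg z U G -> alg z U H.
Proof.
move=> E; suff -> : H = G by [].
by do 3 (apply/funext => ?); rewrite E.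
Qed.

Lemma algmxM U m p q (F : R -> R -> R -> 'M[C]_(m, p)) (G : R -> R -> R -> 'M[C]_(p, q)) :
  algmx U F -> algmx U G -> algmx U (fun x y t => F x y t *m G x y t).
Proof.
move=> H K i j.
apply: (@alg_ext _ (fun x y t => \sum_l F x y t i l * G x y t l j)).
  by move=> x y t; rewrite mxE.
by apply: alg_sum => l; apply: alg_mul.
Qed.

Lemma algmx_adj U m p (F : R -> R -> R -> 'M[C]_(m, p)) :
  algmx U F -> algmx U (fun x y t => (F x y t)^t*).
Proof.
move=> H i j; apply: (@alg_ext _ (fun x y t => conjc (F x y t j i))).
  by move=> x y t; rewrite !mxE.
exact: alg_conj.
Qed.

Lemma alg_det U n (F : R -> R -> R -> 'M[C]_n) : algmx U F ->
  alg z U (fun x y t => \det (F x y t)).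
Proof.
move=> H; apply: alg_sum => s; apply: alg_mul; first exact: alg_cst.
by apply: alg_prod.
Qed.

(** Cramer's formula is used because [invmx] is defined by cases, while the adjugate is polynomial
    in the entries. *)
Lemma algmx_inv U n (F : R -> R -> R -> 'M[C]_n) : algmx U F ->
  (forall x y t, U (wv x y t) -> F x y t \in unitmx) ->
  algmx U (fun x y t => (\det (F x y t))^-1 *: \adj (F x y t)).
Proof.
move=> H u i j.
apply: (@alg_ext _ (fun x y t => (\det (F x y t))^-1 *
   ((-1) ^+ (j + i) * \det (row' j (col' i (F x y t)))))).
  by move=> x y t; rewrite !mxE.
apply: alg_mul.
  by apply: alg_inv; [move=> x y t /u; rewrite -unitfE|exact: alg_det].
apply: alg_mul; first exact: alg_cst.
apply: alg_det => i' j'.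
apply: (@alg_ext _ (fun x y t => F x y t (lift j i') (lift i j'))) => //.
by move=> x y t; rewrite !mxE.
Qed.

(** Extends identities across the isolated exceptional points: raising x by h moves w by exactly h,
    which leaves such a point. *)
Lemma alg_zero U G x y t : copen U -> alg z U G -> U (wv x y t) ->
  (exists2 del : R, 0 < del & forall h, 0 < h < del -> G (x + h) y t = 0) ->
  G x y t = 0.
Proof.
move=> oU AG Uw [d1 d10 B1]; have [G1 _ H] := alg_ddir oU AG 1 0 0.
have /ddir_x/cder_rcont cG := H _ _ _ Uw.
apply: (@norm1_le_eps _ _ 1) => e e0; rewrite mul1r.
have [d2 d20 B2] := cG e e0.
pose h := Num.min d1 d2 / 2.
have m0 : 0 < Num.min d1 d2 by rewrite lt_min d10.
have h0 : 0 < h by rewrite divr_gt0.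
have : h < Num.min d1 d2 by rewrite ltr_pdivrMr// ltr_pMr// ltrDl.
rewrite lt_min => /andP[h1 h2].
have := B2 h; rewrite gtr0_norm// => /(_ h2).
by rewrite B1 ?h0// sub0r norm1N.
Qed.

End matrix_calculus.

(** * Local holomorphic frames and the projections they define *)

Section frames.
Local Open Scope sesquilinear_scope.
Variable R : realType.
Local Notation C := R[i].

Lemma finite_min (I : finType) (r : I -> R) : (forall i, 0 < r i) ->
  exists2 r0 : R, 0 < r0 & forall i, r0 <= r i.
Proof.
move=> H.
have [r0 r00 B] : exists2 r0 : R, 0 < r0 & forall i, i \in enum I -> r0 <= r i.
  elim: (enum I) => [|i s [r0 r00 IH]]; first by exists 1.
  exists (Num.min r0 (r i)); first by rewrite lt_min r00 H.
  move=> j; rewrite inE => /orP[/eqP->|/IH js]; first by rewrite ge_min lexx orbT.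
  by rewrite ge_min js.
by exists r0 => // i; apply: B; rewrite mem_enum.
Qed.

Lemma hol1_sub (U U' : C -> Prop) f f' : (forall w, U' w -> U w) ->
  hol1 U f f' -> hol1 U' f f'.
Proof. by move=> s H w /s /H. Qed.

Lemma hol1_shift U f f' (om : C) : hol1 U f f' ->
  hol1 (fun w => U (w + om)) (fun w => f (w + om)) (fun w => f' (w + om)).
Proof.
move=> H w /H[d c]; split=> e e0.
  have [del d0 B] := d e e0; exists del => // h /B.
  by rewrite [w + om + h]addrAC.
have [del d0 B] := c e e0; exists del => // h /B.
by rewrite [w + om + h]addrAC.
Qed.

Lemma copenI (U U' : C -> Prop) : copen U -> copen U' -> copen (fun w => U w /\ U' w).
Proof.
move=> o o' w [/o[d d0 B] /o'[d' d0' B']].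
exists (Num.min d d'); first by rewrite lt_min d0.
by move=> h; rewrite lt_min => /andP[/B ? /B' ?].
Qed.

Lemma copen_shift (U : C -> Prop) om : copen U -> copen (fun w => U (w + om)).
Proof.
move=> o w /o[d d0 B]; exists d => // h /B.
by rewrite [w + om + h]addrAC.
Qed.

Definition frame_on n k (L : C -> {vspace 'cV[C]_n}) (U : C -> Prop)
    (W W' : C -> 'M[C]_(n, k)) : Prop :=
  (forall i j, hol1 U (fun w => W w i j) (fun w => W' w i j)) /\
  (forall w, U w -> \rank (W w) = k /\ L w = colspan (W w)).

Lemma holomorphic_Gr_frame n k (L : C -> {vspace 'cV[C]_n}) :
  holomorphic_Gr k L -> forall w0, exists U W W',
  [/\ copen U, U w0 & @frame_on n k L U W W'].
Proof.
move=> HL w0; have [W hW /nbhs_norm1P[del d0 B]] := HL w0.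
have ex (p : 'I_n * 'I_k) : exists q : R * (C -> C), 0 < q.1 /\
    hol1 (in_square w0 q.1) (fun w => W w p.1 p.2) q.2.
  have [rho r0 [f' Hf]] := holomorphic_at_hol1 (hW p.1 p.2).
  by exists (rho, f').
have [q Hq] := choice ex.
have [r0 r00 Hr] := finite_min (fun p => (Hq p).1).
pose rho := Num.min r0 (del / 2).
have rho0 : 0 < rho by rewrite lt_min r00 divr_gt0.
exists (in_square w0 rho), W, (fun w => \matrix_(i, j) (q (i, j)).2 w).
split; first exact: copen_square.
  by rewrite /in_square subrr normr0.
split.
  move=> i j; have [_ H] := Hq (i, j).
  have -> : (fun w => (\matrix_(i, j) (q (i, j)).2 w) i j) = (q (i, j)).2.
    by apply/funext => w; rewrite mxE.
  apply: hol1_sub H => w [h1 h2].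
  have rr : rho <= (q (i, j)).1 by apply: le_trans (Hr (i, j)); rewrite ge_min lexx.
  by split; [apply: lt_le_trans h1 rr|apply: lt_le_trans h2 rr].
move=> w [h1 h2]; have -> : w = w0 + (w - w0) by rewrite subrKC.
have rr : rho <= del / 2 by rewrite ge_min lexx orbT.
by apply: B; rewrite /norm1; lra.
Qed.

Variable z : C.
Local Notation wv := (soliton_var z).

Lemma algmx_colproj n k U (W W' : C -> 'M[C]_(n, k)) :
  (forall i j, hol1 U (fun w => W w i j) (fun w => W' w i j)) ->
  (forall w, U w -> \rank (W w) = k) ->
  exists2 Q, algmx z U Q &
    forall x y t, U (wv x y t) -> colproj (W (wv x y t)) = Q x y t.
Proof.
move=> HW rW.
pose G x y t := (W (wv x y t))^t* *m W (wv x y t).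
have uG x y t : U (wv x y t) -> G x y t \in unitmx.
  by move=> /rW; exact: gram_unit.
have AW : algmx z U (fun x y t => W (wv x y t)).
  by move=> i j; exact: (alg_hol _ (HW i j)).
have AG : algmx z U G by apply: algmxM => //; exact: algmx_adj.
exists (fun x y t => W (wv x y t) *m ((\det (G x y t))^-1 *: \adj (G x y t)) *m
    (W (wv x y t))^t*).
  by apply: algmxM; [apply: algmxM => //; exact: algmx_inv|exact: algmx_adj].
move=> x y t Uw; rewrite /colproj; congr (_ *m _ *m _).
by have := uG _ _ _ Uw; rewrite /invmx /G => ->.
Qed.

End frames.

(** * The derivatives of the projection *)

Section one_soliton_calculus.
Local Open Scope sesquilinear_scope.
Variable R : realType.
Local Notation C := R[i].
Variables (n k : nat) (z : C) (L : C -> {vspace 'cV[C]_n}).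
Variable P : R -> R -> R -> 'M[C]_n.
Local Notation wv := (soliton_var z).
Local Notation cj := Num.conj.
Hypothesis z0 : z != 0.
Hypothesis HL : holomorphic_Gr k L.
Hypothesis HP : forall x y t, hermitian_projection_onto (P x y t) (L (wv x y t)).

Lemma projection_local x y t : exists U (W W' : C -> 'M[C]_(n, k)) Q,
  [/\ copen U, U (wv x y t),
      forall i j, hol1 U (fun w => W w i j) (fun w => W' w i j), algmx z U Q &
      forall x' y' t', U (wv x' y' t') ->
        [/\ \rank (W (wv x' y' t')) = k, P x' y' t' = colproj (W (wv x' y' t')) &
            P x' y' t' = Q x' y' t']].
Proof.
have [U [W [W' [oU Uw [hW rW]]]]] := holomorphic_Gr_frame HL (wv x y t).
have [Q AQ HQ] := algmx_colproj z hW (fun w Uw => (rW w Uw).1).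
exists U, W, W', Q; split => // x' y' t' Uw'.
have [r l] := rW _ Uw'.
have E : P x' y' t' = colproj (W (wv x' y' t')).
  by apply: hermitian_projection_colproj => //; rewrite -l.
by split => //; rewrite E HQ.
Qed.

Lemma projection_loc_alg i j : loc_alg z (fun x y t => P x y t i j).
Proof.
move=> x y t; have [U [W [W' [Q [oU Uw _ AQ E]]]]] := projection_local x y t.
exists U, (fun x y t => Q x y t i j); split => // x' y' t' /E[_ _ ->].
by [].
Qed.

Lemma smooth_affine (A : 'M[C]_n) (b : C) : smooth (fun x y t => A + b *: P x y t).
Proof.
move=> m i j; apply: (@loc_alg_Ck _ z).
move=> x y t; have [U [G [oU Uw AG E]]] := projection_loc_alg i j x y t.
exists U, (fun x y t => A i j + b * G x y t); split => //.
  by apply: alg_add; [exact: alg_cst|apply: alg_mul => //; exact: alg_cst].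
by move=> x' y' t' /E Eq; rewrite !mxE Eq.
Qed.

(** A global name for the directional derivative of P, although formulas for it are local; by [dPP]
    the default 0 does not occur. *)
Definition dP (a b c x y t : R) : 'M[C]_n :=
  \matrix_(i, j) xget 0 [set D | ddir (fun x y t => P x y t i j) a b c x y t D].

Lemma dPP a b c x y t : ddirmx P a b c x y t (dP a b c x y t).
Proof.
move=> i j; rewrite mxE.
have [F' _ H] := loc_alg_ddir a b c (projection_loc_alg i j).
apply: (@xgetPex _ 0 [set D | ddir (fun x y t => P x y t i j) a b c x y t D]).
by exists (F' x y t); exact: H.
Qed.

Lemma dP_mixed a b c a' b' c' x y t : exists M,
  ddirmx (dP a b c) a' b' c' x y t M /\ ddirmx (dP a' b' c') a b c x y t M.
Proof.
have [U [W [W' [Q [oU Uw _ AQ E]]]]] := projection_local x y t.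
have ex (p : 'I_n * 'I_n) : exists m,
    ddir (fun x y t => dP a b c x y t p.1 p.2) a' b' c' x y t m /\
    ddir (fun x y t => dP a' b' c' x y t p.1 p.2) a b c x y t m.
  case: p => i j /=.
  have [G1 [G2 [G12 [_ _ _ H]]]] := alg_ddir2 oU (AQ i j) a b c a' b' c'.
  have EP d e f x1 y1 t1 D : U (wv x1 y1 t1) ->
      ddir (fun x y t => Q x y t i j) d e f x1 y1 t1 D -> dP d e f x1 y1 t1 i j = D.
    move=> Uw1 HD; apply: ddir_unique (dPP d e f x1 y1 t1 i j) _.
    by apply: (ddir_ext oU Uw1) HD => x' y' t' /E[_ _ ->].
  have [_ _ h3 h4] := H _ _ _ Uw.
  exists (G12 x y t); split.
    by apply: (ddir_ext oU Uw) h3 => x' y' t' Uw'; apply: EP => //; have [] := H _ _ _ Uw'.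
  by apply: (ddir_ext oU Uw) h4 => x' y' t' Uw'; apply: EP => //; have [] := H _ _ _ Uw'.
have [m Hm] := choice ex.
exists (\matrix_(i, j) m (i, j)).
by split=> i j; rewrite mxE; have [] := Hm (i, j).
Qed.

Lemma soliton_var_x : wv 1 0 0 = 1.
Proof. by rewrite /soliton_var rmorph1 rmorph0 !mulr0 !addr0. Qed.

(* Differentiate P W = W for a local holomorphic frame W. *)
Lemma dP_right a b c x y t :
  dP a b c x y t *m P x y t = wv a b c *: (dP 1 0 0 x y t *m P x y t).
Proof.
have [U [W [W' [Q [oU Uw hW _ E]]]]] := projection_local x y t.
have dW d e f : ddirmx (fun x y t => W (wv x y t)) d e f x y t
    (wv d e f *: W' (wv x y t)).
  move=> i j; rewrite mxE mulrC.
  apply: (@cder_comp _ (fun w => W w i j)); first exact: ddir_soliton_var.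
  by rewrite !mulr0 !addr0; have [] := hW i j _ Uw.
have key d e f : dP d e f x y t *m W (wv x y t) =
    wv d e f *: (W' (wv x y t) - P x y t *m W' (wv x y t)).
  have D1 := ddirmxM (dPP d e f x y t) (dW d e f).
  have D2 : ddirmx (fun x y t => W (wv x y t)) d e f x y t
     (dP d e f x y t *m W (wv x y t) + P x y t *m (wv d e f *: W' (wv x y t))).
    move=> i j; apply: (ddir_ext oU Uw) (D1 i j) => x' y' t' /E[r -> _].
    by rewrite colprojW.
  have := ddirmx_unique D2 (dW d e f).
  move=> /(canRL (addrK _)) ->; rewrite scalerBr; congr (_ - _).
  by rewrite -scalemxAr.
have [r EP _] := E _ _ _ Uw.
rewrite [P x y t in LHS]EP [X in _ *: (_ *m X)]EP /colproj !mulmxA !key.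
by rewrite soliton_var_x scale1r -!scalemxAl.
Qed.

Lemma adjZ m p (c : C) (A : 'M[C]_(m, p)) : (c *: A)^t* = cj c *: A^t*.
Proof. by apply/matrixP => i j; rewrite !mxE rmorphM. Qed.

Lemma dP_adj a b c x y t : (dP a b c x y t)^t* = dP a b c x y t.
Proof.
have := ddirmx_adj (dPP a b c x y t).
have -> : (fun x y t => (P x y t)^t*) = P.
  by apply/funext => u; apply/funext => v; apply/funext => w; have [] := HP u v w.
by move=> H; exact: ddirmx_unique H (dPP a b c x y t).
Qed.

Lemma projection_adj x y t : (P x y t)^t* = P x y t.
Proof. by have [] := HP x y t. Qed.

Lemma projection_idem x y t : P x y t *m P x y t = P x y t.
Proof. by have [] := HP x y t. Qed.

Lemma dP_left a b c x y t :
  P x y t *m dP a b c x y t = cj (wv a b c) *: (P x y t *m dP 1 0 0 x y t).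
Proof.
have := congr1 (fun A => A^t*) (dP_right a b c x y t).
by rewrite adjZ !adjM !dP_adj projection_adj.
Qed.

Lemma dP_idem a b c x y t :
  dP a b c x y t = dP a b c x y t *m P x y t + P x y t *m dP a b c x y t.
Proof.
have := ddirmxM (dPP a b c x y t) (dPP a b c x y t).
have -> : (fun x y t => P x y t *m P x y t) = P.
  by do 3 (apply/funext => ?); exact: projection_idem.
by move=> H; exact: ddirmx_unique (dPP a b c x y t) H.
Qed.

(** The block of P_x from the image of P to its kernel; [Ym] is the block in the opposite direction.
    The diagonal blocks of P_x vanish. *)
Definition Xm x y t := dP 1 0 0 x y t *m P x y t.
Definition Ym x y t := P x y t *m dP 1 0 0 x y t.

Lemma dPE a b c x y t :
  dP a b c x y t = wv a b c *: Xm x y t + cj (wv a b c) *: Ym x y t.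
Proof. by rewrite {1}dP_idem dP_right dP_left. Qed.

Lemma PdPP x y t : P x y t *m dP 1 0 0 x y t *m P x y t = 0.
Proof.
have := congr1 (fun A => P x y t *m A *m P x y t) (dP_idem 1 0 0 x y t).
rewrite /= mulmxDr mulmxDl !mulmxA projection_idem.
rewrite -[P x y t *m dP 1 0 0 x y t *m P x y t *m P x y t]mulmxA projection_idem.
by move=> /eqP; rewrite -subr_eq0 opprD addrA subrr sub0r oppr_eq0 => /eqP.
Qed.

Lemma XmP x y t : Xm x y t *m P x y t = Xm x y t.
Proof. by rewrite /Xm -mulmxA projection_idem. Qed.
Lemma PXm x y t : P x y t *m Xm x y t = 0.
Proof. by rewrite /Xm mulmxA PdPP. Qed.
Lemma YmP x y t : Ym x y t *m P x y t = 0.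
Proof. exact: PdPP. Qed.
Lemma PYm x y t : P x y t *m Ym x y t = Ym x y t.
Proof. by rewrite /Ym mulmxA projection_idem. Qed.
Lemma XmXm x y t : Xm x y t *m Xm x y t = 0.
Proof. by rewrite {1}/Xm -mulmxA PXm mulmx0. Qed.
Lemma YmYm x y t : Ym x y t *m Ym x y t = 0.
Proof. by rewrite {2}/Ym mulmxA YmP mul0mx. Qed.

(** Since X P = X and Y P = 0, right multiplication scales X alone; on the left, [simple_comb], it
    scales Y alone. *)
Lemma comb_simple (a b g : C) x y t :
  (a *: Xm x y t + b *: Ym x y t) *m ((1%:M - P x y t) + g *: P x y t) =
  (a * g) *: Xm x y t + b *: Ym x y t.
Proof.
rewrite mulmxDr mulmxBr mulmx1 -scalemxAr !mulmxDl -!scalemxAl XmP YmP.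
rewrite !scaler0 !addr0 [a *: _ + b *: _]addrC addrK scalerA.
by rewrite addrC [g * a]mulrC.
Qed.

Lemma simple_comb (a b g : C) x y t :
  ((1%:M - P x y t) + g *: P x y t) *m (a *: Xm x y t + b *: Ym x y t) =
  a *: Xm x y t + (g * b) *: Ym x y t.
Proof.
rewrite mulmxDl mulmxBl mul1mx -scalemxAl !mulmxDr -!scalemxAr PXm PYm.
by rewrite scaler0 add0r addrK scalerA.
Qed.

Lemma comb_mul (a b c d : C) x y t :
  (a *: Xm x y t + b *: Ym x y t) *m (c *: Xm x y t + d *: Ym x y t) =
  (a * d) *: (Xm x y t *m Ym x y t) + (b * c) *: (Ym x y t *m Xm x y t).
Proof.
rewrite mulmxDl !mulmxDr -!scalemxAl -!scalemxAr XmXm YmYm !scaler0 add0r addr0.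
by rewrite !scalerA.
Qed.

Lemma simple_ddir (f : C) a b c x y t :
  ddirmx (fun x y t => (1%:M - P x y t) + f *: P x y t) a b c x y t
    ((f - 1) *: dP a b c x y t).
Proof.
apply: ddirmx_eq.
  apply: ddirmxD; last by apply: ddirmxZ; exact: dPP.
  apply: ddirmxD; first exact: ddirmx_cst.
  by apply: ddirmxN; exact: dPP.
by rewrite add0r scalerBl scale1r addrC.
Qed.

Lemma soliton_var_u : wv 0 1 1 = z.
Proof. by rewrite /soliton_var rmorph1 rmorph0; field. Qed.
Lemma soliton_var_v : wv 0 (-1) 1 = z^-1.
Proof. by rewrite /soliton_var rmorphN rmorph1 rmorph0; field. Qed.
Lemma soliton_var_y : wv 0 1 0 = (z - z^-1) / 2.
Proof. by rewrite /soliton_var rmorph1 rmorph0; field. Qed.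
Lemma soliton_var_t : wv 0 0 1 = (z + z^-1) / 2.
Proof. by rewrite /soliton_var rmorph1 rmorph0; field. Qed.

Let zc0 : cj z != 0. Proof. by rewrite fmorph_eq0. Qed.

(** Along u the derivative of w is z, so X carries (f - 1)(lam - z) / f and Y carries (f - 1)(lam -
    cj z). As f - 1 = (cj z - z) / (lam - cj z), both equal cj z - z, free of lam. Along v, where
    the derivative is 1 / z, the same cancellation occurs. *)
Lemma extended_soliton_A lam x y t : lam != z -> lam != cj z ->
  (lam *: Dx (fun x y t => extended_1_soliton z P x y t lam) x y t -
     Du (fun x y t => extended_1_soliton z P x y t lam) x y t)
    *m invmx (extended_1_soliton z P x y t lam) =
  (cj z - z) *: (Xm x y t + Ym x y t).
Proof.
move=> l1 l2; rewrite /extended_1_soliton /simple_element.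
set f := (lam - z) / (lam - cj z).
have lz : lam - z != 0 by rewrite subr_eq0.
have lzc : lam - cj z != 0 by rewrite subr_eq0.
have f0 : f != 0 by rewrite mulf_neq0// invr_eq0.
rewrite (DxE (simple_ddir f 1 0 0 x y t)) (DuE (simple_ddir f 0 1 1 x y t)).
rewrite (simple_inv (projection_idem x y t) f0) !dPE soliton_var_x soliton_var_u rmorph1.
have -> : lam *: ((f - 1) *: (1 *: Xm x y t + 1 *: Ym x y t)) -
   (f - 1) *: (z *: Xm x y t + cj z *: Ym x y t) =
   ((f - 1) * (lam - z)) *: Xm x y t + ((f - 1) * (lam - cj z)) *: Ym x y t.
  by move: (Xm x y t) (Ym x y t) => X Y; apply/matrixP => i j; rewrite !mxE; ring.
rewrite comb_simple scalerDr; by congr (_ *: _ + _ *: _); rewrite /f; field;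
  repeat (apply/andP; split); assumption.
Qed.

Lemma extended_soliton_B lam x y t : lam != z -> lam != cj z ->
  (lam *: Dv (fun x y t => extended_1_soliton z P x y t lam) x y t -
     Dx (fun x y t => extended_1_soliton z P x y t lam) x y t)
    *m invmx (extended_1_soliton z P x y t lam) =
  (cj z - z) *: (z^-1 *: Xm x y t + (cj z)^-1 *: Ym x y t).
Proof.
move=> l1 l2; rewrite /extended_1_soliton /simple_element.
set f := (lam - z) / (lam - cj z).
have lz : lam - z != 0 by rewrite subr_eq0.
have lzc : lam - cj z != 0 by rewrite subr_eq0.
have f0 : f != 0 by rewrite mulf_neq0// invr_eq0.
rewrite (DxE (simple_ddir f 1 0 0 x y t)) (DvE (simple_ddir f 0 (-1) 1 x y t)).
rewrite (simple_inv (projection_idem x y t) f0) !dPE soliton_var_x soliton_var_v rmorph1 fmorphV.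
have -> : lam *: ((f - 1) *: (z^-1 *: Xm x y t + (cj z)^-1 *: Ym x y t)) -
   (f - 1) *: (1 *: Xm x y t + 1 *: Ym x y t) =
   ((f - 1) * (lam - z) / z) *: Xm x y t + ((f - 1) * (lam - cj z) / cj z) *: Ym x y t.
  move: (Xm x y t) (Ym x y t) => X Y; apply/matrixP => i j; rewrite !mxE; field.
  by repeat (apply/andP; split); assumption.
rewrite comb_simple scalerDr !scalerA; congr (_ *: _ + _ *: _); rewrite /f; field;
  by repeat (apply/andP; split); assumption.
Qed.

Lemma extended_soliton_ward :
  extended_ward_map [set lam | lam != z /\ lam != cj z] (extended_1_soliton z P).
Proof.
have f0 lam : lam != z -> lam != cj z -> (lam - z) / (lam - cj z) != 0.
  by move=> a b; rewrite mulf_neq0// ?invr_eq0 subr_eq0.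
split.
- move=> lam _; rewrite /extended_1_soliton /simple_element.
  set f := (lam - z) / _.
  have -> : (fun x y t => 1%:M - P x y t + f *: P x y t) =
      (fun x y t => 1%:M + (f - 1) *: P x y t).
    do 3 (apply/funext => ?); rewrite scalerBl scale1r -addrA; congr (_ + _).
    by rewrite addrC.
  exact: smooth_affine.
- move=> x y t lam [l1 l2]; apply: simple_unit; first exact: projection_idem.
  exact: f0.
- move=> x y t lam1 lam2 [a1 a2] [b1 b2] /=.
  exact: etrans (extended_soliton_A x y t a1 a2) (esym (extended_soliton_A x y t b1 b2)).
- move=> x y t lam1 lam2 [a1 a2] [b1 b2] /=.
  exact: etrans (extended_soliton_B x y t a1 a2) (esym (extended_soliton_B x y t b1 b2)).
- move=> x y t lam [l1 l2] _; rewrite /extended_1_soliton /simple_element.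
  set f := (lam - z) / (lam - cj z).
  (* Conjugation exchanges numerator and denominator of f, so the adjoint at the conjugate parameter
     is the inverse at lam. *)
  have -> : (1%:M - P x y t + ((cj lam - z) / (cj lam - cj z)) *: P x y t)^t* =
     1%:M - P x y t + f^-1 *: P x y t.
    have -> : f^-1 = cj ((cj lam - z) / (cj lam - cj z)).
      by rewrite rmorphM fmorphV !rmorphB /= !conjCK /f invf_div.
    rewrite -[in RHS](projection_adj x y t).
    apply/matrixP => i j; rewrite !mxE !rmorphD !rmorphN !rmorphM eq_sym.
    by rewrite rmorphMn rmorph1.
  have fn0 : f^-1 != 0 by rewrite invr_eq0 f0.
  by have := simple_mulV (projection_idem x y t) fn0; rewrite invrK.
Qed.

(** The hypothesis is P P = P differentiated twice, with S for P_xx and A for (P_x)^2; sandwiching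
    it between two factors p leaves a single unknown p S p. *)
Lemma idem_second_derivative (p S A : 'M[C]_n) : p *m p = p ->
  S = (S *m p + A) + (A + p *m S) -> p *m S *m p = - (p *m A *m p + p *m A *m p).
Proof.
move=> pp ES; have := congr1 (fun B => p *m B *m p) ES.
rewrite /= !mulmxDr !mulmxDl !mulmxA pp -[p *m S *m p *m p]mulmxA pp.
move: (p *m S *m p) (p *m A *m p) => Q B E; apply/eqP; rewrite -addr_eq0; apply/eqP.
apply: (addrI Q); rewrite addr0 [RHS]E.
by rewrite -!addrA; congr (_ + _); rewrite addrCA; congr (_ + _); rewrite addrC.
Qed.

(* The second derivatives of P are determined by S, the second x-derivative. *)
Lemma XY_ddir x y t : exists S, forall a b c,
  ddirmx Xm a b c x y t (wv a b c *: (S *m P x y t) +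
    (2 * wv a b c - cj (wv a b c)) *: (Ym x y t *m Xm x y t) +
    cj (wv a b c) *: (Xm x y t *m Ym x y t)) /\
  ddirmx Ym a b c x y t (cj (wv a b c) *: (P x y t *m S) +
    wv a b c *: (Xm x y t *m Ym x y t) +
    (2 * cj (wv a b c) - wv a b c) *: (Ym x y t *m Xm x y t)).
Proof.
have [S [HS _]] := dP_mixed 1 0 0 1 0 0 x y t.
set X := Xm x y t; set Y := Ym x y t; set p := P x y t.
set XY := X *m Y; set YX := Y *m X.
have p1 : dP 1 0 0 x y t = 1 *: X + 1 *: Y by rewrite dPE soliton_var_x rmorph1.
have p11 : dP 1 0 0 x y t *m dP 1 0 0 x y t = XY + YX.
  by rewrite p1 comb_mul !mul1r !scale1r.
have Xx : ddirmx Xm 1 0 0 x y t (S *m p + (XY + YX)).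
  by rewrite -p11; apply: ddirmxM => //; exact: dPP.
have Yx : ddirmx Ym 1 0 0 x y t ((XY + YX) + p *m S).
  by rewrite -p11; apply: ddirmxM => //; exact: dPP.
have ES : S = (S *m p + (XY + YX)) + ((XY + YX) + p *m S).
  apply: ddirmx_unique HS _.
  have -> : dP 1 0 0 = (fun x y t => Xm x y t + Ym x y t).
    by apply/funext => u; apply/funext => v; apply/funext => w; rewrite {1}dP_idem.
  exact: ddirmxD.
have XYp : XY *m p = 0 by rewrite -mulmxA YmP mulmx0.
have YXp : YX *m p = YX by rewrite -mulmxA XmP.
have pXY : p *m XY = 0 by rewrite mulmxA PXm mul0mx.
have pYX : p *m YX = YX by rewrite mulmxA PYm.
have pp : p *m p = p by exact: projection_idem.
have pSp : p *m S *m p = - (YX + YX).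
  rewrite (idem_second_derivative pp ES) mulmxDr pXY pYX add0r YXp.
  by [].
have Spp : S *m p *m p = S *m p by rewrite -mulmxA pp.
have ppS : p *m (p *m S) = p *m S by rewrite mulmxA pp.
exists S => a b c; set nu := wv a b c.
(* The derivative of P_x along (a, b, c) equals the x-derivative of nu X + cj nu Y, which [Xx] and
   [Yx] express through [S]. *)
have [M [HM1 HM2]] := dP_mixed 1 0 0 a b c x y t.
have EM : M = nu *: (S *m p + (XY + YX)) + cj nu *: ((XY + YX) + p *m S).
  apply: ddirmx_unique HM2 _.
  have -> : dP a b c = (fun x y t => nu *: Xm x y t + cj nu *: Ym x y t).
    by apply/funext => u; apply/funext => v; apply/funext => w; exact: dPE.
  by apply: ddirmxD; apply: ddirmxZ.
split.
  apply: ddirmx_eq; first by apply: ddirmxM; [exact: HM1|exact: dPP].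
  rewrite EM p1 (dPE a b c) comb_mul -/p -/nu -/XY -/YX.
  rewrite mulmxDl -!scalemxAl !mulmxDl Spp XYp YXp pSp.
  move: (S *m p) XY YX {XYp YXp pXY pYX pSp EM ES Xx Yx p11} => SP XY YX.
  by apply/matrixP => i j; rewrite !mxE; ring.
apply: ddirmx_eq; first by apply: ddirmxM; [exact: dPP|exact: HM1].
rewrite EM p1 (dPE a b c) comb_mul -/p -/nu -/XY -/YX.
rewrite mulmxDr -!scalemxAr !mulmxDr ppS pXY pYX (mulmxA p S p) pSp.
move: (p *m S) XY YX {XYp YXp pXY pYX pSp EM ES Xx Yx p11} => SP XY YX.
by apply/matrixP => i j; rewrite !mxE; ring.
Qed.

(** J^-1 J_d = (q - 1)(nu X + q^-1 cj nu Y). The terms with S are multiplied by nu_t^2 - nu_x^2 -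
    nu_y^2 = 0 or its conjugate, and the rest is a multiple of XY - YX. With N = |nu_t|^2 - 1 -
    |nu_y|^2 = (q - 1)^2 / (2 q) and M = nu_t cj nu_y - nu_y cj nu_t = (q^2 - 1) / (2 q), the
    equation becomes (q + 1) N = (q - 1) M. *)
Lemma soliton_ward_equation (c : C) : c != 0 ->
  ward_equation (fun x y t => c *: ((1%:M - P x y t) + (cj z / z) *: P x y t)).
Proof.
move=> c0; set q := cj z / z.
have q0 : q != 0 by rewrite mulf_neq0// invr_eq0.
set J := fun x y t => _.
have JV x y t : invmx (J x y t) = c^-1 *: ((1%:M - P x y t) + q^-1 *: P x y t).
  have u := simple_unit (projection_idem x y t) q0.
  rewrite invmxZ ?(simple_inv (projection_idem x y t) q0)//.
  by rewrite unitmxZ// unitfE.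
have dJ a b d x y t : ddirmx J a b d x y t (c *: ((q - 1) *: dP a b d x y t)).
  by apply: ddirmxZ; exact: simple_ddir.
have lc a b d x y t : invmx (J x y t) *m (c *: ((q - 1) *: dP a b d x y t)) =
    ((q - 1) * wv a b d) *: Xm x y t + ((q - 1) * q^-1 * cj (wv a b d)) *: Ym x y t.
  rewrite JV -scalemxAl -scalemxAr scalerA mulVf// scale1r -scalemxAr dPE simple_comb.
  by rewrite scalerDr !scalerA mulrA.
pose cmb (al be : C) (x y t : R) : 'M[C]_n := al *: Xm x y t + be *: Ym x y t.
have AE : (fun x y t => invmx (J x y t) *m Dt J x y t) =
    cmb ((q - 1) * wv 0 0 1) ((q - 1) * q^-1 * cj (wv 0 0 1)).
  apply/funext => u; apply/funext => v; apply/funext => w.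
  by rewrite (DtE (dJ _ _ _ _ _ _)) lc.
have BE : (fun x y t => invmx (J x y t) *m Dx J x y t) =
    cmb ((q - 1) * wv 1 0 0) ((q - 1) * q^-1 * cj (wv 1 0 0)).
  apply/funext => u; apply/funext => v; apply/funext => w.
  by rewrite (DxE (dJ _ _ _ _ _ _)) lc.
have EE : (fun x y t => invmx (J x y t) *m Dy J x y t) =
    cmb ((q - 1) * wv 0 1 0) ((q - 1) * q^-1 * cj (wv 0 1 0)).
  apply/funext => u; apply/funext => v; apply/funext => w.
  by rewrite (DyE (dJ _ _ _ _ _ _)) lc.
suff H (A B E : R -> R -> R -> 'M[C]_n) :
    A = cmb ((q - 1) * wv 0 0 1) ((q - 1) * q^-1 * cj (wv 0 0 1)) ->
    B = cmb ((q - 1) * wv 1 0 0) ((q - 1) * q^-1 * cj (wv 1 0 0)) ->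
    E = cmb ((q - 1) * wv 0 1 0) ((q - 1) * q^-1 * cj (wv 0 1 0)) ->
    forall x y t, Dt A x y t - Dx B x y t - Dy E x y t -
      (A x y t *m E x y t - E x y t *m A x y t) = 0.
  exact: (H _ _ _ AE BE EE).
move=> -> -> -> x y t.
have [S HS] := XY_ddir x y t.
have D al be a b d := ddirmxD (ddirmxZ al (HS a b d).1) (ddirmxZ be (HS a b d).2).
rewrite (DtE (D _ _ _ _ _)) (DxE (D _ _ _ _ _)) (DyE (D _ _ _ _ _)) /cmb !comb_mul.
rewrite soliton_var_x soliton_var_y soliton_var_t.
rewrite !rmorphM !rmorphD !rmorphN rmorph1 !fmorphV rmorph_nat /=.
move: (S *m P x y t) (P x y t *m S) (Xm x y t *m Ym x y t) (Ym x y t *m Xm x y t).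
move=> SP PS XY YX; apply/matrixP => i j; rewrite !mxE /q.
move: (SP i j) (PS i j) (XY i j) (YX i j) (cj z) zc0 => a1 a2 a3 a4 zc zc0'.
by field; repeat (apply/andP; split); assumption.
Qed.

End one_soliton_calculus.

(** * Periods *)

Section periods.
Variable R : realType.
Local Notation C := R[i].
Variables (n k : nat) (z : C) (V : C -> 'M[C]_(n, k)) (L : C -> {vspace 'cV[C]_n}).
Local Notation wv := (soliton_var z).
Hypothesis mV : forall i j, meromorphic (fun w => V w i j).
Hypothesis HL : extended_colspan V L.

Lemma meromorphic_mx_punctured w0 : exists2 del : R, 0 < del &
  forall h, norm1 h < del -> h != 0 -> holomorphic_mx_at V (w0 + h).
Proof.
have : \forall w \near (w0 : C^o)^', forall i j, holomorphic_at (fun w => V w i j) w.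
  by apply: filter_forall => i; apply: filter_forall => j; exact: (meromorphic_at_punctured (mV i j w0)).
rewrite near_withinE => /nbhs_norm1P[del d0 B]; exists del => // h hd h0 i j.
by apply: B => //; apply: contra h0; rewrite -subr_eq0 addrAC subrr add0r.
Qed.

(* Away from the poles this is the periodicity of V; the two local holomorphic
   extensions then agree at the remaining points by continuity. *)
Lemma extended_colspan_period (a b c : R) :
  (forall i j, meromorphic_period (fun w => V w i j) (wv a b c)) ->
  forall x y t, L (wv (x + a) (y + b) (t + c)) = L (wv x y t).
Proof.
move=> pV x y t; rewrite soliton_varD.
set w0 := wv x y t; set om := wv a b c.
have [hGr LV] := HL.
have [U1 [W1 [D1 [oU1 u1 [h1 r1]]]]] := holomorphic_Gr_frame hGr w0.
have [U2 [W2 [D2 [oU2 u2 [h2 r2]]]]] := holomorphic_Gr_frame hGr (w0 + om).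
pose U w := U1 w /\ U2 (w + om).
have oU : copen U by apply: copenI => //; exact: copen_shift.
have Uw0 : U w0 by [].
have [Q1 A1 E1] : exists2 Q, algmx z U Q &
    forall x y t, U (wv x y t) -> colproj (W1 (wv x y t)) = Q x y t.
  apply: (@algmx_colproj _ z n k U W1 D1).
    by move=> i j; apply: hol1_sub (h1 i j) => w [].
  by move=> w [/r1[]].
have [Q2 A2 E2] : exists2 Q, algmx z U Q &
    forall x y t, U (wv x y t) -> colproj (W2 (wv x y t + om)) = Q x y t.
  apply: (@algmx_colproj _ z n k U (fun w => W2 (w + om)) (fun w => D2 (w + om))).
    by move=> i j w [_ uw]; exact: (hol1_shift (om := om) (h2 i j) uw).
  by move=> w [_ /r2[]].
have [d1 d10 B1] := meromorphic_mx_punctured w0.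
have [d2 d20 B2] := meromorphic_mx_punctured (w0 + om).
have [d3 d30 B3] := oU _ Uw0.
have Q12 : Q1 x y t = Q2 x y t.
  apply/matrixP => i j; apply/eqP; rewrite -subr_eq0; apply/eqP.
  have AG : alg z U (fun x y t => Q1 x y t i j + -1 * Q2 x y t i j).
    by apply: alg_add => //; apply: alg_mul => //; exact: alg_cst.
  rewrite -[- _]mulN1r; apply: (alg_zero oU AG Uw0).
  (* For such h > 0 both w0 + h and its translate by [om] are points where V is holomorphic, and w0
     + h is in the common domain of the frames. *)
  exists (Num.min (Num.min d1 d2) d3); first by rewrite !lt_min d10 d20.
  move=> h /andP[h0]; rewrite !lt_min => /andP[/andP[hd1 hd2] hd3].
  have nh : norm1 h%:C = h by rewrite norm1C gtr0_norm.
  have hn0 : h%:C != 0 :> C by apply/eqP => -[/eqP]; rewrite gt_eqF.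
  have wh : wv (x + h) y t = w0 + h%:C.
    by rewrite /w0 /soliton_var rmorphD /=; ring.
  have Uh : U (wv (x + h) y t) by rewrite wh; apply: B3; rewrite nh.
  rewrite -E1// -E2// wh.
  suff -> : colproj (W1 (w0 + h%:C)) = colproj (W2 (w0 + h%:C + om)).
    by rewrite mulN1r subrr.
  rewrite wh in Uh; case: Uh => Uh1 Uh2.
  have [rk1 l1] := r1 _ Uh1; have [rk2 l2] := r2 _ Uh2.
  apply: hermitian_projection_unique (colprojP rk1) _.
  suff -> : colspan (W1 (w0 + h%:C)) = colspan (W2 (w0 + h%:C + om)) by exact: colprojP.
  rewrite -l1 -l2.
  have hV1 : holomorphic_mx_at V (w0 + h%:C) by apply: B1; rewrite ?nh.
  have hV2 : holomorphic_mx_at V (w0 + h%:C + om).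
    by rewrite addrAC; apply: B2; rewrite ?nh.
  rewrite (LV _ hV1) (LV _ hV2); congr colspan.
  by apply/matrixP => i' j'; rewrite (pV i' j').
have [rk1 ->] := r1 _ u1; have [rk2 ->] := r2 _ u2.
have [_ _ <-] := colprojP rk1; have [_ _ <-] := colprojP rk2.
by rewrite E1// E2// Q12.
Qed.

Definition spacetime_period (a b c : R) : Prop :=
  forall x y t, L (wv (x + a) (y + b) (t + c)) = L (wv x y t).

Lemma spacetime_periodD a b c a' b' c' : spacetime_period a b c ->
  spacetime_period a' b' c' -> spacetime_period (a + a') (b + b') (c + c').
Proof. by move=> H H' x y t; rewrite !addrA H' H. Qed.

Lemma spacetime_periodN a b c : spacetime_period a b c ->
  spacetime_period (- a) (- b) (- c).
Proof. by move=> H x y t; rewrite -(H (x - a)) !subrK. Qed.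

Lemma spacetime_periodZ a b c (m : int) : spacetime_period a b c ->
  spacetime_period (m%:~R * a) (m%:~R * b) (m%:~R * c).
Proof.
move=> H.
have Hn (p : nat) : spacetime_period (p%:R * a) (p%:R * b) (p%:R * c).
  elim: p => [|p IH]; first by move=> x y t; rewrite !mul0r !addr0.
  by rewrite -natr1 !mulrDl !mul1r; exact: spacetime_periodD.
case: m => p; first by rewrite -!pmulrn.
by rewrite NegzE !rmorphN /= -!pmulrn !mulNr; apply: spacetime_periodN.
Qed.

End periods.

(** * Phases e^(ia) *)

Section phases.
Variable R : realType.
Local Notation C := R[i].

Lemma expiD (a b : R) : expi (a + b) = expi a * expi b.
Proof.
apply: complex_eqP; rewrite ?ReM ?ImM /= ?cosD ?sinD; ring.
Qed.

Lemma expi0 : expi 0 = 1 :> C.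
Proof. by rewrite /expi cos0 sin0. Qed.

Lemma expiX (a : R) (m : nat) : expi a ^+ m = expi (m%:R * a).
Proof.
elim: m => [|m IH]; first by rewrite expr0 mul0r expi0.
by rewrite exprS IH -expiD -natr1 mulrDl mul1r addrC.
Qed.

Lemma conj_expi (a : R) : Num.conj (expi a) = expi (- a).
Proof. by rewrite /expi cosN sinN. Qed.

Lemma expi_neq0 (a : R) : expi a != 0.
Proof.
have := expiMN a; apply: contra_eq_neq => ->; rewrite mul0r eq_sym; exact: oner_neq0.
Qed.

End phases.

(** * The 1-soliton *)

Section soliton_group.
Local Open Scope sesquilinear_scope.
Variable R : realType.
Local Notation C := R[i].
Local Notation cj := Num.conj.

Lemma ReExpi (a : R) : complex.Re (expi a) = cos a. Proof. by []. Qed.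
Lemma ImExpi (a : R) : complex.Im (expi a) = sin a. Proof. by []. Qed.

(** The determinant is e^(2ik theta / n) to the power n, times e^(-2i theta) to the power k, hence
    1: the scalar phase of the soliton is the normalisation that achieves this. *)
Lemma soliton_SU n k (P : 'M[C]_n) (U : {vspace 'cV[C]_n}) (W : 'M[C]_(n, k)) (theta : R) :
  (0 < n)%N -> hermitian_projection_onto P U -> \rank W = k -> P = colproj W ->
  SU (expi (2 * k%:R * theta / n%:R) *: ((1%:M - P) + expi (- (2 * theta)) *: P)).
Proof.
move=> n0 [hP PP _] rW PW; set c := expi _; set q := expi _.
have n0' : n%:R != 0 :> R by rewrite pnatr_eq0 -lt0n.
split.
  apply/unitarymxP; rewrite adjZ -scalemxAl -scalemxAr scalerA.
  have -> : (1%:M - P + q *: P)^t* = 1%:M - P + q^-1 *: P.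
    have -> : q^-1 = cj q.
      rewrite conj_expi; apply: (mulfI (expi_neq0 (- (2 * theta)))).
      by rewrite -/q mulfV ?expi_neq0// expiMN.
    rewrite -[in RHS]hP; apply/matrixP => i j.
    by rewrite !mxE !rmorphD !rmorphN !rmorphM eq_sym rmorphMn rmorph1.
  by rewrite simple_mulV ?expi_neq0// conj_expi expiMN scale1r.
rewrite detZ PW det_colproj// !expiX -expiD.
by rewrite (_ : _ + _ = 0) ?expi0//; field.
Qed.

Section polar.
Variables (z : C) (r theta : R).
Hypotheses (r0 : 0 < r) (hz : z = r%:C * expi theta).

Lemma polar_neq0 : z != 0.
Proof.
rewrite hz mulf_neq0 ?expi_neq0//.
by apply/eqP => -[/eqP]; rewrite gt_eqF.
Qed.

Lemma polar_inv : z^-1 = r^-1%:C * expi (- theta).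
Proof.
apply: (mulfI polar_neq0); rewrite mulfV ?polar_neq0// hz mulrACA expiMN mulr1.
by rewrite -rmorphM mulfV ?gt_eqF.
Qed.

Lemma polar_conj_div : cj z / z = expi (- (2 * theta)).
Proof.
apply: (mulIf polar_neq0); rewrite mulfVK ?polar_neq0// hz rmorphM /= conj_expi.
have -> : - theta = - (2 * theta) + theta by ring.
by rewrite expiD; rewrite [cj _]conjc_real; ring.
Qed.

(** The coefficient of t in the imaginary part vanishes exactly when r = 1 or sin theta = 0; this is
    what separates the two cases of time periodicity. *)
Lemma soliton_var_polar (x y t : R) : soliton_var z x y t =
  cplx (x + (r - r^-1) * cos theta / 2 * y + (r + r^-1) * cos theta / 2 * t)
       ((r + r^-1) * sin theta / 2 * y + (r - r^-1) * sin theta / 2 * t).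
Proof.
rewrite /soliton_var polar_inv hz.
have -> : (2 : C)^-1 = (2^-1 : R)%:C by rewrite fmorphV rmorph_nat.
by apply: complex_eqP; rewrite !(ReImE, ReExpi, ImExpi) cosN sinN; field; rewrite gt_eqF.
Qed.

End polar.

End soliton_group.

Unset Implicit Arguments.

Theorem theorem3p1 (R : realType) (n k : nat) (hn : (0 < n)%N)
    (c1 c2 : R) (hc2 : c2 != 0)
    (z : R[i]) (r theta : R) (hr : 0 < r)
    (hz : z = r%:C * expi theta) (hzR : complex.Im z != 0)
    (a b : R) (hab : a +i* b = c1%:C + (z - z^-1) / 2 * c2%:C)
    (V : R[i] -> 'M[R[i]]_(n, k)) (hV : meromorphic_full_rank V)
    (hVell : forall i j, elliptic (fun w => V w i j) (2 * pi)%:C (a +i* b))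
    (L : R[i] -> {vspace 'cV[R[i]]_n}) (hL : extended_colspan V L)
    (P : R -> R -> R -> 'M[R[i]]_n)
    (hP : forall x y t,
       hermitian_projection_onto (P x y t) (L (soliton_var z x y t))) :
  let tau := c1 +i* c2 in
  let psi := extended_1_soliton z P in
  let J := one_soliton z theta k P in
  [/\ extended_ward_map [set lam | lam != z /\ lam != (z^*)%R] psi,
      forall lam, lam != (z^*)%R ->
        space_period (fun x y t => psi x y t lam) (2 * pi)%:C /\
        space_period (fun x y t => psi x y t lam) tau,
      forall x y t, J x y t = expi (2 * k%:R * theta / n%:R) *:
        ((1%:M - P x y t) + expi (- (2 * theta)) *: P x y t) &
      ward_map_mod (lattice (2 * pi)%:C tau) J] /\
  (r != 1 -> forall m1 m2 : int, m2 != 0 ->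
     2 * cos theta / (r - r^-1) =
       (2 * pi * m1%:~R + m2%:~R * c1) / (m2%:~R * c2) ->
     time_period J (m2%:~R * c2 * (r + r^-1) / (r - r^-1))) /\
  (r = 1 -> cos theta != 0 -> time_period J (2 * pi / cos theta)).
Proof.
move=> tau psi J.
have z0 : z != 0 := polar_neq0 hr hz.
have [hGr _] := hL.
have [mV _] := hV.
have idem := projection_idem hP.
have JE x y t : J x y t = expi (2 * k%:R * theta / n%:R) *:
    ((1%:M - P x y t) + expi (- (2 * theta)) *: P x y t).
  rewrite /J /one_soliton /extended_1_soliton /simple_element !sub0r.
  have f0 : - z / - Num.conj z != 0 by rewrite mulf_neq0 ?invr_eq0 ?oppr_eq0// fmorph_eq0.
  by rewrite (simple_inv (idem x y t) f0) invf_div invrN mulrNN (polar_conj_div hr hz).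
clearbody J.
have per1 : spacetime_period z L (2 * pi) 0 0.
  apply: (extended_colspan_period mV hL) => i j.
  have -> : soliton_var z (2 * pi) 0 0 = (2 * pi)%:C.
    by rewrite /soliton_var rmorph0 !mulr0 !addr0.
  by have [] := hVell i j.
have per2 : spacetime_period z L c1 c2 0.
  apply: (extended_colspan_period mV hL) => i j.
  have -> : soliton_var z c1 c2 0 = a +i* b.
    by rewrite hab /soliton_var rmorph0 !mulr0 !addr0.
  by have [] := hVell i j.
have Pper d e f x y t : spacetime_period z L d e f ->
    P (x + d) (y + e) (t + f) = P x y t.
  move=> H; apply: hermitian_projection_unique (hP _ _ _) _.
  by rewrite H; exact: hP.
have Jper d e f x y t : spacetime_period z L d e f ->
    J (x + d) (y + e) (t + f) = J x y t.
  by move=> H; rewrite !JE Pper.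
have perZ m1 m2 : spacetime_period z L (m1%:~R * (2 * pi) + m2%:~R * c1)
    (m2%:~R * c2) 0.
  have := spacetime_periodD (spacetime_periodZ m1 per1) (spacetime_periodZ m2 per2).
  by rewrite !mulr0 !add0r.
(* A time shift that moves w as far as the space period (A, B) does is itself a period. *)
have Tper A B T : spacetime_period z L A B 0 ->
    soliton_var z 0 0 T = soliton_var z A B 0 -> time_period J T.
  move=> H E x y t.
  have {}H : spacetime_period z L 0 0 T.
    by move=> x' y' t'; rewrite soliton_varD E -soliton_varD.
  by have := Jper 0 0 T x y t H; rewrite !addr0.
split; last split.
- split.
  + exact: extended_soliton_ward.
  + move=> lam _; split=> x y t; rewrite /psi /extended_1_soliton.
      have := Pper _ _ _ x y t per1; rewrite (addr0 t) => E.
      exact: (congr1 (fun p => simple_element z p lam) E).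
    have := Pper _ _ _ x y t per2; rewrite (addr0 t) => E.
    exact: (congr1 (fun p => simple_element z p lam) E).
  + exact: JE.
  + split; last first.
      move=> om [m1 [m2 E]] x y t.
      have zE (w : R[i]) (m : int) : w *~ m = (m%:~R)%:C * w.
        by rewrite -mulrzl rmorph_int.
      have -> : complex.Re om = m1%:~R * (2 * pi) + m2%:~R * c1.
        by rewrite E !zE !ReImE !mul0r !subr0.
      have -> : complex.Im om = m2%:~R * c2.
        by rewrite E !zE !ReImE mulr0 !mul0r !addr0 add0r.
      by have := Jper _ _ _ x y t (perZ m1 m2); rewrite (addr0 t).
    have JF : J = (fun x y t => expi (2 * k%:R * theta / n%:R) *:
        ((1%:M - P x y t) + (Num.conj z / z) *: P x y t)).
      apply/funext => x; apply/funext => y; apply/funext => t.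
      by rewrite JE (polar_conj_div hr hz).
    split.
    * rewrite JF; set c := expi _; set q := _ / z.
      have -> : (fun x y t => c *: (1%:M - P x y t + q *: P x y t)) =
          (fun x y t => c *: 1%:M + (c * (q - 1)) *: P x y t).
        apply/funext => x; apply/funext => y; apply/funext => t.
        by move: (P x y t) => p; apply/matrixP => i j; rewrite !mxE; ring.
      exact: (smooth_affine hGr hP).
    * move=> x y t; rewrite JE.
      have [U [W [W' [Q [_ Uw _ _ /(_ _ _ _ Uw)[rW PW _]]]]]] := projection_local hGr hP x y t.
      exact: soliton_SU (hP x y t) rW PW.
    * by rewrite JF; apply: (soliton_ward_equation z0 hGr hP); exact: expi_neq0.
(* With A = 2 pi m1 + m2 c1 and B = m2 c2, equal imaginary parts force T = B (r + r^-1) / (r -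
   r^-1). Equal real parts then say A = 2 B cos theta / (r - r^-1), by (r + r^-1)^2 - (r - r^-1)^2 =
   4, and this is the hypothesis [E]. *)
- move=> r1 m1 m2 m20 E; apply: Tper (perZ m1 m2) _.
  rewrite !(soliton_var_polar hr hz).
  have d0 : r - r^-1 != 0.
    apply: contra r1; rewrite subr_eq0 => /eqP rE.
    have : r * r = 1 by rewrite {2}rE mulfV ?gt_eqF.
    rewrite -expr2 => /eqP; rewrite sqrf_eq1 => /orP[//|/eqP rN].
    by move: hr; rewrite rN oppr_gt0 ltr10.
  have B0 : m2%:~R * c2 != 0 by rewrite mulf_neq0// intr_eq0.
  have AE : m1%:~R * (2 * pi) + m2%:~R * c1 = 2 * cos theta / (r - r^-1) * (m2%:~R * c2).
    by rewrite E mulfVK//; ring.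
  rewrite AE; move: (m2%:~R * c2) => B.
  have rr0 : r != 0 by rewrite gt_eqF.
  have rr1 : r * r - 1 != 0.
    apply: contra d0; rewrite subr_eq0 => /eqP e.
    by rewrite subr_eq0; apply/eqP/(mulfI rr0); rewrite mulfV.
  by apply: complex_eqP; rewrite !ReImE; field; repeat (apply/andP; split);
    (assumption || by move: rr1; congr (_ != 0); ring).
(* For r = 1 a time shift T moves w by the real number T cos theta, here 2 pi. *)
- move=> r1 ct0; apply: Tper per1 _; rewrite !(soliton_var_polar hr hz) r1 invr1.
  by apply: complex_eqP; rewrite !ReImE; field.
Qed.
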